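(* Let $\mu$ be a fixed positive integer and let $q$ be a fixed odd prime power. Then, as $g\to\infty$ through positive integers, \begin{align*} \sum_{D\in\mathcal H_{2g+2}}\frac{L^{(\mu)}(\tfrac{1}{2},\chi_{D})}{(-\ln q)^{\mu}} &= \frac{2^{\mu}|D|}{\zeta_{\mathbb{A}}(2)} \left(G(1) J_{\mu}([\tfrac{g}{2}]) + \frac{G^{(\mu)}(1)}{(-\ln q)^{\mu}}\right) - \frac{2^{\mu}|D|}{\zeta_{\mathbb{A}}(2)}\sum_{n=1}^{\mu+1} j_{\mu}(n)\frac{G^{(n)}(1)}{(-\ln q)^{n}}\\ &\quad- (g+1)^{\mu} G(1) |D| q^{[\frac{g}{2}]-\frac{g+1}{2}} \\ &\quad+ \frac{2^{\mu}|D|}{\zeta_{\mathbb{A}}(2)}\sum_{a+b+c=\mu} \frac{(-1)^{c}\mu !}{a!\, b!\, c!} \frac{g^{a}\delta^{(b)}(\tfrac{1}{2})}{(-2\ln q)^{b}} \left(G(1) J_{c}([\tfrac{g-1}{2}]) + \frac{G^{(c)}(1)}{(-\ln q)^{c}}\right) \\ &\quad - \frac{2^{\mu}|D|}{\zeta_{\mathbb{A}}(2)}\sum_{a+b+c=\mu} \frac{(-1)^{c}\mu !}{a!\, b!\, c!} \frac{g^{a}\delta^{(b)}(\tfrac{1}{2})}{(-2\ln q)^{b}} \sum_{n=1}^{c+1} j_{c}(n)\frac{G^{(n)}(1)}{(-\ln q)^{n}} \\ &\quad-G(1) |D| q^{[\frac{g-1}{2}]-\frac{g}{2}}\sum_{m=0}^{\mu}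 \binom{\mu}{m} \frac{g^{\mu-m}\delta^{(m)}(\tfrac{1}{2})}{(-\ln q)^{m}} + O\left(|D|^{\frac{7}{8}} (\log_{q}|D|)^{\mu}\right), \end{align*} where $\delta(s) = \frac{1-q^{-s}}{1-q^{s-1}}$, the sums over $a+b+c=\mu$ run over triples of non-negative integers, on the right-hand side $|D|$ denotes the number $q^{2g+2}$ (so $\log_q|D|=2g+2$), and the implied constant may depend on $q$ and $\mu$ but not on $g$.
   Context: $\mathbb{F}_q$ is a finite field with $q$ elements, $q$ odd; $\mathbb{A}=\mathbb{F}_q[t]$; $\mathbb{A}^+$ is the set of monic polynomials in $\mathbb{A}$, and $\mathbb{A}^+_n$ the set of monic polynomials of degree $n$. $\mathcal H_n$ is the set of monic square-free polynomials of degree $n$. For $f\in\mathbb{A}$, $|f|=q^{\deg f}$ if $f\neq 0$ and $|0|=0$. $\zeta_{\mathbb{A}}(s)=\frac{1}{1-q^{1-s}}$, so $\zeta_{\mathbb{A}}(2)=\frac{1}{1-q^{-1}}$. For $D$ monic square-free, $\chi_D(f)=\left(\frac{D}{f}\right)$ for $f\in\mathbb{A}^+$ is the quadratic residue symbol: completely multiplicative in $f$, and for $P$ monic irreducible, $\chi_D(P)=0$ if $P\mid D$, $1$ if $P\nmid D$ and $D$ is a square modulo $P$, and $-1$ if $P\nmid D$ and $D$ is a non-square modulo $P$. The $L$-function is $L(s,\chi_D)=\sum_{f\in\mathbb{A}^+}\chi_D(f)|f|^{-s}$ for $\mathrm{Re}(s)>1$; for $D\in\mathcal H_{2g+2}$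 it equals the polynomial of degree $2g+1$ in $q^{-s}$ given by $\sum_{n=0}^{2g+1}\left(\sum_{f\in\mathbb{A}^+_n}\chi_D(f)\right)q^{-ns}$, which defines it for all complex $s$. $L^{(\mu)}(s,\chi_D)$ is the $\mu$-th derivative with respect to $s$; $\delta^{(b)}$ is the $b$-th derivative of $\delta$. For integers $k\ge 0$, $n\ge 0$, $J_k(n)=\sum_{\ell=1}^n \ell^k$, which is a polynomial in $n$ of degree $k+1$ with zero constant term; its coefficients $j_k(m)$ are defined by $J_k(n)=\sum_{m=1}^{k+1}j_k(m)n^m$. $[x]$ is the integer part of $x$. $G(s)=\sum_{L\in\mathbb{A}^+}\frac{\mu(L)}{|L|^s\prod_{P\mid L}(1+|P|)}$, where $\mu(L)$ (with a polynomial argument) is the Möbius function on monic polynomials and $P$ runs over the monic irreducible divisors of $L$; $G^{(m)}$ is its $m$-th derivative, so $\frac{G^{(m)}(s)}{(-\ln q)^m}=\sum_{L\in\mathbb{A}^+}\frac{\mu(L)\deg(L)^m}{|L|^s\prod_{P\mid L}(1+|P|)}$ (with $0^0=1$). *)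

(* Defs.v *)
From HB Require Import structures.
From mathcomp Require Import all_boot all_order all_algebra.
From mathcomp Require Import qpoly complex.
From mathcomp Require Import all_classical all_reals all_analysis.
Import Order.TTheory GRing.Theory Num.Theory.
Import numFieldNormedType.Exports.

Set Implicit Arguments.
Unset Strict Implicit.
Unset Printing Implicit Defensive.

Local Open Scope classical_set_scope.
Local Open Scope ring_scope.
Local Open Scope complex_scope.

Section FunctionField.
Variable F : finFieldType.

Definition monics (n : nat) : {set {poly_n.+1 F}} :=
  [set f : {poly_n.+1 F} | (val f \is monic) && (size (val f) == n.+1)].

Definition square_free (D : {poly F}) : Prop :=
  forall u : {poly F}, size u != 1%N -> ~~ (u ^+ 2 %| D).

Definition monic_square_frees (n : nat) : {set {poly_n.+1 F}} :=
  [set D in monics n | `[< square_free (val D) >]].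

Definition absp (f : {poly F}) : nat :=
  if f == 0 then 0%N else (#|F| ^ (size f).-1)%N.

Definition prime_divisors (f : {poly F}) : {set {poly_(size f) F}} :=
  [set P : {poly_(size f) F} |
    [&& val P \is monic, `[< irreducible_poly (val P) >] & val P %| f]].

(* For f <> 0 and P nonconstant, P ^+ i %| f forces i < size f. *)
Definition multiplicity (P f : {poly F}) : nat :=
  (\sum_(1 <= i < size f) (P ^+ i %| f)%R)%N.

Definition legendre (D P : {poly F}) : int :=
  if P %| D then 0
  else if `[< exists h : {poly F}, P %| D - h ^+ 2 >] then 1 else -1.

Definition chi (D f : {poly F}) : int :=
  \prod_(P in prime_divisors f) legendre D (val P) ^+ multiplicity (val P) f.

Definition moebius (L : {poly F}) : int :=
  if `[< square_free L >] then (-1) ^+ #|prime_divisors L| else 0.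

End FunctionField.

Definition power_sum (k n : nat) : nat := (\sum_(1 <= l < n.+1) l ^ k)%N.

Definition power_sum_poly (k : nat) : {poly rat} :=
  xget 0 [set p : {poly rat} | forall n : nat, p.[n%:R] = (power_sum k n)%:R].

Definition power_sum_coef (k m : nat) : rat := (power_sum_poly k)`_m.

Lemma power_sum_binomial (k n : nat) :
  (n.+1%:R ^+ k.+1 - 1 : rat) =
  \sum_(i < k.+1) 'C(k.+1, i)%:R * (power_sum i n)%:R.
Proof.
rewrite /power_sum; elim: n => [|n IHn].
  by rewrite expr1n subrr big1 // => i _; rewrite big_geq // mulr0.
under eq_bigr do rewrite big_nat_recr //= natrD mulrDr.
rewrite big_split /= -IHn.
have -> : n.+2%:R = n.+1%:R + 1 :> rat by rewrite -[n.+2]addn1 natrD.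
rewrite exprD1n big_ord_recr /= binn mulr1n -addrA addrC; congr (_ + _).
by apply: eq_bigr => i _; rewrite natrX mulr_natl.
Qed.

Lemma power_sum_poly_exists (k : nat) : exists p : {poly rat},
  [/\ (size p <= k.+2)%N, p.[0] = 0 &
      forall n : nat, p.[n%:R] = (power_sum k n)%:R].
Proof.
suff [p szp pE] : exists2 p : {poly rat}, (size p <= k.+2)%N &
    forall n : nat, p.[n%:R] = (power_sum k n)%:R.
  by exists p; split=> //; rewrite (pE 0%N) /power_sum big_geq.
elim/ltn_ind: k => k IHk.
have /choice[P PE] : forall i : 'I_k, exists p : {poly rat},
    (size p <= i.+2)%N /\ forall n : nat, p.[n%:R] = (power_sum i n)%:R.
  by move=> i; have [p] := IHk i (ltn_ord i); exists p.
exists (k.+1%:R^-1 *: (('X + 1) ^+ k.+1 - 1 -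
    \sum_(i < k) 'C(k.+1, i)%:R *: P i)).
  apply: leq_trans (size_scale_leq _ _) _.
  apply: leq_trans (size_polyD _ _) _; rewrite geq_max size_polyN.
  apply/andP; split.
    apply: leq_trans (size_polyD _ _) _; rewrite geq_max size_polyN size_poly1.
    rewrite andbT; apply: leq_trans (size_poly_exp_leq _ _) _.
    by rewrite -[1]/(1%:P) size_XaddC mul1n.
  apply: leq_trans (size_sum _ _ _) _; apply/bigmax_leqP => i _.
  apply: leq_trans (size_scale_leq _ _) _.
  by apply: leq_trans (PE i).1 _; rewrite !ltnS ltnW.
move=> n; have := power_sum_binomial k n; rewrite big_ord_recr /= binSn => E.
rewrite !hornerE horner_sum.
rewrite natr1 E.
under [X in _ - X]eq_bigr => i _ do rewrite hornerZ (PE i).2.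
by rewrite [X in X - _]addrC addrK mulKf // pnatr_eq0.
Qed.

Lemma power_sum_polyP (k n : nat) :
  (power_sum_poly k).[n%:R] = (power_sum k n)%:R.
Proof.
rewrite /power_sum_poly; case: xgetP => [p _ /(_ n) //|].
by have [p [_ _ pE]] := power_sum_poly_exists k => /(_ p).
Qed.

Lemma power_sum_coefE (k n : nat) :
  (power_sum k n)%:R =
  \sum_(1 <= m < k.+2) power_sum_coef k m * n%:R ^+ m :> rat.
Proof.
have [p [szp p0 pE]] := power_sum_poly_exists k.
have eqp : power_sum_poly k = p.
  apply/eqP; rewrite -subr_eq0; apply: contraT => nz.
  pose rs := [seq i%:R : rat | i <- iota 0 (size (power_sum_poly k - p))].
  have /(_ _ rs nz) := @max_poly_roots rat; rewrite size_map size_iota ltnn.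
  apply.
    apply/allP => _ /mapP[i _ ->].
    by rewrite rootE !hornerE power_sum_polyP pE subrr.
  by rewrite map_inj_uniq ?iota_uniq // => i j /eqP; rewrite eqr_nat => /eqP.
rewrite -power_sum_polyP /power_sum_coef eqp (horner_coef_wide _ szp).
rewrite -(big_mkord predT (fun m => p`_m * n%:R ^+ m)) big_ltn //.
by rewrite -horner_coef0 p0 mul0r add0r.
Qed.

Section Complex.
Variable R : realType.
Local Notation C := R[i].

(* a ^ s = exp (s ln a), for a > 0 *)
Definition cpow (a : R) (s : C) : C :=
  (a `^ complex.Re s)%:C *
  (cos (complex.Im s * ln a) +i* sin (complex.Im s * ln a)).

Variable F : finFieldType.
Local Notation q := (#|F|%:R : R).

Definition zetaA (s : C) : C := (1 - cpow q (1 - s))^-1.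

Definition delta (s : C) : C^o := (1 - cpow q (- s)) / (1 - cpow q (s - 1)).

(* For a nonsquare D the terms of the Dirichlet series with deg f = n cancel for
   every n >= deg D, which leaves a polynomial in q ^ -s, defined for all s. *)
Definition L_chi (D : {poly F}) (s : C) : C^o :=
  \sum_(0 <= n < (size D).-1)
    (\sum_(f in monics F n) chi D (val f))%:~R * cpow q (- (n%:R * s)).

(* The series is absolutely convergent for Re s > 0; it is summed by degree. *)
Definition Gfun (s : C) : C^o :=
  limn (series (fun n : nat => \sum_(L in monics F n)
    ((moebius (val L))%:~R /
     (cpow (absp (val L))%:R s *
      (\prod_(P in prime_divisors (val L)) (1 + absp (val P)))%:R)) : C^o)).

End Complex.

(* Main.v *)
Require Import Defs.
From HB Require Import structures.
From mathcomp Require Import all_boot all_order all_algebra.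
From mathcomp Require Import qpoly complex.
From mathcomp Require Import all_classical all_reals all_analysis.
From mathcomp Require Import finfield closed_field.
From mathcomp Require Import ring lra zify.
Import Order.TTheory GRing.Theory Num.Theory.
Import numFieldNormedType.Exports.

(* For D monic square-free of degree 2g+2 write c_n for the sum of chi_D over the
   monic polynomials of degree n, b_n = c_0 + ... + c_(n-1) and u = q^-s.  Gauss
   sums yield the functional equation b_(n+1) q^g = q^n b_(2g+1-n); by partial
   summation it becomes
     L(s) = sum_(n <= g) c_n u^n - b_(g+1) u^(g+1)
            + delta(s) (sum_(n < g) c_n q^(g-n) u^(2g-n) - b_g u^g),
   so that the derivatives at s = 1/2 only involve the sums over n <= h of c_n and
   of n^k c_n q^(-n/2), for h = g and h = g-1.  After summation over D, the square
   polynomials f contribute to c_n the number of square-free D coprime to f, which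
   gives a partial sum of the series G(1); the other f contribute an error term,
   because D |-> chi_D(f) is a nontrivial character by reciprocity: the
   Polya-Vinogradov bound comes from the same Gauss sums, and D is sieved by
   squares.  Abel summation then turns n^k into the polynomial J_k and the
   derivatives of G at 1. *)

Set Implicit Arguments.
Unset Strict Implicit.
Unset Printing Implicit Defensive.

Local Open Scope classical_set_scope.
Local Open Scope ring_scope.
Local Open Scope complex_scope.

(** * Monic polynomials and their prime divisors *)

(** The exponent 7/8 comes from the non-square [f]. In the sieve [D = A^2 B] with [deg A = a], the
    sum over [B] is at most [q^(2g+2-2a)] trivially and [q^(n/2)] by Polya-Vinogradov; since there
    are [q^a] such [A], balancing the two gives about [q^(g+n/4)] for each [f] of degree [n]. With
    [q^n] polynomials [f] and the weight [q^(-n/2)], the worst degree [n = g] yields [q^(7g/4)], the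
    order of [|D|^(7/8)]. Errors are therefore measured in powers of [rho = q^(1/4)]. The tails of G
    are smaller than this, which leaves room to absorb every power of [g] that multiplies them.

    The even degree of [D] shapes the algebra: reciprocity carries no sign, non-zero constants have
    symbol 1, and L vanishes at [u = 1]. Dividing by [1 - u] is what makes the partial sums [b_n],
    rather than the [c_n], satisfy a symmetric functional equation.

    The moment and the main term of the theorem are finally two values of one form, linear in the
    truncated sums, so that only these sums have to be compared. *)

Definition psize (F : finFieldType) (p : {poly F}) : nat := size p.

(* Sizes of polynomials may mention convertible but syntactically different
   ring structures, which [lia] would treat as distinct atoms. *)
Ltac szlia := intros;
  match goal with F0 : finFieldType |- _ =>
    repeat match goal with
    | H : context [@size ?T (@polyseq ?R ?p)] |- _ =>
        change (@size T (@polyseq R p)) with (@psize F0 p) in H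
    | |- context [@size ?T (@polyseq ?R ?p)] =>
        change (@size T (@polyseq R p)) with (@psize F0 p)
    end
  end;
  repeat match goal with
  | H : @eq ?T _ _ |- _ => tryif first [unify T nat | unify T bool] then fail else clear H
  end; lia.

Section MonicPolynomials.
Variable F : finFieldType.
Implicit Types f g D L P Q : {poly F}.

(** Duplicate-free lists in the single type [{poly F}] replace finite sets over [{poly_n F}]: sums
    over different degrees then share an index type and are reindexed by permutations of lists. *)
Definition mon (n : nat) : seq {poly F} := map val (enum (monics F n)).

Definition pols (n : nat) : seq {poly F} := map val (enum {poly_n F}).

Definition pdivs f : seq {poly F} := map val (enum (prime_divisors f)).

Definition mirred P := (P \is monic) && irreducibleb P.

Lemma mem_mon n f : (f \in mon n) = (f \is monic) && (size f == n.+1).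
Proof.
apply/mapP/idP => [[x]|/andP[mf /eqP sf]].
  by rewrite mem_enum inE => xP ->.
have sf' : f \is a poly_of_size n.+1 by rewrite qualifE /= sf.
by exists (NPoly sf'); rewrite // mem_enum inE /= mf sf eqxx.
Qed.

Lemma uniq_mon n : uniq (mon n).
Proof. by rewrite map_inj_uniq ?enum_uniq //; apply: val_inj. Qed.

Lemma mem_pols n f : (f \in pols n) = (size f <= n)%N.
Proof.
apply/mapP/idP => [[x _ ->]|sf]; first exact: size_npoly.
by exists (NPoly (sf : f \is a poly_of_size n)); rewrite ?mem_enum.
Qed.

Lemma uniq_pols n : uniq (pols n).
Proof. by rewrite map_inj_uniq ?enum_uniq //; apply: val_inj. Qed.

Lemma size_pols n : size (pols n) = (#|F| ^ n)%N.
Proof. by rewrite size_map -cardT card_npoly. Qed.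

Lemma mem_pdivs f P : f != 0 -> (P \in pdivs f) = mirred P && (P %| f).
Proof.
move=> f0; apply/mapP/idP => [[x]|/andP[/andP[mP iP] Pf]].
  rewrite mem_enum inE => /and3P[mx /asboolP ix xf] ->.
  by rewrite /mirred mx xf !andbT; apply/irreducibleP.
have sP : P \is a poly_of_size (size f) by rewrite qualifE /= dvdp_leq.
exists (NPoly sP) => //; rewrite mem_enum inE /= mP Pf andbT /=.
by apply/asboolP/irreducibleP.
Qed.

Lemma uniq_pdivs f : uniq (pdivs f).
Proof. by rewrite map_inj_uniq ?enum_uniq //; apply: val_inj. Qed.

Lemma sum_monics (V : nmodType) n (h : {poly F} -> V) :
  \sum_(f in monics F n) h (val f) = \sum_(f <- mon n) h f.
Proof. by rewrite big_map big_enum. Qed.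

Lemma sum_sqfrees (V : nmodType) n (h : {poly F} -> V) :
  \sum_(f in monic_square_frees F n) h (val f) =
  \sum_(f <- mon n | `[< square_free f >]) h f.
Proof.
by rewrite big_map big_enum_cond /=; apply: eq_bigl => f; rewrite inE.
Qed.

Lemma prod_prime_divisors (A : comPzRingType) f (h : {poly F} -> A) :
  \prod_(P in prime_divisors f) h (val P) = \prod_(P <- pdivs f) h P.
Proof. by rewrite big_map big_enum. Qed.

Lemma prodn_prime_divisors f (h : {poly F} -> nat) :
  (\prod_(P in prime_divisors f) h (val P) = \prod_(P <- pdivs f) h P)%N.
Proof. by rewrite big_map big_enum. Qed.

Lemma card_prime_divisors f : #|prime_divisors f| = size (pdivs f).
Proof. by rewrite size_map -cardE. Qed.

Lemma mirred_monic P : mirred P -> P \is monic.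
Proof. by case/andP. Qed.

Lemma mirred_irr P : mirred P -> irreducible_poly P.
Proof. by case/andP=> _ /irreducibleP. Qed.

Lemma mirred_size P : mirred P -> (1 < size P)%N.
Proof. by move/mirred_irr => []. Qed.

Lemma mirred_neq0 P : mirred P -> P != 0.
Proof. by move/mirred_monic/monic_neq0. Qed.

Lemma mirred_coprime P f : mirred P -> coprimep P f = ~~ (P %| f).
Proof. by move/mirred_irr/irreducible_poly_coprime ->. Qed.

Lemma mirred_dvdM P f g : mirred P -> (P %| f * g) = (P %| f) || (P %| g).
Proof.
move=> iP; have [Pf|nPf] /= := boolP (P %| f); first exact: dvdp_mulr.
by rewrite Gauss_dvdpr // mirred_coprime.
Qed.

Lemma mirred_dvd_eq P Q : mirred P -> mirred Q -> (P %| Q) = (P == Q).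
Proof.
move=> iP iQ; apply/idP/eqP => [PQ|-> //].
have [_ /(_ P)] := mirred_irr iQ.
rewrite neq_ltn mirred_size // orbT => /(_ isT PQ).
by rewrite eqp_monic ?mirred_monic // => /eqP.
Qed.

Lemma dvdp_monicE P f : P \is monic -> f \is monic -> P %| f ->
  exists2 g, g \is monic & f = P * g.
Proof.
move=> mP mf /dvdpP[g fE]; exists g; last by rewrite fE mulrC.
by move: mf; rewrite fE monicMr.
Qed.

Lemma size_monicM f g : f \is monic -> g \is monic ->
  size (f * g) = (size f + size g).-1.
Proof. by move=> mf mg; rewrite size_monicM ?monic_neq0. Qed.

Lemma monic_size1 f : f \is monic -> size f = 1%N -> f = 1.
Proof.
move=> mf /eqP/size_poly1P[c c0 fE]; move: mf; rewrite fE monicE lead_coefC.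
by move/eqP ->.
Qed.

(** Descent on the size: a reducible [f] has a smaller non-constant divisor, and an irreducible one
    becomes monic after scaling. *)
Lemma exists_mirred f : (1 < size f)%N -> exists2 P, mirred P & P %| f.
Proof.
have [n le_fn] := ubnP (size f); elim: n => // n IHn in f le_fn *; move=> sf.
have [if_|] := boolP (irreducibleb f).
  have l0 : lead_coef f != 0 by rewrite lead_coef_eq0 -size_poly_gt0 ltnW.
  exists ((lead_coef f)^-1 *: f).
    rewrite /mirred monicE lead_coefZ mulVf // eqxx /=.
    apply/irreducibleP; move/irreducibleP: if_ => [_ H]; split.
      by rewrite size_scale ?invr_eq0.
    move=> u su; rewrite dvdpZr ?invr_eq0 // => /(H _ su) uf.
    by rewrite (eqp_trans uf) // eqp_sym eqp_scale ?invr_eq0.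
  by rewrite dvdpZl ?invr_eq0.
rewrite /irreducibleb sf /= => /forallPn[/= u].
rewrite negb_imply -ltnNge -Pdiv.Idomain.dvdpE => /andP[uf su].
have [|P iP Pu] := IHn (val u) _ su; last by exists P => //; apply: dvdp_trans uf.
apply: leq_trans (_ : (size f).-1 < _)%N; first by rewrite ltnS size_npoly.
by move: sf le_fn; case: (size f).
Qed.

(** Takes the place of unique factorisation: multiplicative facts about [chi] and [pdivs] only need
    the effect of one more prime factor. *)
Lemma monic_ind (T : {poly F} -> Prop) : T 1 ->
  (forall P f, mirred P -> f \is monic -> T f -> T (P * f)) ->
  forall f, f \is monic -> T f.
Proof.
move=> T1 TM f; have [n le_fn] := ubnP (size f).
elim: n => // n IHn in f le_fn *; move=> mf.
have := size_poly_gt0 f; rewrite monic_neq0 // leq_eqVlt => /orP[/eqP s1|sf].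
  by rewrite (monic_size1 mf).
have [P iP Pf] := exists_mirred sf.
have [g mg fE] := dvdp_monicE (mirred_monic iP) mf Pf.
rewrite fE; apply: TM => //; apply: IHn => //.
move: le_fn (mirred_size iP); rewrite fE size_monicM ?(mirred_monic iP) //.
by have := size_poly_gt0 g; rewrite monic_neq0 //; szlia.
Qed.

Lemma size_exp_mirred P i : mirred P -> (i < size (P ^+ i)%R)%N.
Proof.
move=> iP; have := size_exp P i; have := mirred_size iP.
have : (0 < size (P ^+ i)%R)%N by rewrite size_poly_gt0 expf_neq0 ?mirred_neq0.
case: (size (P ^+ i)%R) => // k _ sP /= ->.
by rewrite ltnS leq_pmull // -ltnS (ltn_predK sP).
Qed.

Lemma mult_wide P f m : mirred P -> f != 0 -> (size f <= m)%N ->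
  multiplicity P f = (\sum_(1 <= i < m) (P ^+ i %| f)%R)%N.
Proof.
move=> iP f0 sm; rewrite /multiplicity.
have s1 : (1 <= size f)%N by rewrite size_poly_gt0.
rewrite (big_cat_nat s1 sm) /= [X in _ = (_ + X)%N]big1_seq ?addn0 //.
move=> i; rewrite mem_index_iota => /andP[_ /andP[si _]]; case: (boolP (_ %| _)) => // /dvdp_leq.
by move=> /(_ f0); have := size_exp_mirred i iP; szlia.
Qed.

Lemma multMl P f : mirred P -> f != 0 ->
  multiplicity P (P * f) = (multiplicity P f).+1.
Proof.
move=> iP f0; have P0 := mirred_neq0 iP.
rewrite (@mult_wide P (P * f) (size (P * f)).+1) ?mulf_neq0 //.
have sPf : (size f < size (P * f)%R)%N.
  rewrite size_mul //; have := mirred_size iP; rewrite -size_poly_gt0 in f0.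
  by szlia.
rewrite big_nat_recl; last by szlia.
rewrite expr1 dvdp_mulr // add1n; congr _.+1.
rewrite (@mult_wide P f (size (P * f))) //; last by szlia.
by apply: eq_bigr => i _; rewrite exprS dvdp_mul2l.
Qed.

Lemma multMr P Q f : mirred P -> mirred Q -> P != Q -> f != 0 ->
  multiplicity Q (P * f) = multiplicity Q f.
Proof.
move=> iP iQ nPQ f0; have P0 := mirred_neq0 iP.
rewrite (@mult_wide Q f (size (P * f))) //; last first.
  rewrite size_mul //; have := mirred_size iP; szlia.
apply: eq_bigr => i _; rewrite Gauss_dvdpr // coprimep_expl //.
by rewrite mirred_coprime // mirred_dvd_eq // eq_sym.
Qed.

Lemma mult_ndvd P f : mirred P -> f != 0 -> ~~ (P %| f) -> multiplicity P f = 0%N.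
Proof.
move=> iP f0 nPf; rewrite /multiplicity big_nat_cond big1 // => i.
case: i => // i _; case: (boolP (_ %| _)) => // H.
by rewrite (dvdp_trans _ H) ?dvdp_exp // in nPf.
Qed.

(** [chi D f] and [chi D (P * f)] are products over different sets of primes; primes of multiplicity
    0 are added so that both run over one list. *)
Lemma chi_wide D f (s : seq {poly F}) : f != 0 -> uniq s ->
  all mirred s -> {subset pdivs f <= s} ->
  chi D f = \prod_(P <- s) legendre D P ^+ multiplicity P f.
Proof.
move=> f0 us ms subs.
rewrite /chi (prod_prime_divisors f (fun P => legendre D P ^+ multiplicity P f)).
rewrite [RHS](bigID (fun P => P %| f)) /= [X in _ = _ * X]big1_seq ?mulr1.
  rewrite -[RHS]big_filter; apply: perm_big; apply: uniq_perm.
  - exact: uniq_pdivs.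
  - exact: filter_uniq.
  move=> P; rewrite mem_filter mem_pdivs // andbC; have [Pf|] //= := boolP (P %| f).
  by apply/idP/idP => [iP|/(allP ms) //]; apply: subs; rewrite mem_pdivs // iP.
move=> P /andP[nPf Ps]; rewrite mult_ndvd ?expr0 //.
by move/allP: ms; apply.
Qed.

Lemma chiP1 D P f : mirred P -> f != 0 -> chi D (P * f) = legendre D P * chi D f.
Proof.
move=> iP f0; have Pf0 : P * f != 0 by exact: mulf_neq0 (mirred_neq0 iP) f0.
have sub1 : {subset pdivs f <= pdivs (P * f)}.
  by move=> Q; rewrite !mem_pdivs // => /andP[-> Qf]; rewrite dvdp_mull.
have allm : all mirred (pdivs (P * f)).
  by apply/allP => Q; rewrite mem_pdivs // => /andP[].
rewrite !(@chi_wide _ _ (pdivs (P * f))) ?uniq_pdivs //.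
have PP : P \in pdivs (P * f) by rewrite mem_pdivs // iP dvdp_mulr.
rewrite !(bigD1_seq P) ?uniq_pdivs //= mulrA multMl // exprS; congr (_ * _).
rewrite big_seq_cond [RHS]big_seq_cond; apply: eq_bigr => Q /andP[Qm nQP].
by rewrite multMr // 1?eq_sym //; apply: (allP allm).
Qed.

Lemma chi1 D : chi D 1 = 1.
Proof.
rewrite (@chi_wide _ _ [::]) ?big_nil ?oner_neq0 // => P.
rewrite mem_pdivs ?oner_neq0 // => /andP[iP].
by rewrite dvdp1 => /eqP sP; have := mirred_size iP; rewrite sP.
Qed.

Lemma chiMr D f g : f \is monic -> g \is monic ->
  chi D (f * g) = chi D f * chi D g.
Proof.
move=> mf mg; elim/monic_ind: f / mf => [|P f iP mf IH].
  by rewrite mul1r chi1 mul1r.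
rewrite -mulrA chiP1 ?mulf_neq0 ?monic_neq0 // IH chiP1 ?monic_neq0 //.
by rewrite mulrA.
Qed.

Lemma sum_mon_dvd (V : nmodType) n d P (h : {poly F} -> V) :
  P \in mon d ->
  \sum_(B <- mon n | P %| B) h B =
  if (d <= n)%N then \sum_(B <- mon (n - d)) h (P * B) else 0.
Proof.
rewrite mem_mon => /andP[mP /eqP sP]; case: leqP => dn; last first.
  rewrite big1_seq // => B /andP[PB]; rewrite mem_mon => /andP[mB /eqP sB].
  by have := dvdp_leq (monic_neq0 mB) PB; rewrite sB sP; szlia.
rewrite -big_filter -(big_map (fun B => P * B) xpredT h).
apply: perm_big; apply: uniq_perm.
- by rewrite filter_uniq // uniq_mon.
- by rewrite map_inj_uniq ?uniq_mon //; apply: mulfI; rewrite monic_neq0.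
move=> B; rewrite mem_filter mem_mon; apply/idP/mapP.
  move=> /and3P[PB mB /eqP sB]; have [g mg BE] := dvdp_monicE mP mB PB.
  exists g => //; rewrite mem_mon mg; move: sB; rewrite BE size_monicM // sP.
  by move=> sB; apply/eqP; szlia.
move=> [g]; rewrite mem_mon => /andP[mg /eqP sg] ->.
rewrite dvdp_mulr // monicMl // mg size_monicM // sP sg /=; apply/eqP; szlia.
Qed.

Lemma sum_mon (V : nmodType) n (h : {poly F} -> V) :
  \sum_(f <- mon n) h f = \sum_(r <- pols n) h ('X^n + r).
Proof.
rewrite -(big_map (fun r => 'X^n + r) xpredT h); apply: perm_big.
apply: uniq_perm; first exact: uniq_mon.
  by rewrite map_inj_uniq ?uniq_pols //; apply: addrI.
move=> f; rewrite mem_mon; apply/idP/mapP => [/andP[mf /eqP sf]|[r]].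
  exists (f - 'X^n); last by rewrite addrC subrK.
  rewrite mem_pols; apply/leq_sizeP => j; rewrite leq_eqVlt coefB coefXn.
  case/orP => [/eqP <-|nj].
    by move: mf; rewrite monicE lead_coefE sf eqxx => /eqP ->; rewrite subrr.
  rewrite nth_default ?sf // sub0r; case: eqP => [jn|_]; last by rewrite oppr0.
  by rewrite jn ltnn in nj.
rewrite mem_pols => sr ->.
by rewrite monicE lead_coefDl ?size_polyXn ?ltnS // lead_coefXn eqxx
           size_polyDl size_polyXn ?ltnS // eqxx.
Qed.

Lemma size_mon n : size (mon n) = (#|F| ^ n)%N.
Proof.
have : \sum_(f <- mon n) 1%N = \sum_(r <- pols n) 1%N by exact: sum_mon.
by rewrite !sum1_size size_pols.
Qed.

End MonicPolynomials.

(** * Moebius inversion *)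

Section Moebius.
Variable F : finFieldType.
Implicit Types f g l D L P Q A B : {poly F}.

Definition sqf f := `[< square_free f >].

Lemma sqfP f : f != 0 ->
  reflect (forall P, mirred P -> ~~ (P ^+ 2 %| f)) (sqf f).
Proof.
move=> f0; rewrite /sqf; apply: (iffP (asboolP _)) => H.
  by move=> P iP; apply: H; rewrite neq_ltn mirred_size ?orbT.
move=> u su; apply/negP => uf.
have u0 : u != 0.
  by apply: contraNneq f0 => u0; move: uf; rewrite u0 expr0n dvd0p.
have [|P iP Pu] := @exists_mirred _ u.
  by move: su; rewrite neq_ltn ltnS leqn0 size_poly_eq0 (negPf u0).
by have := H _ iP; rewrite (dvdp_trans _ uf) // dvdp_exp2r.
Qed.

Lemma mirredM_monic P L : mirred P -> L \is monic -> P * L \is monic.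
Proof. by move=> iP mL; rewrite monicMl ?(mirred_monic iP). Qed.

Lemma sqfM P L : mirred P -> L \is monic ->
  sqf (P * L) = ~~ (P %| L) && sqf L.
Proof.
move=> iP mL; have L0 := monic_neq0 mL.
have PL0 : P * L != 0 by rewrite monic_neq0 ?mirredM_monic.
have P0 := mirred_neq0 iP.
apply/sqfP/andP => // [H|[nPL /(sqfP L0) H] Q iQ].
  split; first by have := H P iP; rewrite expr2 dvdp_mul2l.
  apply/sqfP => // Q iQ; apply: contra (H Q iQ) => QL; exact: dvdp_mull.
have [->|nQP] := eqVneq Q P; first by rewrite expr2 dvdp_mul2l.
rewrite Gauss_dvdpr ?H // coprimep_expl // mirred_coprime //.
by rewrite mirred_dvd_eq.
Qed.

Lemma sqf1 : sqf 1.
Proof.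
apply/sqfP => [|P iP]; first exact: oner_neq0.
rewrite dvdp1; have := size_exp_mirred 2 iP.
by case: eqP => // ->.
Qed.

Lemma pdivs1 : pdivs (1 : {poly F}) = [::].
Proof.
case E: (pdivs 1) => [|P s] //; have : P \in pdivs 1 by rewrite E mem_head.
rewrite mem_pdivs ?oner_neq0 // => /andP[iP].
by rewrite dvdp1 => /eqP sP; have := mirred_size iP; rewrite sP.
Qed.

Lemma pdivsM P L : mirred P -> L \is monic -> ~~ (P %| L) ->
  perm_eq (pdivs (P * L)) (P :: pdivs L).
Proof.
move=> iP mL nPL; have L0 := monic_neq0 mL.
have PL0 : P * L != 0 by rewrite monic_neq0 ?mirredM_monic.
apply: uniq_perm; first exact: uniq_pdivs.
  by rewrite /= uniq_pdivs mem_pdivs // (negPf nPL) andbF.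
move=> Q; rewrite inE !mem_pdivs //.
have [iQ|niQ] /= := boolP (mirred Q); last first.
  by case: eqP => // QP; rewrite QP iP in niQ.
by rewrite mirred_dvdM // mirred_dvd_eq.
Qed.

Lemma pdivsMd P L : mirred P -> L \is monic -> P %| L ->
  perm_eq (pdivs (P * L)) (pdivs L).
Proof.
move=> iP mL PL; have L0 := monic_neq0 mL.
have PL0 : P * L != 0 by rewrite monic_neq0 ?mirredM_monic.
apply: uniq_perm; try exact: uniq_pdivs.
move=> Q; rewrite !mem_pdivs //; have [iQ|niQ] //= := boolP (mirred Q).
rewrite mirred_dvdM // mirred_dvd_eq //.
by case: eqP => // ->.
Qed.

Lemma moebiusE L : moebius L = if sqf L then (-1) ^+ size (pdivs L) else 0.
Proof. by rewrite /moebius card_prime_divisors. Qed.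

Lemma moebius1 : moebius (1 : {poly F}) = 1.
Proof. by rewrite moebiusE sqf1 pdivs1 expr0. Qed.

Lemma moebiusM P L : mirred P -> L \is monic ->
  moebius (P * L) = if P %| L then 0 else - moebius L.
Proof.
move=> iP mL; rewrite !moebiusE sqfM //; have [//|nPL] /= := boolP (P %| L).
case: ifP => _; last by rewrite oppr0.
by rewrite (perm_size (pdivsM iP mL nPL)) exprS mulN1r.
Qed.

Definition mdivs l := [seq L <- pols F (size l) | (L \is monic) && (L %| l)].

Lemma mem_mdivs l L : l \is monic ->
  (L \in mdivs l) = (L \is monic) && (L %| l).
Proof.
move=> ml; rewrite mem_filter mem_pols; apply/andb_idr => /andP[mL Ll].
by rewrite dvdp_leq ?monic_neq0.
Qed.

Lemma uniq_mdivs l : uniq (mdivs l).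
Proof. by rewrite filter_uniq ?uniq_pols. Qed.

Lemma mdivs1 : mdivs 1 = [:: 1].
Proof.
apply: perm_small_eq => //; apply: uniq_perm => //; first exact: uniq_mdivs.
move=> L; rewrite mem_mdivs ?monic1 // inE dvdp1.
apply/andP/eqP => [[mL /eqP]|->]; first exact: monic_size1.
by rewrite monic1 size_poly1.
Qed.

Lemma sum_mdivsM (V : nmodType) P l (H : {poly F} -> V) :
  mirred P -> l \is monic -> ~~ (P %| l) ->
  \sum_(L <- mdivs (P * l)) H L =
  \sum_(L <- mdivs l) H L + \sum_(L <- mdivs l) H (P * L).
Proof.
move=> iP ml nPl; have mPl := mirredM_monic iP ml; have mP := mirred_monic iP.
rewrite (bigID (fun L => P %| L)) /= addrC; congr (_ + _).
  rewrite -big_filter; apply: perm_big; apply: uniq_perm.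
  - by rewrite filter_uniq ?uniq_mdivs.
  - exact: uniq_mdivs.
  move=> L; rewrite mem_filter !mem_mdivs //; apply/idP/idP.
    case/and3P => nPL ->; rewrite Gauss_dvdpr // coprimep_sym.
    by rewrite mirred_coprime.
  case/andP => -> Ll; rewrite dvdp_mull // !andbT.
  by apply: contra nPl => PL; apply: dvdp_trans Ll.
rewrite -big_filter -(big_map (fun L => P * L) xpredT H).
apply: perm_big; apply: uniq_perm.
- by rewrite filter_uniq ?uniq_mdivs.
- by rewrite map_inj_uniq ?uniq_mdivs //; apply: mulfI; rewrite mirred_neq0.
move=> L; rewrite mem_filter mem_mdivs //; apply/idP/mapP.
  case/and3P => PL mL LPl; have [g mg LE] := dvdp_monicE mP mL PL.
  by exists g => //; rewrite mem_mdivs // mg; move: LPl; rewrite LE dvdp_mul2l ?mirred_neq0.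
case=> g; rewrite mem_mdivs // => /andP[mg gl] ->.
by rewrite dvdp_mulr // mirredM_monic // dvdp_mul2l ?mirred_neq0.
Qed.

(** The divisors of [P * l] that do not divide [l] are divisible by [P ^+ 2], so a function
    supported on square-free polynomials does not see them. *)
Lemma sum_mdivsMd (V : nmodType) P l (H : {poly F} -> V) :
  mirred P -> l \is monic -> P %| l -> (forall L, ~~ sqf L -> H L = 0) ->
  \sum_(L <- mdivs (P * l)) H L = \sum_(L <- mdivs l) H L.
Proof.
move=> iP ml Pl H0; have mPl := mirredM_monic iP ml; have mP := mirred_monic iP.
rewrite (bigID (fun L => L %| l)) /= [X in _ + X]big1_seq ?addr0.
  rewrite -big_filter; apply: perm_big; apply: uniq_perm.
  - by rewrite filter_uniq ?uniq_mdivs.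
  - exact: uniq_mdivs.
  move=> L; rewrite mem_filter !mem_mdivs // andbCA; congr (_ && _).
  by case: (boolP (L %| l)) => // Ll; rewrite dvdp_mull.
move=> L /andP[nLl]; rewrite mem_mdivs // => /andP[mL LPl]; apply: H0.
have [PL|nPL] := boolP (P %| L); last first.
  case/negP: nLl; rewrite -(@Gauss_dvdpr _ l P) // coprimep_sym.
  by rewrite mirred_coprime.
have [g mg LE] := dvdp_monicE mP mL PL; rewrite LE sqfM // negb_and negbK.
apply/orP; left; apply: contraNT nLl => nPg.
rewrite LE Gauss_dvdp ?mirred_coprime // Pl /=.
by move: LPl; rewrite LE dvdp_mul2l ?mirred_neq0.
Qed.

(** A finite Euler product. With [h = 1] it is Moebius inversion; with [h P = 1 / (1 + |P|)] it
    produces the coefficients of G. *)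
Lemma sum_moebius (A : comNzRingType) (h : {poly F} -> A) l : l \is monic ->
  \sum_(L <- mdivs l) (moebius L)%:~R * (\prod_(P <- pdivs L) h P) =
  \prod_(P <- pdivs l) (1 - h P).
Proof.
move=> ml; elim/monic_ind: l / ml => [|P l iP ml IH].
  by rewrite mdivs1 big_seq1 moebius1 pdivs1 !big_nil mulr1.
have [Pl|nPl] := boolP (P %| l).
  rewrite sum_mdivsMd // => [|L nL]; last by rewrite moebiusE (negPf nL) mul0r.
  by rewrite IH; apply: perm_big; rewrite perm_sym pdivsMd.
rewrite sum_mdivsM // IH (perm_big _ (pdivsM iP ml nPl)) big_cons /= mulrBl mul1r.
congr (_ + _); rewrite -IH mulr_sumr -sumrN big_seq [RHS]big_seq.
apply: eq_bigr => L; rewrite mem_mdivs // => /andP[mL Ll].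
have nPL : ~~ (P %| L) by apply: contra nPl => PL; apply: dvdp_trans Ll.
rewrite moebiusM // (negPf nPL) (perm_big _ (pdivsM iP mL nPL)) big_cons /=.
by rewrite mulrNz mulNr mulrCA.
Qed.

Lemma sum_mdivs (V : nmodType) (H : {poly F} -> V) l m : l \is monic ->
  (size l <= m)%N ->
  \sum_(L <- mdivs l) H L = \sum_(0 <= a < m) \sum_(A <- mon F a | A %| l) H A.
Proof.
move=> ml sl.
have inner a : \sum_(A <- mon F a | A %| l) H A =
    \sum_(L <- mdivs l | size L == a.+1) H L.
  rewrite -big_filter -[RHS]big_filter; apply: perm_big; apply: uniq_perm.
  - by rewrite filter_uniq ?uniq_mon.
  - by rewrite filter_uniq ?uniq_mdivs.
  move=> L; rewrite mem_filter [in RHS]mem_filter mem_mdivs // mem_mon.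
  by case: (L %| l); case: (L \is monic); case: (size L == _).
under [RHS]eq_bigr do rewrite inner.
rewrite [RHS](exchange_big_dep xpredT) //=.
rewrite big_seq [RHS]big_seq; apply: eq_bigr => L.
rewrite mem_mdivs // => /andP[mL Ll].
have sL : (size L = (size L).-1.+1)%N.
  by rewrite prednK // size_poly_gt0 monic_neq0.
rewrite (eq_bigl (fun a => a == (size L).-1)); last first.
  by move=> a; rewrite {1}sL eqSS eq_sym.
rewrite big_nat1_eq /= ifT // -sL (leq_trans _ sl) // dvdp_leq // monic_neq0 //.
Qed.

Lemma square_decomposition D : D \is monic ->
  exists A D1, [/\ A \is monic, D1 \is monic, sqf D1 & D = A ^+ 2 * D1].
Proof.
have [n] := ubnP (size D); elim: n D => // n IH D sD mD.
have D0 := monic_neq0 mD.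
have [sqD|] := boolP (sqf D); first by exists 1, D; rewrite monic1 expr1n mul1r.
move=> nsq; have [P iP PD] : exists2 P, mirred P & P ^+ 2 %| D.
  apply: contrapT => H; case/negP: nsq; apply/(sqfP D0) => P iP.
  by apply/negP => PD; apply: H; exists P.
have mP := mirred_monic iP.
have [E mE DE] := dvdp_monicE (monic_exp 2 mP) mD PD.
have [|A [D1 [mA mD1 sD1 EE]]] := IH E _ mE.
  move: sD; rewrite DE size_monicM ?monic_exp //.
  have := size_exp_mirred 2 iP; have := size_poly_gt0 E; rewrite monic_neq0 //.
  szlia.
exists (P * A), D1; split => //; first by rewrite monicMl.
by rewrite DE EE mulrA exprMn.
Qed.

(** A prime of [A] must divide [A0], since its square cannot divide the square-free [D1]; primes are
    cancelled from [A] and [A0] one at a time. *)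
Lemma dvdp_sqrM A A0 D1 : A \is monic -> A0 \is monic -> D1 \is monic ->
  sqf D1 -> (A ^+ 2 %| A0 ^+ 2 * D1) = (A %| A0).
Proof.
move=> mA mA0 mD1 sD1; apply/idP/idP; last first.
  by move=> AA0; rewrite dvdp_mulr // dvdp_exp2r.
elim/monic_ind: A / mA A0 mA0 => [|P A iP mA IH] A0 mA0; first by rewrite dvd1p.
rewrite exprMn => H; have mP := mirred_monic iP; have P0 := mirred_neq0 iP.
have PA0 : P %| A0.
  apply: contraTT H => nPA0; apply: contra (sqfP (monic_neq0 mD1) sD1 _ iP) => H.
  rewrite -(@Gauss_dvdpr _ D1 (A0 ^+ 2)).
    by apply: dvdp_trans H; apply: dvdp_mulr.
  by rewrite coprimep_expl ?coprimep_expr ?mirred_coprime.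
have [B mB A0E] := dvdp_monicE mP mA0 PA0; rewrite A0E (dvdp_mul2l _ _ P0) IH //.
move: H; rewrite A0E exprMn => H.
by rewrite -(dvdp_mul2l _ _ (expf_neq0 2 P0)) (mulrA (P ^+ 2) _ D1).
Qed.

(** Only the largest square [A0 ^+ 2] dividing [D] matters: the [A] that occur are the divisors of
    [A0], and their Moebius sum detects [A0 = 1]. *)
Lemma sqf_moebius N D m : D \in mon F N -> (N < m.*2)%N ->
  (sqf D)%:R = \sum_(0 <= a < m) \sum_(A <- mon F a | A ^+ 2 %| D) moebius A.
Proof.
rewrite mem_mon => /andP[mD /eqP sD] Nm.
have [A0 [D1 [mA0 mD1 sD1 DE]]] := square_decomposition mD.
have sA0 : (size A0 <= m)%N.
  move: sD; rewrite DE size_monicM ?monic_exp // expr2 size_monicM //.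
  have := size_poly_gt0 A0; rewrite monic_neq0 //.
  have := size_poly_gt0 D1; rewrite monic_neq0 //.
  szlia.
transitivity (\sum_(L <- mdivs A0) (moebius L)%:~R * (\prod_(P <- pdivs L) 1) : int).
  rewrite sum_moebius // subrr; have [A01|nA01] := eqVneq A0 1.
    by rewrite DE A01 expr1n mul1r sD1 pdivs1 big_nil.
  have [|P iP PA0] := @exists_mirred _ A0.
    rewrite ltn_neqAle size_poly_gt0 monic_neq0 // andbT eq_sym.
    by apply: contraNN nA01 => /eqP /(monic_size1 mA0) ->.
  have PpA0 : P \in pdivs A0 by rewrite mem_pdivs ?monic_neq0 // iP.
  rewrite (bigD1_seq P) ?uniq_pdivs //= mul0r.
  rewrite [sqf D]negbTE //; apply/negP => /(sqfP (monic_neq0 mD)) /(_ _ iP).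
  by rewrite DE dvdp_mulr // dvdp_exp2r.
rewrite (sum_mdivs _ mA0 sA0); apply: eq_bigr => a _.
rewrite big_seq_cond [RHS]big_seq_cond; apply: eq_big => [A|A _].
  rewrite mem_mon; case: (boolP (A \is monic)) => //= mA.
  by rewrite DE dvdp_sqrM.
by rewrite big1 // mulr1 intz.
Qed.

(** The sieve by squares: it trades square-free [D] for arbitrary monic [B], over which character
    sums can be bounded. *)
Lemma sum_sqf N (w : {poly F} -> int) :
  \sum_(D <- mon F N | sqf D) w D =
  \sum_(0 <= a < N./2.+1) \sum_(A <- mon F a)
    moebius A * \sum_(B <- mon F (N - a.*2)) w (A ^+ 2 * B).
Proof.
transitivity (\sum_(D <- mon F N) (sqf D)%:R * w D).
  by rewrite big_mkcond; apply: eq_bigr => D _; case: sqf; rewrite ?mul1r ?mul0r.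
have Nm : (N < N./2.+1.*2)%N by lia.
rewrite big_seq; under eq_bigr => D DN.
  rewrite (sqf_moebius DN Nm) mulr_suml; over.
rewrite -big_seq exchange_big /= big_nat_cond [RHS]big_nat_cond.
apply: eq_bigr => a /andP[/andP[_ aN] _].
under eq_bigr do rewrite mulr_suml.
rewrite (exchange_big_dep xpredT) //= big_seq [RHS]big_seq.
apply: eq_bigr => A Aa; rewrite -mulr_sumr.
have A2 : A ^+ 2 \in mon F a.*2.
  move: Aa; rewrite !mem_mon => /andP[mA /eqP sA].
  by rewrite monic_exp // expr2 size_monicM // sA; apply/eqP; lia.
by rewrite (sum_mon_dvd _ _ A2) ifT //; lia.
Qed.

Lemma sum_mdivs_mon (V : nmodType) n (H : {poly F} -> {poly F} -> V) :
  \sum_(f <- mon F n) \sum_(L <- mdivs f) H f L =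
  \sum_(0 <= a < n.+1) \sum_(L <- mon F a) \sum_(g <- mon F (n - a)) H (L * g) L.
Proof.
rewrite big_seq; under eq_bigr => f.
  rewrite mem_mon => /andP[mf /eqP sf].
  rewrite (sum_mdivs _ mf (eq_leq sf)); over.
rewrite -big_seq exchange_big /= big_nat_cond [RHS]big_nat_cond.
apply: eq_bigr => a /andP[/andP[_ an] _].
rewrite (exchange_big_dep xpredT) //= big_seq [RHS]big_seq.
by apply: eq_bigr => L La; rewrite (sum_mon_dvd _ _ La) ifT.
Qed.

(** These are the coefficients of [1 - q u], the inverse of the zeta function; the convolution with
    [q^n] is evaluated by Moebius inversion and then solved for the last term. *)
Lemma sum_moebius_mon n :
  \sum_(L <- mon F n) moebius L =
  (n == 0%N)%:R - (#|F|%:R) *+ (n == 1%N) :> int.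
Proof.
pose M a : int := \sum_(L <- mon F a) moebius L.
have E n' : \sum_(0 <= a < n'.+1) M a * (#|F| ^ (n' - a))%:R = (n' == 0%N)%:R :> int.
  transitivity (\sum_(f <- mon F n') \sum_(L <- mdivs f)
      (moebius L)%:~R * (\prod_(P <- pdivs L) 1) : int).
    rewrite sum_mdivs_mon /=; apply: eq_bigr => a _; rewrite mulr_suml.
    apply: eq_bigr => L _; under eq_bigr do rewrite big1_eq.
    rewrite -mulr_sumr intz; congr (_ * _).
    by rewrite big_const_seq count_predT size_mon iter_addr_0.
  rewrite big_seq; under eq_bigr => f.
    rewrite mem_mon => /andP[mf sf]; rewrite (sum_moebius (fun=> 1) mf) subrr; over.
  rewrite -big_seq; case: n' => [|n'] /=.
    have -> : mon F 0 = [:: 1].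
      apply: perm_small_eq => //; apply: uniq_perm; rewrite ?uniq_mon // => f.
      rewrite mem_mon inE; apply/andP/eqP => [[mf /eqP]|->]; first exact: monic_size1.
      by rewrite monic1 size_poly1.
    by rewrite big_seq1 pdivs1 big_nil.
  rewrite big1_seq // => f /andP[_]; rewrite mem_mon => /andP[mf /eqP sf].
  have [|P iP Pf] := @exists_mirred _ f; first by rewrite sf.
  have Pp : P \in pdivs f by rewrite mem_pdivs ?monic_neq0 // iP.
  by rewrite (bigD1_seq P) ?uniq_pdivs //= mul0r.
rewrite -/(M n); case: n => [|n].
  by have := E 0%N; rewrite big_nat1 expn0 mulr1 subr0.
have := E n.+1; rewrite big_nat_recr //= subnn expn0 mulr1.
rewrite (_ : \sum_(0 <= i < n.+1) _ = #|F|%:R * (n == 0%N)%:R); last first.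
  rewrite -E mulr_sumr big_nat_cond [RHS]big_nat_cond; apply: eq_bigr => a.
  move=> /andP[/andP[_ an] _]; rewrite subSn // expnS natrM; ring.
move/eqP; rewrite addrC addr_eq0 sub0r eqSS => /eqP ->.
by case: (n == 0%N); rewrite ?mulr1 ?mulr0 ?oppr0.
Qed.

(** The coefficients of [(1 - q u^2) / (1 - q u)]: by [sum_moebius_mon] only [a = 0] and [a = 1]
    survive in the sieve. *)
Lemma card_sqf n :
  \sum_(D <- mon F n | sqf D) 1 =
  (#|F| ^ n)%:R - (#|F| ^ n.-1)%:R *+ (1 < n)%N :> int.
Proof.
rewrite sum_sqf.
under eq_bigr => a _.
  under eq_bigr => A _.
    rewrite big_const_seq count_predT size_mon iter_addr_0; over.
  rewrite -mulr_suml sum_moebius_mon; over.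
rewrite big_nat_recl //= subr0 mul1r subn0.
case: n => [|[|n]]; [by rewrite big_geq // addr0 subr0 | by rewrite big_geq // addr0 subr0 |].
have -> : n.+2./2 = n./2.+1 by [].
rewrite big_nat_recl //= big1 ?addr0 => [|i _]; last by rewrite mul0r.
by rewrite sub0r mulr1n mulNr -natrM -expnS subSS subn1.
Qed.

End Moebius.

(** * Quadratic reciprocity *)

Lemma prodr_const_seq (A : pzSemiRingType) (I : Type) (s : seq I) (c : A) :
  \prod_(i <- s) c = c ^+ size s.
Proof. by rewrite big_const_seq count_predT iter_mulr_1. Qed.

(** * Frobenius on the roots of a prime, and Euler's criterion *)

Section FrobeniusInClosure.
Variables (F : finFieldType) (K : fieldType) (io : {rmorphism F -> K}).
Local Notation q := #|F|.
Implicit Types (f g h x P : {poly F}) (y z a : K).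

Definition pev h a : K := (map_poly io h).[a].

Lemma pevM g h a : pev (g * h) a = pev g a * pev h a.
Proof. by rewrite /pev rmorphM hornerM. Qed.

Lemma pevD g h a : pev (g + h) a = pev g a + pev h a.
Proof. by rewrite /pev rmorphD hornerD. Qed.

Lemma pevB g h a : pev (g - h) a = pev g a - pev h a.
Proof. by rewrite /pev rmorphB hornerD hornerN. Qed.

Lemma pevC (c : F) a : pev c%:P a = io c.
Proof. by rewrite /pev map_polyC hornerC. Qed.

Lemma pevX a : pev 'X a = a.
Proof. by rewrite /pev map_polyX hornerX. Qed.

Lemma card_gt1 : (1 < q)%N.
Proof. exact: finNzRing_gt1. Qed.

Lemma frobD n y z : (y + z) ^+ (q ^ n) = y ^+ (q ^ n) + z ^+ (q ^ n).
Proof.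
apply: exprDn_pchar.
have [p pp pF] := finPcharP F.
have pK : p \in [pchar K] by apply: (rmorph_pchar io).
have := card_pprimeChar pF; rewrite /pPrimeCharType => qE.
by rewrite qE -expnM pnatX pnatE // pK.
Qed.

Lemma frob_iota n (c : F) : io c ^+ (q ^ n) = io c.
Proof.
rewrite -rmorphXn; congr (io _).
by elim: n => [|n IH]; rewrite ?expr1 // expnSr exprM IH expf_card.
Qed.

Lemma frob_pev n h a : pev h a ^+ (q ^ n) = pev h (a ^+ (q ^ n)).
Proof.
elim/poly_ind: h => [|h c IH].
  by rewrite /pev rmorph0 !horner0 expr0n expn_eq0 (gtn_eqF (ltnW card_gt1)).
by rewrite !pevD !pevM !pevX !pevC frobD exprMn IH frob_iota.
Qed.

Lemma frob_inj n : injective (fun y => y ^+ (q ^ n)).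
Proof.
move=> y z /= yz; apply/eqP; rewrite -subr_eq0.
have : (y - z) ^+ (q ^ n) + z ^+ (q ^ n) = z ^+ (q ^ n) by rewrite -frobD subrK.
move/eqP; rewrite -subr_eq0 addrK expf_eq0.
by case/andP.
Qed.

Section Prime.
Variables (P : {poly F}) (a : K).
Hypotheses (iP : mirred P) (Pa : pev P a = 0).
Local Notation d := (size P).-1.

Lemma size_mirredE : size P = d.+1.
Proof. by rewrite prednK // size_poly_gt0 mirred_neq0. Qed.

Lemma deg_mirred_gt0 : (0 < d)%N.
Proof. by rewrite -ltnS -size_mirredE mirred_size. Qed.

Lemma pev_eq0 h : (pev h a == 0) = (P %| h).
Proof.
apply/idP/idP => [/eqP h0|/dvdpP[g ->]]; last by rewrite pevM Pa mulr0.
apply: contraT; rewrite -mirred_coprime // => /Bezout_eq1_coprimepP[[u v] /= uv].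
have := congr1 (pev^~ a) uv; rewrite /= pevD !pevM Pa h0 !mulr0 addr0.
by rewrite -[1]/(1%:P) pevC rmorph1 => /eqP; rewrite eq_sym oner_eq0.
Qed.

Lemma pev_inj : {in pols F d &, injective (pev^~ a)}.
Proof.
move=> g h; rewrite !mem_pols => sg sh /eqP; rewrite -subr_eq0 -pevB pev_eq0.
move=> Pgh; apply/eqP; rewrite -subr_eq0; apply: contraT => gh0.
have := dvdp_leq gh0 Pgh; rewrite size_mirredE leqNgt => /negP[].
rewrite ltnS; apply: leq_trans (size_polyD _ _) _.
by rewrite size_polyN geq_max sg sh.
Qed.

(** If the [q^m]-th power map fixes [a], it fixes every [pev h a]; these are [q^d] distinct roots of
    [X^(q^m) - X]. *)
Lemma frob_fix_ge m : (0 < m)%N -> a ^+ (q ^ m) = a -> (d <= m)%N.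
Proof.
move=> m0 am; have qm : (1 < q ^ m)%N by rewrite -(exp1n m) ltn_exp2r // card_gt1.
have sX : size ('X^(q ^ m) - 'X : {poly K}) = (q ^ m).+1.
  by rewrite size_polyDl size_polyXn // size_polyN size_polyX.
have := @max_poly_roots _ ('X^(q ^ m) - 'X) (map (pev^~ a) (pols F d)).
rewrite sX size_map size_pols ltnS leq_exp2l ?card_gt1 //; apply.
- by rewrite -size_poly_eq0 sX.
- apply/allP => _ /mapP[h _ ->]; rewrite rootE !hornerE.
  by rewrite frob_pev am subrr.
- by rewrite map_inj_in_uniq ?uniq_pols //; apply: pev_inj.
Qed.


Definition conjs := [seq a ^+ (q ^ i) | i <- iota 0 d].

Lemma conj_root i : pev P (a ^+ (q ^ i)) = 0.
Proof.
by rewrite -frob_pev Pa expr0n expn_eq0 (gtn_eqF (ltnW card_gt1)).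
Qed.

Lemma conj_eq i j : (i < j)%N -> a ^+ (q ^ i) = a ^+ (q ^ j) -> (d <= j - i)%N.
Proof.
move=> ij E; apply: frob_fix_ge; first by rewrite subn_gt0.
apply: (@frob_inj i); rewrite /= -exprM -expnD subnK ?E //.
exact: ltnW.
Qed.

Lemma conjs_uniq : uniq conjs.
Proof.
rewrite map_inj_in_uniq ?iota_uniq // => i j; rewrite !mem_iota !add0n /=.
move=> id jd E; case: (ltngtP i j) => // ij.
  by have := conj_eq ij E; szlia.
by have := conj_eq ij (esym E); szlia.
Qed.

Lemma conjs_prod : map_poly io P = \prod_(z <- conjs) ('X - z%:P).
Proof.
have := @all_roots_prod_XsubC _ (map_poly io P) conjs.
rewrite size_map_poly lead_coef_map (monicP (mirred_monic iP)) rmorph1 scale1r.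
apply.
- by rewrite size_map size_iota size_mirredE.
- by apply/allP => _ /mapP[i _ ->]; rewrite rootE -/(pev _ _) conj_root.
- by rewrite uniq_rootsE conjs_uniq.
Qed.

(** [a^(q^d)] is again a root of [P], hence one of the conjugates; an exponent [i > 0] would force
    [d <= d - i]. *)
Lemma frob_deg : a ^+ (q ^ d) = a.
Proof.
have : a ^+ (q ^ d) \in conjs.
  by rewrite -root_prod_XsubC -conjs_prod rootE -/(pev _ _) conj_root.
case/mapP => i.
rewrite mem_iota add0n /= => id.
case: i id => [|i] id E; first by rewrite E expn0 expr1.
by have := conj_eq id (esym E); szlia.
Qed.

Lemma frob_deg_pev h : pev h a ^+ (q ^ d) = pev h a.
Proof. by rewrite frob_pev frob_deg. Qed.

Hypothesis odd_q : odd q.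
Local Notation M := (q ^ d)./2.

Lemma cardE : (q ^ d = M.*2.+1)%N.
Proof. by rewrite -[LHS]odd_double_half oddX odd_q orbT. Qed.

Lemma halfcard_gt0 : (0 < M)%N.
Proof.
have : (1 < q ^ d)%N by rewrite -(exp1n d) ltn_exp2r ?deg_mirred_gt0 // card_gt1.
by rewrite cardE; szlia.
Qed.

(** The non-zero elements of the residue field of [P], embedded in [K] through the root [a]. *)
Definition units_at := map (pev^~ a) [seq h <- pols F d | h != 0].

Lemma size_units_at : size units_at = M.*2.
Proof.
rewrite size_map -(rem_filter _ (uniq_pols F d)) size_rem.
  by rewrite size_pols {1}cardE.
by rewrite mem_pols size_poly0.
Qed.

Lemma uniq_units_at : uniq units_at.
Proof.
rewrite map_inj_in_uniq ?filter_uniq ?uniq_pols // => g h.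
by rewrite !mem_filter => /andP[_ gp] /andP[_ hp]; apply: pev_inj.
Qed.

Lemma pev_neq0 h : h \in pols F d -> h != 0 -> pev h a != 0.
Proof.
rewrite mem_pols => sh h0; rewrite pev_eq0; apply/negP => /(dvdp_leq h0).
by rewrite size_mirredE ltnNge sh.
Qed.

Lemma pev_exp_half x : pev x a != 0 ->
  pev x a ^+ M = 1 \/ pev x a ^+ M = -1.
Proof.
move=> y0; have : pev x a ^+ M.*2 == 1.
  apply/eqP/(mulfI y0); rewrite mulr1 -exprS -cardE; exact: frob_deg_pev.
rewrite -muln2 exprM sqrf_eq1 => /orP[] /eqP; [by left|by right].
Qed.

(** The converse is a count. If [y = pev x a] is no square but [y ^+ M = 1], then [y] and the set
    [S] of squares of units are roots of [X^M - 1], so [S] has fewer than [M] elements; yet all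
    [2 M] units are roots of the product of the [X^2 - s], whose degree is twice the size of [S]. *)
Lemma euler_criterion x : pev x a != 0 ->
  pev x a ^+ M = 1 <-> exists h, P %| x - h ^+ 2.
Proof.
move=> y0; split; last first.
  case=> h; rewrite -pev_eq0 pevB subr_eq0 expr2 pevM => /eqP E.
  have h0 : pev h a != 0 by move: y0; rewrite E mulf_eq0 orbb.
  rewrite E -expr2 -exprM mul2n; apply/(mulfI h0).
  by rewrite mulr1 -exprS -cardE frob_deg_pev.
move=> yM; apply: contrapT => nsq.
pose S := undup [seq t ^+ 2 | t <- units_at].
have yS : pev x a \notin S.
  rewrite mem_undup; apply/mapP => -[_ /mapP[h _ ->]] E; apply: nsq; exists h.
  by rewrite -pev_eq0 pevB expr2 pevM -expr2 E subrr.
have sS : (size S < M)%N.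
  have := @max_poly_roots _ ('X^M - 1%:P) (pev x a :: S).
  rewrite size_XnsubC ?halfcard_gt0 //= ltnS; apply.
  - by rewrite -size_poly_eq0 size_XnsubC ?halfcard_gt0.
  - rewrite rootE !hornerE yM subrr eqxx /=; apply/allP => z.
    rewrite mem_undup => /mapP[t /mapP[h + ->] ->]; rewrite mem_filter.
    move=> /andP[h0 hp]; rewrite rootE !hornerE subr_eq0; apply/eqP.
    have h0' := pev_neq0 hp h0.
    rewrite -exprM mul2n; apply/(mulfI h0').
    by rewrite mulr1 -exprS -cardE frob_deg_pev.
  - by rewrite yS undup_uniq.
have sP : size (\prod_(s <- S) ('X^2 - s%:P)) = (size S).*2.+1.
  elim: (S) => [|s r IH]; first by rewrite big_nil size_poly1.
  rewrite big_cons size_mul ?IH ?size_XnsubC //; last first.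
    by rewrite -size_poly_eq0 IH.
  by rewrite -size_poly_eq0 size_XnsubC.
have := @max_poly_roots _ (\prod_(s <- S) ('X^2 - s%:P)) units_at.
rewrite sP size_units_at ltnS leq_double leqNgt sS => H; suff: ~~ true by [].
apply: H; last exact: uniq_units_at.
  by rewrite -size_poly_eq0 sP.
apply/allP => t tU; rewrite rootE horner_prod prodf_seq_eq0; apply/hasP.
exists (t ^+ 2); last by rewrite /= !hornerE subrr.
by rewrite mem_undup; apply/mapP; exists t.
Qed.

Lemma legendreE x : (legendre x P)%:~R = pev x a ^+ M.
Proof.
rewrite /legendre; case: (boolP (P %| x)) => [|nPx].
  by rewrite -pev_eq0 => /eqP ->; rewrite expr0n (gtn_eqF halfcard_gt0).
have y0 : pev x a != 0 by rewrite pev_eq0.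
case: asboolP => [/(euler_criterion y0) -> //|nsq].
case: (pev_exp_half y0) => [/(euler_criterion y0) //|->].
by rewrite rmorphN1.
Qed.

(** Since [(q^d - 1)/2 = (1 + q + ... + q^(d-1)) (q - 1)/2], the power in Euler's criterion splits
    into powers [(q - 1)/2] over the conjugates [a^(q^i)]. *)
Lemma legendre_conjs x :
  (legendre x P)%:~R = \prod_(z <- conjs) pev x z ^+ q./2.
Proof.
rewrite legendreE big_map.
under eq_bigr do rewrite -frob_pev -exprM.
rewrite prodrXr; congr (_ ^+ _).
rewrite -big_distrl /=.
have -> : (\sum_(i <- iota 0 d) q ^ i = \sum_(i < d) q ^ i)%N.
  by rewrite -(big_mkord predT (fun i => q ^ i)%N) /index_iota subn0.
have qE : (q = q./2.*2.+1)%N by rewrite -[LHS]odd_double_half odd_q.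
have := predn_exp q d.
rewrite (_ : (q ^ d).-1 = M.*2)%N; last by rewrite {1}cardE.
rewrite (_ : q.-1 = q./2.*2)%N; last by rewrite {1}qE.
by rewrite -doubleMl => /double_inj ->; rewrite mulnC.
Qed.

(** Otherwise all [2 M] units would be roots of [X^M - 1]. *)
Lemma nonresidue_exists : exists c, legendre c P = -1.
Proof.
apply: contrapT => nc.
have := @max_poly_roots _ ('X^M - 1%:P) units_at.
rewrite size_XnsubC ?halfcard_gt0 // size_units_at ltnS => H.
have := halfcard_gt0; suff : (M.*2 <= M)%N by szlia.
apply: H; last exact: uniq_units_at.
  by rewrite -size_poly_eq0 size_XnsubC ?halfcard_gt0.
apply/allP => t /mapP[h + ->]; rewrite mem_filter => /andP[h0 hp].
have nPh : (P %| h) = false by rewrite -pev_eq0 (negPf (pev_neq0 hp h0)).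
have E : legendre h P = 1.
  have : legendre h P <> -1 by move=> E; apply: nc; exists h.
  by rewrite /legendre nPh; case: ifP.
by rewrite rootE !hornerE -legendreE E subrr.
Qed.

End Prime.
End FrobeniusInClosure.

(** * The residue symbol as a power of a resultant *)

Section Jacobi.
Variable F : finFieldType.
Hypothesis odd_q : odd #|F|.
Local Notation q := #|F|.
Implicit Types (f g x y P : {poly F}).

Lemma odd_card_gt2 : (2 < q)%N.
Proof. by have := card_gt1 F; case: q odd_q => [|[|[]]]. Qed.

Lemma legendre_val x P : legendre x P \in [:: -1; 0; 1].
Proof. by rewrite /legendre; case: ifP => // _; case: ifP. Qed.

Lemma chi_val x f : chi x f \in [:: -1; 0; 1].
Proof.
rewrite /chi; apply: (big_ind (fun z : int => z \in [:: -1; 0; 1])) => //.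
  by move=> u v; rewrite !inE => /or3P[]/eqP-> /or3P[]/eqP->.
move=> P _; elim: multiplicity => [|n]; first by rewrite expr0.
rewrite exprS; have := legendre_val x (val P).
by rewrite !inE => /or3P[]/eqP-> /or3P[]/eqP->.
Qed.

(* Conjugates of a root of a prime P turn Euler's criterion into a product over
   the roots of P, so the symbol (x/f) becomes a resultant raised to (q-1)/2. *)
Lemma chi_roots (K : closedFieldType) (io : {rmorphism F -> K}) f : f \is monic ->
  exists2 r : seq K, map_poly io f = \prod_(z <- r) ('X - z%:P) &
    forall x, (chi x f)%:~R = \prod_(z <- r) pev io x z ^+ q./2.
Proof.
move=> mf; elim/monic_ind: f / mf => [|P f iP mf [r fr chir]].
  exists [::]; first by rewrite rmorph1 big_nil.
  by move=> x; rewrite chi1 big_nil.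
have [|a Pa] := @closed_rootP _ (map_poly io P) _.
  by rewrite size_map_poly neq_ltn mirred_size ?orbT.
have {}Pa : pev io P a = 0 by apply/eqP.
exists (conjs P a ++ r).
  by rewrite rmorphM /= (conjs_prod iP Pa) fr big_cat.
move=> x; rewrite chiP1 ?monic_neq0 // intrM (legendre_conjs iP Pa odd_q) chir.
by rewrite big_cat.
Qed.

(** Identities between symbols are verified in [K], where -1, 0 and 1 stay distinct because the
    characteristic is odd. *)
Lemma chi_transfer (K : fieldType) (io : {rmorphism F -> K}) (a b : int) :
  a \in [:: -1; 0; 1] -> b \in [:: -1; 0; 1] -> a%:~R = b%:~R :> K -> a = b.
Proof.
have t0 : (2%:R : K) != 0.
  rewrite -(rmorph_nat io) fmorph_eq0.
  have [p pp pF] := finPcharP F.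
  have [n qE] : exists n, q = (p ^ n)%N.
    by exists (logn p q); exact: card_pprimeChar pF.
  apply/negP => t0; have : 2%N \in [pchar F] by rewrite inE /= t0.
  rewrite (pcharf_eq pF) inE => /eqP p2; move: odd_q; rewrite qE -p2 oddX /= orbF.
  move=> /eqP n0; have := card_gt1 F; rewrite qE -p2 n0.
  by [].
have o0 : (1 : K) != 0 by exact: oner_neq0.
have n11 : (1 : K) != -1 by rewrite -subr_eq0 opprK.
rewrite !inE => /or3P[]/eqP-> /or3P[]/eqP-> //= /eqP;
  rewrite ?rmorphN1 ?rmorph0 ?rmorph1 ?oppr_eq0 ?(negPf o0) // eq_sym
    ?rmorphN1 ?oppr_eq0 ?(negPf o0) ?(negPf n11) //.
by rewrite eq_sym (negPf n11).
Qed.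

Lemma chiM x y f : f \is monic -> chi (x * y) f = chi x f * chi y f.
Proof.
move=> mf; have [K [io _]] := countable_algebraic_closure F.
have [r fr chir] := chi_roots io mf; apply: (@chi_transfer _ io).
- exact: chi_val.
- have := chi_val x f; have := chi_val y f.
  by rewrite !inE => /or3P[]/eqP-> /or3P[]/eqP->.
rewrite intrM !chir -big_split; apply: eq_bigr => z _.
by rewrite pevM exprMn.
Qed.

Lemma chi_mod x y f : f \is monic -> f %| x - y -> chi x f = chi y f.
Proof.
move=> mf fxy; have [K [io _]] := countable_algebraic_closure F.
have [r fr chir] := chi_roots io mf; apply: (@chi_transfer _ io).
- exact: chi_val.
- exact: chi_val.
rewrite !chir big_seq [RHS]big_seq; apply: eq_bigr => z zr; congr (_ ^+ _).
apply/eqP; rewrite -subr_eq0 -pevB; case/dvdpP: fxy => g ->.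
rewrite pevM mulf_eq0 /pev fr horner_prod prodf_seq_eq0; apply/orP; right.
by apply/hasP; exists z => //; rewrite /= !hornerE subrr.
Qed.

Lemma size_prod_roots (K : fieldType) (io : {rmorphism F -> K}) f (r : seq K) :
  map_poly io f = \prod_(z <- r) ('X - z%:P) -> size f = (size r).+1.
Proof. by move=> fr; rewrite -(size_map_poly io) fr size_prod_XsubC. Qed.

(** Both symbols are products of [(z - i)^((q-1)/2)] over pairs of roots, up to the order in each
    difference; the resulting sign [(-1)^(deg f deg g (q-1)/2)] is 1 because [deg g] is even. *)
Lemma chi_reciprocity f g : f \is monic -> g \is monic -> odd (size g) ->
  chi f g = chi g f.
Proof.
move=> mf mg sg; have [K [io _]] := countable_algebraic_closure F.
have [r fr chif] := chi_roots io mf; have [s gs chig] := chi_roots io mg.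
apply: (@chi_transfer _ io); rewrite ?chi_val //.
rewrite chif chig.
under eq_bigr => z _ do rewrite /pev fr horner_prod -prodrXl.
under [RHS]eq_bigr => z _ do rewrite /pev gs horner_prod -prodrXl.
rewrite exchange_big /=; apply: eq_bigr => z _.
have -> : \prod_(j <- s) ('X - z%:P).[j] ^+ q./2 =
    \prod_(i <- s) ((-1) ^+ q./2 * ('X - i%:P).[z] ^+ q./2).
  apply: eq_bigr => i _; rewrite -exprMn !hornerE; congr (_ ^+ _); ring.
rewrite big_split /= prodr_const_seq -exprM mulnC exprM -signr_odd.
move: sg; rewrite (size_prod_roots gs) /= => /negPf ->.
by rewrite expr0 expr1n mul1r.
Qed.

(** An even number of roots makes the symbol a power of [c^(q-1) = 1]. *)
Lemma chi_const (c : F) f : f \is monic -> odd (size f) -> c != 0 ->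
  chi c%:P f = 1.
Proof.
move=> mf sf c0; have [K [io _]] := countable_algebraic_closure F.
have [r fr chir] := chi_roots io mf; apply: (@chi_transfer _ io); rewrite ?chi_val //.
rewrite chir rmorph1; under eq_bigr do rewrite pevC.
rewrite prodr_const_seq -exprM -rmorphXn /=.
move: sf; rewrite (size_prod_roots fr) /= => /even_halfK <-.
have qE : (q = q./2.*2.+1)%N by rewrite -[LHS]odd_double_half odd_q.
have cq : c ^+ q./2.*2 = 1 by apply: (mulfI c0); rewrite -exprS -qE expf_card mulr1.
by rewrite -doubleMr doubleMl exprM cq expr1n rmorph1.
Qed.

Lemma nonresidue P : mirred P -> exists c, legendre c P = -1.
Proof.
move=> iP; have [K [io _]] := countable_algebraic_closure F.
have [|a Pa] := @closed_rootP _ (map_poly io P) _.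
  by rewrite size_map_poly neq_ltn mirred_size ?orbT.
by apply: (@nonresidue_exists _ _ io P a iP) => //; apply/eqP.
Qed.

Lemma legendreP1 x P : mirred P -> chi x P = legendre x P.
Proof. by move=> iP; rewrite -{1}[P]mulr1 chiP1 ?oner_neq0 // chi1 mulr1. Qed.

Lemma legendre_eq0 x P : (legendre x P == 0) = (P %| x).
Proof. by rewrite /legendre; case: ifP => // _; case: ifP. Qed.

Lemma chi_eq0 x f : f \is monic -> (chi x f == 0) = ~~ coprimep x f.
Proof.
move=> mf; elim/monic_ind: f / mf => [|P f iP mf IH].
  by rewrite chi1 coprimep1.
rewrite chiP1 ?monic_neq0 // mulf_eq0 IH legendre_eq0 coprimepMr negb_and.
by rewrite [coprimep x P]coprimep_sym (mirred_coprime x iP) negbK.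
Qed.

Lemma chi_sqr x f : f \is monic -> chi (x ^+ 2) f = (coprimep x f)%:R.
Proof.
move=> mf; rewrite expr2 chiM //; have := chi_eq0 x mf.
have := chi_val x f; rewrite !inE => /or3P[]/eqP-> /=.
all: by case: coprimep.
Qed.

Lemma chi_sqrr x f : f \is monic -> chi x (f ^+ 2) = (coprimep x f)%:R.
Proof.
move=> mf; rewrite expr2 chiMr //; have := chi_eq0 x mf.
have := chi_val x f; rewrite !inE => /or3P[]/eqP-> /=.
all: by case: coprimep.
Qed.

End Jacobi.

(** * Gauss sums *)

Section SumsOverPolynomials.
Variable F : finFieldType.
Local Notation q := #|F|.
Implicit Types (f g D E P V x y z : {poly F}).

Lemma pols0 : pols F 0 = [:: 0].
Proof.
apply: perm_small_eq => //; apply: uniq_perm; rewrite ?uniq_pols // => x.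
by rewrite mem_pols inE leqn0 size_poly_eq0.
Qed.

Lemma mon0 : mon F 0 = [:: 1].
Proof.
apply: perm_small_eq => //; apply: uniq_perm; rewrite ?uniq_mon // => f.
rewrite mem_mon inE; apply/andP/eqP => [[mf /eqP]|->]; first exact: monic_size1.
by rewrite monic1 size_poly1.
Qed.

(** By counting, a reindexing map needs no explicit inverse. *)
Lemma perm_inj_map (T U : eqType) (h : T -> U) (s : seq T) (r : seq U) :
  uniq s -> {in s &, injective h} -> {in s, forall t, h t \in r} ->
  (size r <= size s)%N -> perm_eq (map h s) r.
Proof.
move=> us ih sub sz.
have um : uniq (map h s) by rewrite map_inj_in_uniq.
have sub' : {subset map h s <= r} by move=> _ /mapP[x xs ->]; apply: sub.
have sz' : (size r <= size (map h s))%N by rewrite size_map.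
have [_ eqi] := uniq_min_size um sub' sz'.
by apply: uniq_perm => //; apply: leq_size_uniq um sub' sz'.
Qed.

Lemma sum_pols_shift (V : nmodType) n z (h : {poly F} -> V) : (size z <= n)%N ->
  \sum_(y <- pols F n) h (y + z) = \sum_(y <- pols F n) h y.
Proof.
move=> sz; rewrite -(big_map (fun y => y + z) xpredT h); apply: perm_big.
apply: perm_inj_map => //; first exact: uniq_pols.
  by move=> x y _ _ /addIr.
move=> y; rewrite !mem_pols => sy; apply: leq_trans (size_polyD _ _) _.
by rewrite geq_max sy.
Qed.

Lemma sum_pols_split (V : nmodType) e m E (h : {poly F} -> V) : E \in mon F e ->
  \sum_(y <- pols F (e + m)) h y =
  \sum_(y <- pols F e) \sum_(z <- pols F m) h (y + E * z).
Proof.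
rewrite mem_mon => /andP[mE /eqP sE]; have E0 := monic_neq0 mE.
pose s := [seq (y, z) | y <- pols F e, z <- pols F m].
transitivity (\sum_(u <- s) h (u.1 + E * u.2)); last by rewrite big_allpairs.
rewrite -(big_map (fun u : {poly F} * {poly F} => u.1 + E * u.2) xpredT h).
apply: perm_big; rewrite perm_sym; apply: perm_inj_map.
- by rewrite allpairs_uniq ?uniq_pols // => -[? ?] [? ?].
- move=> _ _ /allpairsP[[y z] /= [ys zs ->]] /allpairsP[[y' z'] /= [ys' zs' ->]] /=.
  have sm (w : {poly F}) : w \in pols F e -> w %% E = w.
    by rewrite mem_pols => sw; rewrite modp_small // sE ltnS.
  move=> E1; have := congr1 (fun w => w %% E) E1.
  rewrite !modpD ![E * _]mulrC !modp_mull !addr0 !sm // => yy.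
  by move: E1; rewrite yy => /addrI/(mulfI E0) ->.
- move=> _ /allpairsP[[y z] /= [ys zs ->]] /=; move: ys zs; rewrite !mem_pols.
  move=> sy sz; apply: leq_trans (size_polyD _ _) _.
  rewrite geq_max (leq_trans sy) ?leq_addr //=.
  apply: leq_trans (size_polyMleq _ _) _; rewrite sE; szlia.
- by rewrite size_allpairs !size_pols expnD.
Qed.

Lemma sum_pols1 (V : nmodType) (h : {poly F} -> V) :
  \sum_(x <- pols F 1) h x = \sum_(c : F) h c%:P.
Proof.
rewrite -big_enum -(big_map (fun c : F => c%:P) xpredT h) /=; apply: perm_big.
apply: uniq_perm; first exact: uniq_pols.
  by rewrite map_inj_uniq ?enum_uniq //; apply: polyC_inj.
move=> x; rewrite mem_pols; apply/idP/mapP => [/size1_polyC ->|[c _ ->]].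
  by exists x`_0; rewrite ?mem_enum.
by rewrite size_polyC; case: (c != 0).
Qed.

Lemma sum_pols_mon (V : nmodType) n (h : {poly F} -> V) :
  \sum_(x <- pols F n) h x =
  h 0 + \sum_(0 <= j < n) \sum_(c : F | c != 0) \sum_(f <- mon F j) h (c *: f).
Proof.
elim: n => [|n IH]; first by rewrite pols0 big_seq1 big_geq ?addr0.
have Xn : 'X^n \in mon F n by rewrite mem_mon monicXn size_polyXn eqxx.
rewrite -addn1 (sum_pols_split _ _ Xn) exchange_big /= sum_pols1.
rewrite (bigD1 0) //= addn1 big_nat_recr //= addrA -IH; congr (_ + _).
  by apply: eq_bigr => x _; rewrite mulr0 addr0.
apply: eq_bigr => c c0; rewrite sum_mon.
rewrite -(big_map (fun y => y + 'X^n * c%:P) xpredT h).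
rewrite -(big_map (fun r => c *: ('X^n + r)) xpredT h).
apply: perm_big; apply: perm_trans (_ : perm_eq (map (fun y => c *: y + 'X^n * c%:P) (pols F n)) _).
  rewrite perm_sym (map_comp (fun y => y + 'X^n * c%:P) (fun y => c *: y)).
  apply: perm_map; apply: perm_inj_map => //; first exact: uniq_pols.
    by move=> x y _ _ /(scalerI c0).
  by move=> x; rewrite !mem_pols size_scale.
rewrite (eq_map (g := fun r => c *: ('X^n + r))) // => r /=.
by rewrite scalerDr mulrC mul_polyC addrC.
Qed.

(** A substitute for orthogonality of characters: translating [z] by a multiple of [z0] shifts the
    argument of [phi] by any prescribed [a] without changing the sum, and averaging over [a] gives
    0. *)
Lemma sum_functional m (phi : F -> int) (lam : {poly F} -> F) z0 (c : F) :
  \sum_(a : F) phi a = 0 ->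
  {morph lam : x y / x + y} -> (forall a x, lam (a *: x) = a * lam x) ->
  z0 \in pols F m -> lam z0 != 0 ->
  \sum_(z <- pols F m) phi (c + lam z) = 0.
Proof.
move=> phi0 lamD lamZ; rewrite mem_pols => sz0 lz0.
set S := LHS.
have shift a : \sum_(z <- pols F m) phi (c + lam z + a) = S.
  rewrite /S -[RHS](@sum_pols_shift _ m ((a / lam z0) *: z0)); last first.
    exact: leq_trans (size_scale_leq _ _) _.
  by apply: eq_bigr => z _ /=; rewrite lamD lamZ divfK // addrA.
have : q%:R * S = 0.
  transitivity (\sum_(a : F) S); first by rewrite sumr_const mulr_natl.
  under eq_bigr => a _ do rewrite -(shift a).
  rewrite exchange_big big1 // => z _.
  rewrite (reindex_inj (addrI (- (c + lam z)))) /= -[RHS]phi0.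
  by apply: eq_bigr => a _; rewrite addNKr.
by move/eqP; rewrite mulf_eq0 pnatr_eq0 => /orP[/eqP q0|/eqP //]; have := card_gt1 F; rewrite q0.
Qed.

Lemma sum_crt (A : nmodType) d e f g (H : {poly F} -> {poly F} -> A) :
  f \in mon F d -> g \in mon F e -> coprimep f g ->
  \sum_(x <- pols F (d + e)) H (x %% f) (x %% g) =
  \sum_(u <- pols F d) \sum_(v <- pols F e) H u v.
Proof.
rewrite !mem_mon => /andP[mf /eqP sf] /andP[mg /eqP sg] cfg.
transitivity (\sum_(w <- [seq (u, v) | u <- pols F d, v <- pols F e]) H w.1 w.2);
  last by rewrite big_allpairs.
rewrite -(big_map (fun x => (x %% f, x %% g)) xpredT (fun u => H u.1 u.2)).
apply: perm_big; apply: perm_inj_map.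
- exact: uniq_pols.
- move=> x y; rewrite !mem_pols => sx sy E.
  have dvdB k : x %% k = y %% k -> k %| x - y.
    by move=> xy; rewrite /dvdp modpD modpN xy subrr.
  have fxy := dvdB _ (congr1 fst E); have gxy := dvdB _ (congr1 snd E).
  have : f * g %| x - y by rewrite Gauss_dvdp // fxy.
  move=> fg; apply/eqP; rewrite -subr_eq0; apply: contraT => xy0.
  have := dvdp_leq xy0 fg; rewrite size_monicM // sf sg.
  have : (size (x - y)%R <= d + e)%N.
    by apply: leq_trans (size_polyD _ _) _; rewrite size_polyN geq_max sx sy.
  by move=> le1 le2; have := leq_trans le2 le1; lia.
- move=> x _; apply/allpairsP; exists (x %% f, x %% g); split => //=.
    by rewrite mem_pols -ltnS -sf ltn_modpN0 ?monic_neq0.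
  by rewrite mem_pols -ltnS -sg ltn_modpN0 ?monic_neq0.
- by rewrite size_allpairs !size_pols expnD.
Qed.

Lemma sum_pols_mul (A : nmodType) N D c (h : {poly F} -> A) : D \in mon F N ->
  coprimep D c -> (forall x y, D %| x - y -> h x = h y) ->
  \sum_(x <- pols F N) h (c * x) = \sum_(x <- pols F N) h x.
Proof.
rewrite mem_mon => /andP[mD /eqP sD] cDc hmod; have D0 := monic_neq0 mD.
have dm x : D %| x - x %% D by rewrite {1}(divp_eq x D) addrK dvdp_mull.
rewrite (eq_bigr (fun x => h ((c * x) %% D))) => [|x _]; last exact: hmod.
rewrite -(big_map (fun x => (c * x) %% D) xpredT h); apply: perm_big.
apply: perm_inj_map => //; first exact: uniq_pols.
  move=> x y; rewrite !mem_pols => sx sy /eqP.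
  rewrite -subr_eq0 -modpN -modpD -mulrN -mulrDr -/(dvdp _ _) Gauss_dvdpr //.
  move=> Dxy; apply/eqP; rewrite -subr_eq0; apply: contraT => xy0.
  have := dvdp_leq xy0 Dxy; rewrite sD leqNgt => /negP[]; rewrite ltnS.
  by apply: leq_trans (size_polyD _ _) _; rewrite size_polyN geq_max sx sy.
by move=> x _; rewrite mem_pols -ltnS -sD ltn_modpN0.
Qed.

End SumsOverPolynomials.

(** * Gauss sums for square-free moduli *)

Section GaussSum.
Variables (F : finFieldType).
Hypothesis odd_q : odd #|F|.
Local Notation q := #|F|.
Implicit Types (f g D E P V x y z : {poly F}).

Lemma two_neq0 : (2%:R : F) != 0.
Proof.
have [p pp pF] := finPcharP F.
have [n qE] : exists n, q = (p ^ n)%N.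
  by exists (logn p q); exact: card_pprimeChar pF.
apply/negP => t0; have : 2%N \in [pchar F] by rewrite inE /= t0.
rewrite (pcharf_eq pF) inE => /eqP p2; move: odd_q; rewrite qE -p2 oddX /= orbF.
by move=> /eqP n0; have := card_gt1 F; rewrite qE -p2 n0.
Qed.

Lemma chi_one f : f \is monic -> chi 1 f = 1.
Proof. by move=> mf; rewrite -(expr1n _ 2) chi_sqr // coprime1p. Qed.

Definition root_count D y : int :=
  \sum_(x <- pols F (size D).-1) (D %| x ^+ 2 - y)%R%:R.

Lemma root_count_prime P y : mirred P -> root_count P y = 1 + legendre y P.
Proof.
move=> iP; rewrite /root_count; set d := (size P).-1.
have P0 := mirred_neq0 iP.
have sP : size P = d.+1 by rewrite prednK // size_poly_gt0.
have smallE (u v : {poly F}) : u \in pols F d -> (P %| u - v) = (u == v %% P).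
  rewrite mem_pols => su; rewrite /dvdp modpD modpN modp_small ?sP //.
  by rewrite subr_eq0.
have modP u : u %% P \in pols F d by rewrite mem_pols -ltnS -sP ltn_modpN0.
have single (v : {poly F}) : \sum_(x <- pols F d) (x == v %% P)%:R = 1 :> int.
  rewrite (bigD1_seq (v %% P)) ?uniq_pols //= eqxx big1_seq ?addr0 // => x.
  by case/andP => /negPf ->.
rewrite /legendre; case: ifP => Py.
  rewrite addr0 -[RHS](single 0) big_seq [RHS]big_seq; apply: eq_bigr => x xp.
  rewrite -smallE // subr0 dvdp_addl ?dvdpNr //.
  by rewrite expr2 mirred_dvdM // orbb.
case: asboolP => [[h Ph]|nsq]; last first.
  rewrite subrr big1 // => x _; case: (boolP (_ %| _)) => // H; case: nsq.
  by exists x; rewrite -dvdpNr opprB.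
have -> : (1 + 1 : int) = \sum_(x <- pols F d) (x == h %% P)%:R +
    \sum_(x <- pols F d) (x == - h %% P)%:R by rewrite !single.
rewrite -big_split /=.
rewrite big_seq [RHS]big_seq; apply: eq_bigr => x xp.
have -> : (P %| x ^+ 2 - y) = (P %| x - h) || (P %| x - - h).
  rewrite -mirred_dvdM // opprK -subr_sqr.
  rewrite (_ : x ^+ 2 - h ^+ 2 = (x ^+ 2 - y) + (y - h ^+ 2)); last by ring.
  by rewrite [RHS]dvdp_addl.
rewrite -!smallE //; case: (boolP (P %| x - h)) => [H1|_]; last by rewrite add0r.
case: (boolP (P %| x - - h)) => [H2|_]; last by [].
(* The residues of [h] and [- h] are distinct: a coincidence would make [P] divide [2 h], hence [h]
   and [y]. *)
have : P %| (2%:R : F) *: h.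
  have -> : (2%:R : F) *: h = (x - - h) - (x - h).
    by rewrite scaler_nat mulr2n; ring.
  by rewrite dvdp_sub.
rewrite dvdpZr ?two_neq0 // => PhP; move: Py; rewrite -[y](subrK (h ^+ 2)).
by rewrite dvdp_addr // expr2 dvdp_mull.
Qed.

Lemma root_count_sqf D y : D \is monic -> sqf D ->
  root_count D y = \prod_(P <- pdivs D) (1 + legendre y P).
Proof.
move=> mD; elim/monic_ind: D / mD => [_|P f iP mf IH].
  rewrite pdivs1 big_nil /root_count size_poly1 pols0 big_seq1.
  by rewrite dvd1p.
rewrite sqfM // => /andP[nPf sf].
rewrite (perm_big _ (pdivsM iP mf nPf)) big_cons /= -IH // -root_count_prime //.
have mP := mirred_monic iP.
have Pd : P \in mon F (size P).-1.
  by rewrite mem_mon mP prednK ?eqxx // size_poly_gt0 monic_neq0.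
have fe : f \in mon F (size f).-1.
  by rewrite mem_mon mf prednK ?eqxx // size_poly_gt0 monic_neq0.
rewrite /root_count; have cPf : coprimep P f by rewrite mirred_coprime.
have -> : (size (P * f)%R).-1 = ((size P).-1 + (size f).-1)%N.
  rewrite size_monicM //; have := size_poly_gt0 f; have := size_poly_gt0 P.
  rewrite !monic_neq0 //; szlia.
rewrite mulr_suml; under [RHS]eq_bigr do rewrite mulr_sumr.
rewrite -(sum_crt (fun u v => (P %| u ^+ 2 - y)%R%:R * (f %| v ^+ 2 - y)%R%:R) Pd fe cPf).
apply: eq_bigr => x _ /=.
have red (g : {poly F}) : (g %| (x %% g) ^+ 2 - y) = (g %| x ^+ 2 - y).
  rewrite -[RHS](dvdp_addr _ (_ : g %| (x %% g) ^+ 2 - x ^+ 2)).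
    by rewrite addrA subrK.
  rewrite subr_sqr dvdp_mulr // {2}(divp_eq x g) opprD addrCA subrr addr0.
  by rewrite dvdpNr dvdp_mull.
rewrite !red Gauss_dvdp //.
by case: (P %| _); case: (f %| _).
Qed.

Section Modulus.
Variables (N : nat) (D : {poly F}) (phi : F -> int).
Hypotheses (DN : D \in mon F N) (sD : sqf D) (N_gt0 : (0 < N)%N).
Hypothesis phi0 : \sum_(a : F) phi a = 0.

Let mD : D \is monic. Proof. by move: DN; rewrite mem_mon => /andP[]. Qed.
Let szD : size D = N.+1. Proof. by move: DN; rewrite mem_mon => /andP[_ /eqP]. Qed.
Let D0 : D != 0. Proof. exact: monic_neq0. Qed.

(* The coefficient of 1 / X in the Laurent expansion of x / D; [phi \o ell] plays the
   role of an additive character mod D, and can take integer values because only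
   the vanishing of the sum of phi is ever used. *)
Definition ell x : F := (x %% D)`_N.-1.

Lemma ellD : {morph ell : x y / x + y}.
Proof. by move=> x y; rewrite /ell modpD coefD. Qed.

Lemma ellZ a x : ell (a *: x) = a * ell x.
Proof. by rewrite /ell modpZl coefZ. Qed.

Lemma ell_small x : (size x <= N)%N -> ell x = x`_N.-1.
Proof. by move=> sx; rewrite /ell modp_small // szD. Qed.

Lemma ell_tiny x : (size x < N)%N -> ell x = 0.
Proof.
move=> sx; rewrite ell_small ?(ltnW sx) // nth_default //.
by rewrite -ltnS prednK.
Qed.

Lemma ell_lead x : size x = N -> ell x != 0.
Proof.
move=> sx; rewrite ell_small ?sx // -sx -lead_coefE lead_coef_eq0.
by rewrite -size_poly_gt0 sx.
Qed.

Lemma ell_mod x y : D %| x - y -> ell x = ell y.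
Proof.
move=> Dxy; rewrite -[x](subrK y) ellD.
by rewrite {1}/ell (eqP Dxy) coef0 add0r.
Qed.

Definition gauss V := \sum_(x <- pols F N) chi x D * phi (ell (x * V)).

(** For [V] prime to [D] the variable [x] is multiplied by [V]. Otherwise both sides vanish: with a
    prime [P] dividing [D = P * E] and [V], take [c] congruent to 1 mod [E] and to a non-residue mod
    [P]. Then [chi c D = -1] while [c V] and [V] agree mod [D], so [gauss V = - gauss V]. *)
Lemma gauss_twist V : gauss V = chi V D * gauss 1.
Proof.
have [cDV|ncDV] := boolP (coprimep D V).
  have hmod x y : D %| x - y -> chi x D * phi (ell x) = chi y D * phi (ell y).
    by move=> Dxy; rewrite (chi_mod odd_q mD Dxy) (ell_mod Dxy).
  have := sum_pols_mul DN cDV hmod.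
  rewrite /gauss; under [in RHS]eq_bigr do rewrite -[X in ell X]mulr1.
  move <-; rewrite mulr_sumr; apply: eq_bigr => x _.
  rewrite chiM // mulrA mulrA [V * x]mulrC.
  have -> : chi V D * chi V D = 1 by rewrite -chiM // -expr2 chi_sqr // coprimep_sym cDV.
  by rewrite mul1r.
have := ncDV; rewrite coprimep_sym -(chi_eq0 V mD) => /eqP ->; rewrite mul0r.
have [P iP PG] : exists2 P, mirred P & P %| gcdp D V.
  apply: exists_mirred; move: ncDV; rewrite /coprimep neq_ltn ltnS leqn0.
  by rewrite size_poly_eq0 gcdp_eq0 (negPf D0).
move: PG; rewrite dvdp_gcd => /andP[PD PV].
have [E mE DE] := dvdp_monicE (mirred_monic iP) mD PD.
have cPE : coprimep P E.
  by move: sD; rewrite DE sqfM // mirred_coprime // => /andP[].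
have /Bezout_eq1_coprimepP[[u v] /= uv] := cPE.
have [c0 lc0] := nonresidue odd_q iP.
pose c := u * P + c0 * (v * E).
have cE : E %| c - 1.
  rewrite /c -uv (_ : _ - _ = (c0 - 1) * v * E); last by ring.
  by rewrite dvdp_mull.
have cP : P %| c - c0.
  rewrite /c (_ : _ - _ = (u * P + c0 * (v * E)) - c0 * (u * P + v * E)).
    rewrite (_ : _ - _ = (1 - c0) * u * P); last by ring.
    by rewrite dvdp_mull.
  by rewrite uv mulr1.
have chic : chi c D = -1.
  rewrite DE chiP1 ?monic_neq0 // (chi_mod odd_q mE cE) chi_one // mulr1.
  by rewrite -legendreP1 // (chi_mod odd_q (mirred_monic iP) cP) legendreP1.
have cDc : coprimep D c.
  by rewrite coprimep_sym -[coprimep _ _]negbK -chi_eq0 // chic.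
have hmod x y : D %| x - y ->
    chi x D * phi (ell (x * V)) = chi y D * phi (ell (y * V)).
  move=> Dxy; rewrite (chi_mod odd_q mD Dxy) (@ell_mod (x * V) (y * V)) //.
  by rewrite -mulrBl dvdp_mulr.
have : gauss V = - gauss V.
  rewrite {1}/gauss -(sum_pols_mul DN cDc hmod) /gauss -sumrN.
  apply: eq_bigr => x _; rewrite chiM // chic mulN1r mulNr; congr (- (_ * phi _)).
  apply: ell_mod; rewrite (_ : _ - _ = x * ((c - 1) * V)); last by ring.
  by rewrite dvdp_mull // DE mulrC dvdp_mul.
by move/eqP; rewrite -addr_eq0 -mulr2n mulrn_eq0 => /eqP.
Qed.

(** With the residue [y] mod [E] fixed, [chi] is constant on [y + E * z], whereas [ell (E * z)] is a
    non-zero functional of [z]: it does not vanish at [z = X^(N-e-1)], for which [E * z] has degree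
    [N - 1]. *)
Lemma sum_chi_proper E : E \is monic -> E %| D -> E != D ->
  \sum_(y <- pols F N) chi y E * phi (ell y) = 0.
Proof.
move=> mE ED nED; set e := (size E).-1.
have sE : size E = e.+1 by rewrite prednK // size_poly_gt0 monic_neq0.
have eN : (e < N)%N.
  rewrite ltn_neqAle -(eqn_add2r 1) !addn1 -sE -szD.
  have := dvdp_leq D0 ED; rewrite sE szD ltnS => ->; rewrite andbT.
  apply: contra nED => /eqP sED; rewrite -eqp_monic //.
  by rewrite -dvdp_size_eqp // sE szD sED.
have Ee : E \in mon F e by rewrite mem_mon mE sE eqxx.
rewrite -(subnKC (ltnW eN)) (sum_pols_split _ _ Ee) big1 // => y _.
under eq_bigr => z _.
  rewrite (@chi_mod _ odd_q _ y _ mE) ?ellD; last first.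
    by rewrite addrC addKr dvdp_mulr.
  over.
rewrite -mulr_sumr; apply/eqP; rewrite mulf_eq0; apply/orP; right; apply/eqP.
apply: (@sum_functional F (N - e) phi (fun z => ell (E * z)) ('X^((N - e).-1)) (ell y)) => //.
- by move=> x z; rewrite mulrDr ellD.
- by move=> a x; rewrite -scalerAr ellZ.
- by rewrite mem_pols size_polyXn prednK // subn_gt0.
apply: ell_lead; rewrite size_monicM ?monicXn // size_polyXn sE.
by rewrite addSn /= prednK ?subn_gt0 // subnKC // ltnW.
Qed.

(** Expanding the product gives one character for each subset of the primes, and [sum_chi_proper]
    kills all moduli other than [D]. During the induction [E] collects the primes already chosen. *)
Lemma sum_chi_subsets (s : seq {poly F}) E : all (@mirred F) s -> E \is monic ->
  E * \prod_(P <- s) P %| D ->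
  \sum_(y <- pols F N) chi y E * \prod_(P <- s) (1 + legendre y P) * phi (ell y) =
  if E * \prod_(P <- s) P == D then gauss 1 else 0.
Proof.
elim: s E => [|P s IH] E.
  rewrite big_nil mulr1 => _ mE ED.
  under eq_bigr do rewrite big_nil mulr1.
  case: eqP => [->|/eqP nED]; last exact: sum_chi_proper.
  by rewrite /gauss; apply: eq_bigr => y _; rewrite mulr1.
move=> /andP[iP ms] mE; rewrite big_cons => H.
have mP := mirred_monic iP.
have mS : \prod_(P <- s) P \is monic.
  by rewrite big_seq monic_prod // => Q /(allP ms)/mirred_monic.
have H1 : E * \prod_(P <- s) P %| D.
  by apply: dvdp_trans H; rewrite dvdp_mul2l ?monic_neq0 // dvdp_mull.
under [LHS]eq_bigr => y _.
  rewrite big_cons mulrDl mul1r mulrDr mulrDl.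
  rewrite [_ * (legendre _ _ * _)]mulrCA mulrA -chiP1 ?monic_neq0 //; over.
have EP : E * (P * \prod_(P <- s) P) = P * E * \prod_(P <- s) P.
  by rewrite mulrA [E * P]mulrC.
have mPE : P * E \is monic by rewrite monicMl.
rewrite EP in H *; rewrite big_split /= (IH E) // (IH (P * E)) //.
rewrite [X in X + _]ifF ?add0r //.
apply/eqP => E1; have := dvdp_leq D0 H.
rewrite -{1}E1 -mulrA [size (P * _)]size_monicM ?monicMl //.
have := mirred_size iP.
have := size_poly_gt0 (E * \prod_(P <- s) P); rewrite monic_neq0 ?monicMl //.
by clear IH ms H H1 EP; szlia.
Qed.

Lemma prod_pdivs E : E \is monic -> sqf E -> \prod_(P <- pdivs E) P = E.
Proof.
move=> mE; elim/monic_ind: E / mE => [_|P f iP mf IH].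
  by rewrite pdivs1 big_nil.
rewrite sqfM // => /andP[nPf sf].
by rewrite (perm_big _ (pdivsM iP mf nPf)) big_cons /= IH.
Qed.

(** The product of the [1 + legendre y P] over [P] dividing [D] counts the square roots of [y] mod
    [D], so the sum over [y] becomes a sum over square roots [x]. *)
Lemma gauss_squares : gauss 1 = \sum_(x <- pols F N) phi (ell (x ^+ 2)).
Proof.
have all_pd : all (@mirred F) (pdivs D).
  by apply/allP => P; rewrite mem_pdivs // => /andP[].
have dvdD : 1 * \prod_(P <- pdivs D) P %| D by rewrite mul1r prod_pdivs.
have := sum_chi_subsets all_pd (monic1 _) dvdD.
rewrite mul1r prod_pdivs // eqxx => <-.
under eq_bigr do rewrite chi1 mul1r -root_count_sqf // /root_count szD mulr_suml.
rewrite exchange_big /=; apply: eq_bigr => x _.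
have xD : x ^+ 2 %% D \in pols F N by rewrite mem_pols -ltnS -szD ltn_modpN0.
rewrite (bigD1_seq (x ^+ 2 %% D)) ?uniq_pols //= big1_seq ?addr0.
  rewrite {1}(divp_eq (x ^+ 2) D) addrK dvdp_mull // mul1r; congr phi.
  by rewrite /ell modp_id.
move=> y /andP[nyx]; rewrite mem_pols => sy; rewrite [D %| _]negbTE ?mul0r //.
apply: contra nyx; rewrite /dvdp modpD modpN [y %% D]modp_small ?szD //.
by rewrite subr_eq0 eq_sym.
Qed.

(* Polynomials of degree less than N/2 form an isotropic subspace for the quadratic
   form [ell (x ^+ 2)], so all but the terms [z] below cancel. *)
Lemma gauss_isotropic m : (m.*2 <= N)%N -> (N <= m.*2.+1)%N ->
  gauss 1 = (q ^ m)%:R * \sum_(z <- pols F (N - m.*2)) phi (ell ('X^(m.*2) * z ^+ 2)).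
Proof.
move=> m2N Nm2.
have mN : (m <= N)%N by rewrite (leq_trans _ m2N) // -addnn leq_addr.
have X2 k : 'X^k \in mon F k by rewrite mem_mon monicXn size_polyXn eqxx.
have mul_lt (y : {poly F}) z b c : (size y <= b)%N -> (size z <= c)%N ->
    (b + c <= N)%N -> ell (y * z) = 0.
  move=> sy sz bcN; have [->|y0] := eqVneq y 0.
    by rewrite mul0r /ell mod0p coef0.
  have [->|z0] := eqVneq z 0; first by rewrite mulr0 /ell mod0p coef0.
  apply: ell_tiny; rewrite size_mul //.
  move: y0 z0; rewrite -!size_poly_gt0; szlia.
rewrite gauss_squares -{1}(subnKC mN) (sum_pols_split _ _ (X2 m)) exchange_big /=.
have inner z y : y \in pols F m ->
    phi (ell ((y + 'X^m * z) ^+ 2)) =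
    phi (ell ('X^(m.*2) * z ^+ 2) + ell (2%:R *: ('X^m * z) * y)).
  rewrite mem_pols => sy; congr phi.
  rewrite (_ : (_ + _) ^+ 2 =
    'X^(m.*2) * z ^+ 2 + 2%:R *: ('X^m * z) * y + y * y); last first.
    by rewrite -addnn exprD scaler_nat; ring.
  by rewrite !ellD (@mul_lt y y m m) ?addnn ?addr0.
(* The choice of [k] gives [X^m z X^k] degree [N - 1]: the cross term is then a non-zero functional
   of [y], and the sum over [y] vanishes. *)
have vanish z k : (size z + m + k = N)%N -> (k < m)%N -> (0 < size z)%N ->
    \sum_(y <- pols F m) phi (ell ((y + 'X^m * z) ^+ 2)) = 0.
  move=> sz km z0; rewrite big_seq; under eq_bigr => y ym do rewrite inner //.
  rewrite -big_seq.
  apply: (@sum_functional F m phi (fun y => ell (2%:R *: ('X^m * z) * y)) 'X^k) => //.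
  - by move=> x y; rewrite mulrDr ellD.
  - by move=> a x; rewrite -scalerAr ellZ.
  - by rewrite mem_pols size_polyXn.
  rewrite -scalerAl ellZ mulf_neq0 ?two_neq0 //; apply: ell_lead.
  have nz : z != 0 by rewrite -size_poly_gt0.
  by rewrite mulrC mulrA -exprD mulrC size_mulXn // -sz; szlia.
have cE : (N - m = (N - m.*2) + m)%N by lia.
rewrite cE (sum_pols_split _ _ (X2 (N - m.*2)%N)) mulr_sumr big_seq [RHS]big_seq.
apply: eq_bigr => z; rewrite mem_pols => sz.
rewrite (bigD1_seq 0) ?uniq_pols ?mem_pols ?size_poly0 //= mulr0 addr0.
rewrite [X in _ + X]big1_seq ?addr0 => [|w /andP[w0]]; last first.
  rewrite mem_pols => sw.
  have w_gt0 : (0 < size w)%N by rewrite size_poly_gt0.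
  have sXw : size ('X^(N - m.*2) * w) = (N - m.*2 + size w)%N.
    by rewrite mulrC size_mulXn.
  have sE : size (z + 'X^(N - m.*2) * w) = (size w + (N - m.*2))%N.
    by rewrite addrC size_polyDl sXw; szlia.
  apply: (vanish _ (m - size w)%N); rewrite ?sE.
  - szlia.
  - szlia.
  - szlia.
rewrite big_seq (eq_bigr (fun=> phi (ell ('X^(m.*2) * z ^+ 2)))).
  by rewrite -big_seq big_const_seq count_predT iter_addr_0 size_pols mulr_natl.
move=> y ym; rewrite inner // -scalerAl ellZ mulrAC (@mul_lt ('X^m * y) z m.*2 (N - m.*2)%N).
- by rewrite mulr0 addr0.
- move: ym; rewrite mem_pols => sy; apply: leq_trans (size_polyMleq _ _) _.
  by rewrite size_polyXn; szlia.
- by [].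
- by lia.
Qed.

(** A form of Poisson summation: after [gauss_twist] the sum over [V] is done first. It vanishes if
    [size x > N - k], since [x * V] then runs through all values of [ell]; otherwise [x * V] has
    degree below [N] and [ell] reads off one coefficient of [x]. *)
Lemma sum_monic_gauss k : (k < N)%N ->
  (\sum_(V <- mon F k) chi V D) * gauss 1 =
  (q ^ k)%:R * \sum_(x <- pols F (N - k)) chi x D * phi x`_(N - k).-1.
Proof.
move=> kN; rewrite mulr_suml.
under eq_bigr do rewrite -gauss_twist /gauss.
rewrite exchange_big /=.
under eq_bigr do rewrite -mulr_sumr.
rewrite (bigID (fun x : {poly F} => (size x <= N - k)%N)) /=.
rewrite [X in _ + X]big1_seq ?addr0 => [|x /andP[nsx]]; last first.
  rewrite -ltnNge in nsx; rewrite mem_pols => sx.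
  apply/eqP; rewrite mulf_eq0; apply/orP; right; apply/eqP.
  rewrite sum_mon; under eq_bigr do rewrite mulrDr ellD.
  apply: (@sum_functional F k phi (fun r => ell (x * r)) 'X^(N - size x)) => //.
  - by move=> r s; rewrite mulrDr ellD.
  - by move=> a r; rewrite -scalerAr ellZ.
  - by rewrite mem_pols size_polyXn; szlia.
  have x_gt0 : (0 < size x)%N by szlia.
  by apply: ell_lead; rewrite size_mulXn -?size_poly_gt0 //; szlia.
rewrite -big_filter mulr_sumr.
rewrite (perm_big (pols F (N - k))); last first.
  apply: uniq_perm; rewrite ?filter_uniq ?uniq_pols // => x.
  by rewrite mem_filter !mem_pols andb_idr // => /leq_trans -> //; exact: leq_subr.
rewrite big_seq [RHS]big_seq; apply: eq_bigr => x; rewrite mem_pols => sx.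
rewrite mulrCA; congr (_ * _); rewrite sum_mon.
rewrite big_seq (eq_bigr (fun=> phi x`_(N - k).-1)).
  by rewrite -big_seq big_const_seq count_predT iter_addr_0 size_pols mulr_natl.
move=> r; rewrite mem_pols => sr; rewrite mulrDr ellD [ell (x * r)]ell_tiny ?addr0.
  rewrite ell_small ?coefMXn; last first.
    apply: leq_trans (size_polyMleq _ _) _; rewrite size_polyXn; szlia.
  by rewrite ifF; [congr (phi _`_ _); szlia | szlia].
apply: leq_ltn_trans (size_polyMleq _ _) _; szlia.
Qed.

End Modulus.
End GaussSum.

(** * Character sums and the functional equation *)

Lemma sumr_const_seq (V : nmodType) (I : Type) (s : seq I) (c : V) :
  \sum_(i <- s) c = c *+ size s.
Proof. by rewrite big_const_seq count_predT iter_addr_0. Qed.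

Section CharacterSums.
Variable F : finFieldType.
Hypothesis odd_q : odd #|F|.
Local Notation q := #|F|.
Implicit Types (f g A B D E P V x y z : {poly F}).

Lemma sum_top_coef (A : pzRingType) n (h : F -> A) :
  \sum_(x <- pols F n.+1) h x`_n = (q ^ n)%:R * \sum_(c : F) h c.
Proof.
have Xn : 'X^n \in mon F n by rewrite mem_mon monicXn size_polyXn eqxx.
rewrite -addn1 (sum_pols_split _ _ Xn) big_seq.
rewrite (eq_bigr (fun=> \sum_(c : F) h c)).
  by rewrite -big_seq big_const_seq count_predT iter_addr_0 size_pols mulr_natl.
move=> y; rewrite mem_pols => sy; rewrite sum_pols1; apply: eq_bigr => c _.
by rewrite coefD [y`_n]nth_default // add0r mulrC coefMXn ltnn subnn coefC.
Qed.

Lemma q_neq0 : (q%:R : int) != 0.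
Proof. by rewrite pnatr_eq0; have := card_gt1 F; case: q. Qed.

(** The sum of all non-trivial additive characters of [F]. Its value at 0 is what remains of the
    Gauss sum for even [N]. *)
Definition phi_even (c : F) : int := q%:R * (c == 0)%:R - 1.

Lemma sum_phi_even : \sum_(c : F) phi_even c = 0.
Proof.
rewrite sumrB sumr_const -mulr_sumr (bigD1 0) //= eqxx big1 => [|c /negPf -> //].
by rewrite addr0 mulr1 subrr.
Qed.

Lemma phi_even0 : phi_even 0 = q%:R - 1.
Proof. by rewrite /phi_even eqxx mulr1. Qed.

Lemma q1_neq0 : (q%:R - 1 : int) != 0.
Proof. by rewrite subr_eq0 (eqr_nat _ q 1); have := card_gt1 F; case: q => [|[]]. Qed.

(** The twist by [V = 0] turns the Gauss sum into [q - 1] times the plain character sum, and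
    [chi 0 D = 0]. *)
Lemma sum_chi_eq0 N D : D \in mon F N -> sqf D -> (0 < N)%N ->
  \sum_(x <- pols F N) chi x D = 0.
Proof.
move=> DN sD N0; have := DN; rewrite mem_mon => /andP[mD /eqP szD].
have := gauss_twist odd_q phi_even DN sD 0.
have -> : chi 0 D = 0.
  apply/eqP; rewrite chi_eq0 // coprime0p -size_poly_eq1 szD.
  by case: (N) N0.
rewrite mul0r /gauss.
under eq_bigr do rewrite mulr0 /ell mod0p coef0 phi_even0.
by rewrite -mulr_suml => /eqP; rewrite mulf_eq0 (negPf q1_neq0) orbF => /eqP.
Qed.

Lemma sum_chi_large N D k : D \in mon F N -> sqf D -> (0 < N)%N -> (N <= k)%N ->
  \sum_(V <- mon F k) chi V D = 0.
Proof.
move=> DN sD N0 Nk; have := DN; rewrite mem_mon => /andP[mD /eqP szD].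
rewrite sum_mon -(subnKC Nk) (sum_pols_split _ _ DN) exchange_big big1 //= => z _.
set X := 'X^_; rewrite -[RHS](sum_chi_eq0 DN sD N0).
rewrite -[RHS](sum_pols_shift _ (_ : (size (X %% D)%R <= N)%N)); last first.
  by rewrite -ltnS -szD ltn_modpN0 ?monic_neq0.
apply: eq_bigr => y _; apply: chi_mod => //.
rewrite (_ : _ - _ = (X - X %% D) + D * z); last by ring.
by rewrite dvdp_addl ?dvdp_mulr // {1}(divp_eq X D) addrK dvdp_mull.
Qed.

Lemma X_mon1 : 'X \in mon F 1.
Proof. by rewrite mem_mon monicX size_polyX eqxx. Qed.

Lemma sqf_X : sqf ('X : {poly F}).
Proof.
apply/sqfP => [|P iP]; first by rewrite polyX_eq0.
apply/negP => /dvdp_leq; rewrite polyX_eq0 => /(_ isT).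
by rewrite size_polyX leqNgt size_exp_mirred.
Qed.

(** The quadratic character of [F], obtained as the symbol modulo [X]. For odd [N] the Gauss sum
    reduces to its values at squares, which are 1 away from 0. *)
Definition phi_odd (c : F) : int := chi c%:P 'X.

Lemma sum_phi_odd : \sum_(c : F) phi_odd c = 0.
Proof. by rewrite -(sum_pols1 (fun x => chi x 'X)) (sum_chi_eq0 X_mon1 sqf_X). Qed.

Lemma coprime_constX (c : F) : coprimep c%:P 'X = (c != 0).
Proof. by rewrite coprimepX rootE hornerC. Qed.

Lemma phi_odd_sqr c : phi_odd (c ^+ 2) = (c != 0)%:R.
Proof. by rewrite /phi_odd rmorphXn chi_sqr ?monicX // coprime_constX. Qed.

Lemma abs_phi_odd c : `|phi_odd c| = (c != 0)%:R.
Proof.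
have := chi_val c%:P 'X; have := chi_eq0 c%:P (monicX F); rewrite coprime_constX.
by rewrite /phi_odd !inE negbK => <- /or3P[] /eqP->.
Qed.

Lemma sum_neq0 : \sum_(c : F) (c != 0)%:R = q%:R - 1 :> int.
Proof.
rewrite (eq_bigr (fun c => 1 - (c == 0)%:R)) => [|c _]; last first.
  by case: (c == 0); rewrite ?subrr ?subr0.
rewrite sumrB sumr_const (bigD1 0) //= eqxx big1 ?addr0 // => c /negPf -> //.
Qed.

Lemma gauss_even m D : D \in mon F m.*2 -> sqf D -> (0 < m)%N ->
  gauss m.*2 D phi_even 1 = (q ^ m)%:R * (q%:R - 1).
Proof.
move=> DN sD m0; have m20 : (0 < m.*2)%N by rewrite double_gt0.
rewrite (gauss_isotropic odd_q DN sD m20 sum_phi_even (leqnn _) (leqnSn _)).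
by rewrite subnn pols0 big_seq1 expr0n mulr0 /ell mod0p coef0 phi_even0.
Qed.

Lemma gauss_odd m D : D \in mon F m.*2.+1 -> sqf D ->
  gauss m.*2.+1 D phi_odd 1 = (q ^ m)%:R * (q%:R - 1).
Proof.
move=> DN sD; have := DN; rewrite mem_mon => /andP[mD /eqP szD].
rewrite (gauss_isotropic odd_q DN sD (ltn0Sn _) sum_phi_odd (leqnSn _) (leqnn _)).
rewrite subSnn sum_pols1 -sum_neq0; congr (_ * _); apply: eq_bigr => c _.
rewrite -phi_odd_sqr; congr phi_odd.
rewrite -rmorphXn /= mulrC mul_polyC ellZ (ell_small DN) ?size_polyXn //.
by rewrite coefXn eqxx mulr1.
Qed.

(** No logarithm is lost: the sum on the right of [sum_monic_gauss] sees [phi] only at an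
    equidistributed top coefficient, so the whole side is bounded trivially by [q^(N-1)] times the
    sum of [|phi a|]. *)
Lemma polya_vinogradov_aux (phi : F -> int) (c : int) N D k :
  D \in mon F N -> sqf D -> (0 < N)%N -> (k < N)%N -> \sum_a phi a = 0 ->
  0 < c -> gauss N D phi 1 = (q ^ N./2)%:R * c ->
  \sum_a `|phi a| * (q ^ N.-1)%:R <= c * (q ^ N./2)%:R ^+ 2 ->
  `|\sum_(V <- mon F k) chi V D| <= (q ^ N./2)%:R.
Proof.
move=> DN sD N0 kN phi0 c0 gE Hc; have := sum_monic_gauss odd_q DN sD N0 phi0 kN.
set S := \sum_(V <- _) _ => SE.
have SE' : `|S| * ((q ^ N./2)%:R * c) <= \sum_a `|phi a| * (q ^ N.-1)%:R.
  rewrite -[c in leLHS]gtr0_norm; last exact: c0.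
  rewrite -[(q ^ N./2)%:R in leLHS]ger0_norm; last exact: ler0n.
  rewrite -!normrM -gE SE.
  rewrite normrM [`|_%:R|]ger0_norm; last exact: ler0n.
  rewrite -mulr_suml.
  have kE : (N - k = (N - k).-1.+1)%N by lia.
  have -> : N.-1 = (k + (N - k).-1)%N by lia.
  have Qk : 0 < (q ^ k)%:R :> int by rewrite ltr0n expn_gt0 ltnW ?card_gt1.
  rewrite expnD natrM mulrCA (ler_pM2l Qk).
  rewrite [leRHS]mulrC -(sum_top_coef _ (fun a => `|phi a|)) -kE.
  apply: le_trans (ler_norm_sum _ _ _) _; apply: ler_sum => x _.
  rewrite normrM -[leRHS]mul1r; apply: ler_wpM2r; first exact: normr_ge0.
  by have := chi_val x D; rewrite !inE => /or3P[] /eqP->.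
have Q0 : 0 < (q ^ N./2)%:R :> int by rewrite ltr0n expn_gt0 ltnW ?card_gt1.
have := le_trans SE' Hc.
rewrite (mulrC _ c) [leLHS]mulrCA (ler_pM2l c0) expr2.
by rewrite (ler_pM2r Q0).
Qed.

Lemma polya_vinogradov N D k : D \in mon F N -> sqf D -> (0 < N)%N ->
  `|\sum_(V <- mon F k) chi V D| <= (q ^ N./2)%:R.
Proof.
move=> DN sD N0; case: (leqP N k) => [Nk|kN].
  by rewrite (sum_chi_large DN) // normr0.
have q1 := card_gt1 F.
have c0 : 0 < q%:R - 1 :> int by rewrite subr_gt0 ltr1n.
have [m [NE|NE]] : exists m, N = m.*2 \/ N = m.*2.+1.
- by exists N./2; case: (boolP (odd N)) => oN; [right|left]; lia.
- have m0 : (0 < m)%N by lia.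
  apply: (polya_vinogradov_aux DN sD N0 kN sum_phi_even c0).
    by rewrite NE doubleK gauss_even // -NE.
  rewrite -mulr_suml (bigD1 0) //= phi_even0 gtr0_norm //.
  rewrite (eq_bigr (fun=> 1)) => [|a /negPf a0]; last first.
    by rewrite /phi_even a0 mulr0 sub0r normrN1.
  rewrite [X in _ + X](_ : _ = q%:R - 1); last first.
    rewrite -sum_neq0 [RHS](bigD1 0) //= eqxx add0r.
    by apply: eq_bigr => a ->.
  rewrite (_ : q%:R - 1 + _ = (q%:R - 1) * 2%:R); last first.
    by rewrite mulr_natr mulr2n.
  rewrite -mulrA (ler_pM2l c0) -natrX -natrM ler_nat.
  rewrite NE doubleK -expnM muln2 -{2}[m.*2]prednK ?double_gt0 //.
  by rewrite expnS leq_mul2r q1 orbT.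
apply: (polya_vinogradov_aux DN sD N0 kN sum_phi_odd c0).
  have -> : N./2 = m by lia.
  by rewrite NE gauss_odd // -NE.
rewrite -mulr_suml; under eq_bigr do rewrite abs_phi_odd.
rewrite sum_neq0; have -> : N./2 = m by lia.
by rewrite NE /= -natrX -expnM muln2.
Qed.

(** * The functional equation for the partial sums of the coefficients *)

Section FunctionalEquation.
Variables (g : nat) (D : {poly F}).
Hypotheses (DN : D \in mon F g.+1.*2) (sD : sqf D).

(* The coefficient of q ^ (- k s) in [L_chi D]. *)
Definition csum k : int := \sum_(V <- mon F k) chi D V.
Definition bsum n : int := \sum_(0 <= k < n) csum k.

Let mD : D \is monic. Proof. by move: DN; rewrite mem_mon => /andP[]. Qed.
Let szD : size D = g.+1.*2.+1.
Proof. by move: DN; rewrite mem_mon => /andP[_ /eqP]. Qed.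
Let odd_szD : odd (size D). Proof. by rewrite szD /= odd_double. Qed.

Lemma csumE k : csum k = \sum_(V <- mon F k) chi V D.
Proof.
rewrite /csum big_seq [RHS]big_seq; apply: eq_bigr => V.
by rewrite mem_mon => /andP[mV _]; rewrite [RHS]chi_reciprocity.
Qed.

Lemma sum_chi_pols n : \sum_(x <- pols F n) chi x D = (q%:R - 1) * bsum n.
Proof.
rewrite sum_pols_mon (_ : chi 0 D = 0) ?add0r; last first.
  by apply/eqP; rewrite chi_eq0 // coprime0p -size_poly_eq1 szD.
rewrite mulr_sumr; apply: eq_bigr => j _; rewrite csumE -sum_neq0 mulr_suml.
rewrite [RHS](bigD1 0) //= eqxx mul0r add0r; apply: eq_bigr => c c0.
rewrite c0 mul1r; apply: eq_bigr => f _.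
by rewrite -mul_polyC chiM // chi_const // mul1r.
Qed.

(** [phi_even] compares polynomials whose top coefficient vanishes with all polynomials of bounded
    degree, which is why two consecutive partial sums appear. *)
Lemma csum_fe k : (k < g.+1.*2)%N ->
  csum k * (q ^ g.+1)%:R =
  (q ^ k)%:R * (q%:R * bsum (g.+1.*2 - k).-1 - bsum (g.+1.*2 - k)).
Proof.
move=> kN; apply: (mulIf q1_neq0).
have N0 : (0 < g.+1.*2)%N by [].
have := sum_monic_gauss odd_q DN sD N0 sum_phi_even kN.
rewrite gauss_even // -csumE mulrA => ->.
rewrite -[RHS]mulrA; congr (_ * _).
have kE : (g.+1.*2 - k = (g.+1.*2 - k).-1.+1)%N by lia.
rewrite kE /=; set n := (_ - k).-1.
rewrite mulrBl -mulrA [bsum n * _]mulrC [bsum n.+1 * _]mulrC -!sum_chi_pols.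
have Xn : 'X^n \in mon F n by rewrite mem_mon monicXn size_polyXn eqxx.
under eq_bigr do rewrite /phi_even mulrBr mulr1 mulrCA.
rewrite sumrB -mulr_sumr; congr (_ * _ - _).
rewrite (bigID (fun x : {poly F} => x`_n == 0)) /=.
rewrite [X in _ + X]big1 ?addr0 => [|x /negPf ->]; last by rewrite mulr0.
under eq_bigr => x /eqP -> do rewrite eqxx mulr1.
rewrite -big_filter; apply: perm_big; apply: uniq_perm; rewrite ?filter_uniq ?uniq_pols //.
move=> x; rewrite mem_filter !mem_pols; apply/andP/idP => [[/eqP xn sx]|sx].
  apply/leq_sizeP => j; rewrite leq_eqVlt => /orP[/eqP <- //|nj].
  by rewrite nth_default // (leq_trans sx).
by rewrite nth_default // eqxx ltnW.
Qed.

(** The zero of L at [u = 1], present because [deg D] is even. *)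
Lemma bsum_all : bsum g.+1.*2 = 0.
Proof.
apply/eqP; rewrite -(mulrI_eq0 _ (mulfI q1_neq0)) -sum_chi_pols.
by rewrite sum_chi_eq0.
Qed.

(** [bsum n.+1] is the coefficient of [u^n] in [L / (1 - u)], of degree at most [2 g], and the
    symmetry exchanges [n] and [2 g - n]. It follows by telescoping [csum_fe], starting from
    [bsum_all]. *)
Lemma functional_equation n : (n < g.+1.*2)%N ->
  bsum n.+1 * (q ^ g)%:R = (q ^ n)%:R * bsum (g.+1.*2 - n).-1.
Proof.
elim: n => [|n IH] nN.
  apply: (mulIf q_neq0); have := csum_fe nN.
  rewrite subn0 bsum_all subr0 expn0 !mul1r -mulrA -natrM -expnSr.
  have -> : bsum 1 = csum 0 by rewrite /bsum big_nat1.
  by move->; rewrite mulrC.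
apply: (mulIf q_neq0); rewrite -mulrA -natrM -expnSr.
rewrite {1}/bsum big_nat_recr //= -/(bsum _) mulrDl csum_fe //.
rewrite [in X in X + _]expnSr natrM mulrA IH ?(ltnW nN) //.
have -> : (g.+1.*2 - n).-1 = (g.+1.*2 - n.+1)%N by lia.
by rewrite expnSr natrM; ring.
Qed.

End FunctionalEquation.

(** * Cancellation in character sums attached to non-square polynomials *)

Lemma size_pdivs f n : f \in mon F n -> (size (pdivs f) <= n)%N.
Proof.
rewrite mem_mon => /andP[mf /eqP sf].
have -> : n = (size f).-1 by rewrite sf.
elim/monic_ind: f / mf {sf} => [|P f iP mf IH]; first by rewrite pdivs1.
have := mirred_size iP; have := size_poly_gt0 f; rewrite monic_neq0 //.
move=> s0 s1; rewrite size_monicM ?(mirred_monic iP) //.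
have le : (size (pdivs (P * f)) <= (size (pdivs f)).+1)%N.
  have [Pf|nPf] := boolP (P %| f).
    by rewrite (perm_size (pdivsMd iP mf Pf)).
  by rewrite (perm_size (pdivsM iP mf nPf)).
by apply: leq_trans le _; szlia.
Qed.

(** Coprimality is recorded by a list of forbidden primes so that it can be handled by induction on
    the list. *)
Definition avoids (s : seq {poly F}) B := all (fun P => ~~ (P %| B)) s.

Lemma coprimep_avoids A B : A \is monic -> coprimep B A = avoids (pdivs A) B.
Proof.
move=> mA; apply/idP/allP => [cBA P|H].
  rewrite (mem_pdivs _ (monic_neq0 mA)) => /andP[iP PA]; apply/negP => PB.
  have : P %| gcdp B A by rewrite dvdp_gcd PB.
  move: cBA; rewrite /coprimep => /eqP s1 /dvdp_leq.
  rewrite -size_poly_gt0 s1 => /(_ isT).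
  by have := mirred_size iP; case: (size P) => [|[]].
apply: contraT => ncBA; have [P iP] : exists2 P, mirred P & P %| gcdp B A.
  apply: exists_mirred; move: ncBA; rewrite /coprimep neq_ltn ltnS leqn0.
  by rewrite size_poly_eq0 gcdp_eq0 (negPf (monic_neq0 mA)) andbF.
rewrite dvdp_gcd => /andP[PB PA].
by have := H P; rewrite (mem_pdivs _ (monic_neq0 mA)) iP PA PB => /(_ isT).
Qed.

Lemma avoids_mulP (s : seq {poly F}) P B : all (@mirred F) s -> mirred P ->
  P \notin s -> avoids s (P * B) = avoids s B.
Proof.
move=> ms iP nPs; apply: eq_in_all => Q Qs; have iQ := allP ms _ Qs.
rewrite mirred_dvdM // mirred_dvd_eq //; case: eqP => // QP.
by rewrite -QP Qs in nPs.
Qed.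

(** Forbidding one more prime gives a difference of two sums of the same kind, by multiplicativity
    of [chi]; each prime costs a factor 2. *)
Lemma sum_chi_avoids N D (s : seq {poly F}) k :
  D \in mon F N -> sqf D -> (0 < N)%N -> all (@mirred F) s -> uniq s ->
  `|\sum_(B <- mon F k | avoids s B) chi B D| <= (2 ^ size s * q ^ N./2)%:R.
Proof.
move=> DN sD N0; elim: s k => [|P s IH] k.
  by move=> _ _; rewrite mul1n; apply: polya_vinogradov.
move=> /= /andP[iP ms] /andP[nPs us].
have mD : D \is monic by move: DN; rewrite mem_mon => /andP[].
have -> : \sum_(B <- mon F k | avoids (P :: s) B) chi B D =
    \sum_(B <- mon F k | avoids s B) chi B D -
    \sum_(B <- mon F k | P %| B) (avoids s B)%:R * chi B D.
  apply/eqP; rewrite eq_sym subr_eq; apply/eqP.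
  rewrite (bigID (fun B => P %| B)) /= addrC; congr (_ + _).
    by apply: eq_bigl => B; rewrite andbC.
  rewrite big_mkcondl; apply: eq_bigr => B _.
  by case: avoids; rewrite ?mul1r ?mul0r.
rewrite expnS -mulnA mul2n -addnn natrD.
apply: le_trans (ler_normB _ _) _; rewrite lerD ?IH //.
have Pd : P \in mon F (size P).-1.
  by rewrite mem_mon mirred_monic // prednK ?eqxx // size_poly_gt0 mirred_neq0.
rewrite (sum_mon_dvd _ _ Pd); case: ifP => _; last by rewrite normr0.
under eq_bigr => B _ do rewrite avoids_mulP // chiM // mulrCA.
rewrite -mulr_sumr normrM -[leRHS]mul1r ler_pM //.
  by have := chi_val P D; rewrite !inE => /or3P[] /eqP->.
set m := (k - _)%N; apply: le_trans (IH m ms us); rewrite [X in _ <= `|X|]big_mkcond.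
rewrite le_eqVlt; apply/orP; left; apply/eqP; congr `|_|; apply: eq_bigr => B _.
by case: avoids; rewrite ?mul1r ?mul0r.
Qed.

(** Write [f = A ^+ 2 * f1] with [f1] square-free and non-constant: the symbol mod [f] is the one
    mod [f1] restricted to [B] prime to [A]. The factor 2 per prime of [A] is at most [2^a <= q^a]
    with [a = deg A], which the bound [q^(n/2)] already contains. *)
Lemma sum_chi_nonsquare n f k : f \in mon F n -> ~ (exists A, f = A ^+ 2) ->
  `|\sum_(B <- mon F k) chi B f| <= (q ^ n./2)%:R.
Proof.
move=> fn nsq; have := fn; rewrite mem_mon => /andP[mf /eqP sf].
have [A [f1 [mA mf1 sf1 fE]]] := square_decomposition mf.
set a := (size A).-1; set d := (size f1).-1.
have Aa : A \in mon F a by rewrite mem_mon mA prednK ?eqxx // size_poly_gt0 monic_neq0.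
have fd : f1 \in mon F d by rewrite mem_mon mf1 prednK ?eqxx // size_poly_gt0 monic_neq0.
have d0 : (0 < d)%N.
  rewrite lt0n; apply/eqP => d0; apply: nsq; exists A; rewrite fE.
  by move: fd; rewrite d0 mon0 inE => /eqP ->; rewrite mulr1.
have nE : n = (a.*2 + d)%N.
  move: sf; rewrite fE size_monicM ?monic_exp // expr2 size_monicM //.
  move: Aa fd; rewrite !mem_mon => /andP[_ /eqP ->] /andP[_ /eqP ->].
  by lia.
have -> : \sum_(B <- mon F k) chi B f =
    \sum_(B <- mon F k | avoids (pdivs A) B) chi B f1.
  rewrite [RHS]big_mkcond /=; apply: eq_bigr => B _.
  rewrite fE chiMr ?monic_exp // chi_sqrr // coprimep_avoids //.
  by case: avoids; rewrite ?mul1r ?mul0r.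
have allm : all (@mirred F) (pdivs A).
  by apply/allP => P; rewrite mem_pdivs ?monic_neq0 // => /andP[].
apply: le_trans (sum_chi_avoids _ fd sf1 d0 allm (uniq_pdivs _)) _.
have -> : n./2 = (a + d./2)%N by lia.
rewrite ler_nat expnD leq_mul2r; apply/orP; right.
apply: leq_trans (_ : 2 ^ a <= _)%N; first by rewrite leq_exp2l // size_pdivs.
by case: (a) => // b; rewrite leq_exp2r ?card_gt1.
Qed.

Lemma geom_sum_le n : (\sum_(0 <= a < n) q ^ a <= q ^ n)%N.
Proof.
elim: n => [|n IH]; first by rewrite big_geq.
rewrite big_nat_recr //= expnS.
apply: leq_trans (_ : 2 * q ^ n <= _)%N; first by rewrite mul2n -addnn leq_add2r.
by rewrite leq_mul2r card_gt1 orbT.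
Qed.

(** The two bounds cross at [a = M - h/2], where each term is about [q^(M + h/2)]; on either side
    the sum is geometric. *)
Lemma min_sum_le M h :
  (\sum_(0 <= a < M.+1) q ^ a * minn (q ^ (M.*2 - a.*2)) (q ^ h) <=
   q ^ (M + h./2 + 2))%N.
Proof.
have q2 := odd_card_gt2 odd_q.
set t := h./2; set K := (M.+1 - t.+1)%N.
have K1 : (K <= M.+1)%N by rewrite leq_subr.
rewrite (big_cat_nat (leq0n _) K1) /=.
have le1 : (\sum_(0 <= a < K) q ^ a * minn (q ^ (M.*2 - a.*2)) (q ^ h) <=
    q ^ (M + t).+1)%N.
  apply: leq_trans (_ : \sum_(0 <= a < K) q ^ a * q ^ h <= _)%N.
    by apply: leq_sum => a _; rewrite leq_mul2l geq_minr orbT.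
  rewrite -big_distrl /=.
  have [->|K0] := posnP K; first by rewrite big_geq.
  apply: leq_trans (leq_mul (geom_sum_le K) (leqnn _)) _.
  by rewrite -expnD leq_exp2l ?card_gt1 // /K /t; move: K0; rewrite /K /t; lia.
have le2 : (\sum_(K <= a < M.+1) q ^ a * minn (q ^ (M.*2 - a.*2)) (q ^ h) <=
    q ^ (M + t).+1)%N.
  apply: leq_trans (_ : \sum_(K <= a < M.+1) q ^ (M + (M - a)) <= _)%N.
    rewrite big_nat_cond [X in (_ <= X)%N]big_nat_cond; apply: leq_sum => a.
    move=> /andP[/andP[_ aM] _].
    apply: leq_trans (leq_mul (leqnn _) (geq_minl _ _)) _.
    by rewrite -expnD leq_exp2l ?card_gt1 //; lia.
  rewrite big_nat_rev /=.
  apply: leq_trans (_ : \sum_(K <= a < M.+1) q ^ M * q ^ (a - K) <= _)%N.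
    rewrite big_nat_cond [X in (_ <= X)%N]big_nat_cond; apply: leq_sum => a.
    move=> /andP[/andP[Ka aM] _].
    by rewrite -expnD leq_exp2l ?card_gt1 //; lia.
  rewrite -big_distrr /= -{1}[K]add0n big_addn.
  under eq_bigr do rewrite addnK.
  apply: leq_trans (leq_mul (leqnn _) (geom_sum_le _)) _.
  by rewrite -expnD leq_exp2l ?card_gt1 // /K; lia.
apply: leq_trans (leq_add le1 le2) _.
rewrite addnn -mul2n addn2 [X in (_ <= X)%N]expnS leq_mul2r.
by rewrite ltnW ?orbT.
Qed.

(** After the sieve, the sum over [B] of degree [2 g + 2 - 2 a] is bounded by the number of terms or
    by [sum_chi_nonsquare], whichever is smaller, and [min_sum_le] adds up the result. *)
Lemma sum_sqf_nonsquare (g n : nat) f : f \in mon F n -> ~ (exists A, f = A ^+ 2) ->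
  `|\sum_(D <- mon F g.+1.*2 | sqf D) chi D f| <= (q ^ (g + n %/ 4 + 3))%:R.
Proof.
move=> fn nsq; have := fn; rewrite mem_mon => /andP[mf _].
rewrite sum_sqf doubleK.
have -> : (g + n %/ 4 + 3 = g.+1 + n./2./2 + 2)%N by lia.
apply: le_trans (_ : _ <= (\sum_(0 <= a < g.+2) q ^ a *
    minn (q ^ (g.+1.*2 - a.*2)) (q ^ n./2))%:R) _; last first.
  by rewrite ler_nat min_sum_le.
rewrite natr_sum; apply: le_trans (ler_norm_sum _ _ _) _; apply: ler_sum => a _.
apply: le_trans (ler_norm_sum _ _ _) _.
rewrite natrM -size_mon mulr_natl -sumr_const_seq.
apply: ler_sum => A _; rewrite normrM -[leRHS]mul1r ler_pM //.
  rewrite moebiusE; case: ifP => _; last by rewrite normr0.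
  by rewrite normrX normrN1 expr1n.
under eq_bigr do rewrite chiM //.
rewrite -mulr_sumr normrM -[leRHS]mul1r ler_pM //.
  by have := chi_val (A ^+ 2) f; rewrite !inE => /or3P[] /eqP->.
rewrite /minn; case: ifP => _; last exact: sum_chi_nonsquare.
apply: le_trans (ler_norm_sum _ _ _) _.
rewrite -size_mon -[leRHS]sumr_const_seq; apply: ler_sum => B _.
by have := chi_val B f; rewrite !inE => /or3P[] /eqP->.
Qed.

End CharacterSums.

(** * Averages over square-free polynomials *)

Section CoprimeCounts.
Variables (R : realType) (F : finFieldType).
Hypothesis odd_q : odd #|F|.
Local Notation q := #|F|.
Local Notation Q := (#|F|%:R : R).
Implicit Types (f g A B D E P V x y z L : {poly F}) (s : seq {poly F}).

Definition sqf_count s n : int := \sum_(D <- mon F n | sqf D && avoids s D) 1.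

Lemma avoids_cons P s D : avoids (P :: s) D = ~~ (P %| D) && avoids s D.
Proof. by []. Qed.

(** A square-free multiple of [P] is [P] times a square-free polynomial prime to [P]; this gives a
    recursion in [n] with step [deg P]. *)
Lemma sqf_count_cons P s n : all (@mirred F) s -> mirred P -> P \notin s ->
  sqf_count s n = sqf_count (P :: s) n +
    (if ((size P).-1 <= n)%N then sqf_count (P :: s) (n - (size P).-1) else 0).
Proof.
move=> ms iP nPs; rewrite {1}/sqf_count (bigID (fun D => P %| D)) /= addrC.
congr (_ + _).
  by apply: eq_bigl => D; rewrite avoids_cons andbC [RHS]andbCA.
have Pd : P \in mon F (size P).-1.
  by rewrite mem_mon mirred_monic // prednK ?eqxx // size_poly_gt0 mirred_neq0.
under eq_bigl do rewrite andbC.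
rewrite big_mkcondr /= (sum_mon_dvd _ _ Pd); case: ifP => // _.
rewrite /sqf_count [RHS]big_mkcond /= big_seq [RHS]big_seq; apply: eq_bigr => B.
rewrite mem_mon => /andP[mB _].
by rewrite sqfM // avoids_mulP // andbCA andbA.
Qed.

Lemma size_predM f g : f \is monic -> g \is monic ->
  (size (f * g)%R).-1 = ((size f).-1 + (size g).-1)%N.
Proof.
move=> mf mg; rewrite size_monicM //.
have := size_poly_gt0 f; have := size_poly_gt0 g; rewrite !monic_neq0 //; szlia.
Qed.

Definition rq : R := Num.sqrt Q.

Lemma Q_ge3 : 3 <= Q.
Proof. by rewrite (ler_nat _ 3 q); exact: odd_card_gt2. Qed.

Lemma Q_gt0 : 0 < Q.
Proof. by apply: lt_le_trans Q_ge3. Qed.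

Lemma rq_sqr : rq ^+ 2 = Q.
Proof. by rewrite sqr_sqrtr // ltW // Q_gt0. Qed.

Lemma rq_gt0 : 0 < rq.
Proof. by rewrite sqrtr_gt0 Q_gt0. Qed.

(** The bound 1.7 lies between the golden ratio and the square root of 3, so that [1 + y <= y^2] for
    [y >= 1.7], as the induction in [sqf_count_bound] requires. *)
Lemma rq_ge : 17 / 10 <= rq.
Proof.
have := rq_sqr; have := Q_ge3; have := rq_gt0; rewrite expr2 => r0 Q3 E.
rewrite leNgt; apply/negP => rlt.
have : rq * rq < (17 / 10) * (17 / 10) by apply: ltr_pM => //; exact: ltW.
rewrite E; lra.
Qed.

Lemma rq_exp_ge1 n : 1 <= rq ^+ n.
Proof. by rewrite exprn_ege1 //; have := rq_ge; lra. Qed.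

Definition nrm P : R := (absp P)%:R.

Lemma absp_monic f : f \is monic -> absp f = (q ^ (size f).-1)%N.
Proof. by move=> mf; rewrite /absp (negPf (monic_neq0 mf)). Qed.

Lemma nrm_mirred P : mirred P -> nrm P = (rq ^+ (size P).-1) ^+ 2.
Proof.
by move=> iP; rewrite /nrm absp_monic ?mirred_monic // natrX -rq_sqr -!exprM mulnC.
Qed.

Lemma nrm_ge1 P : mirred P -> 1 <= nrm P.
Proof. by move=> iP; rewrite nrm_mirred // exprn_ege1 // rq_exp_ge1. Qed.

(** The limiting proportion of square-free polynomials that avoid [s]: [1 - 1/q] is the density of
    square-free ones, and avoiding [P] replaces the local factor [1 - |P|^(-2)] by
    [1 - |P|^(-1)]. *)
Definition cop_density s : R := (1 - Q^-1) * \prod_(P <- s) (1 + (nrm P)^-1)^-1.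

Lemma cop_density_cons P s :
  cop_density (P :: s) = cop_density s / (1 + (nrm P)^-1).
Proof. by rewrite /cop_density big_cons mulrCA mulrC. Qed.

Lemma cop_density_bounds s : all (@mirred F) s -> 0 <= cop_density s <= 1.
Proof.
have Q3 := Q_ge3; elim: s => [_|P s IH /= /andP[iP ms]].
  have h1 : Q^-1 <= 1 by rewrite invf_le1 ?Q_gt0 //; lra.
  have h0 : 0 <= Q^-1 by rewrite invr_ge0 ltW ?Q_gt0.
  by rewrite /cop_density big_nil mulr1; apply/andP; split; lra.
have /andP[c0 c1] := IH ms.
have n0 : 0 < nrm P by apply: lt_le_trans (nrm_ge1 iP).
have d1 : 1 <= 1 + (nrm P)^-1 by rewrite lerDl invr_ge0 ltW.
have d0 : 0 < 1 + (nrm P)^-1 by apply: lt_le_trans d1.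
rewrite cop_density_cons divr_ge0 ?(ltW d0) //= ler_pdivrMr // mul1r.
exact: le_trans c1 d1.
Qed.

Lemma sqf_count_nil n : `|(sqf_count [::] n)%:~R - Q ^+ n * cop_density [::]| <= rq ^+ n.
Proof.
rewrite /cop_density big_nil mulr1.
have -> : sqf_count [::] n = \sum_(D <- mon F n | sqf D) 1.
  by apply: eq_bigl => D; rewrite andbT.
rewrite card_sqf; have Q0 : Q != 0 by rewrite gt_eqF // Q_gt0.
have r1 := rq_exp_ge1; have Q3 := Q_ge3.
case: n => [|[|n]] /=.
- rewrite expn0 mulr0n subr0 !expr0 mul1r rmorph1 opprB addrCA subrr addr0.
  rewrite ger0_norm ?invr_ge0 ?(ltW Q_gt0) // invf_le1 ?Q_gt0 //; lra.
- rewrite expn1 mulr0n subr0 expr1 rmorph_nat mulrBr mulr1 divff // opprB addrCA.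
  by rewrite subrr addr0 normr1 expr1 -[rq]expr1 r1.
rewrite mulr1n rmorphB !rmorph_nat !natrX mulrBr mulr1.
rewrite [Q ^+ n.+2 / Q](_ : _ = Q ^+ n.+1); last by rewrite exprSr mulfK.
by rewrite subrr normr0 ltW // exprn_gt0 // rq_gt0.
Qed.

(** The recursion [sqf_count_cons] is unwound by an inner induction on [n]. A loss of [|P|] per
    prime is affordable, and with [y = |P|^(1/2)] the step closes by [y + y^2 <= y^3]. *)
Lemma sqf_count_bound s n : all (@mirred F) s -> uniq s ->
  `|(sqf_count s n)%:~R - Q ^+ n * cop_density s| <=
  (\prod_(P <- s) nrm P) * rq ^+ n.
Proof.
elim: s n => [|P s IH] n; first by rewrite big_nil mul1r sqf_count_nil.
move=> ms' us'; have := ms'; have := us'; rewrite /= => /andP[nPs us] /andP[iP ms].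
rewrite big_cons.
set W := \prod_(P <- s) nrm P; set d := (size P).-1; set c := cop_density (P :: s).
have W1 : 1 <= W.
  rewrite /W big_seq; elim/big_ind: _ => // [u v|Q' Qs]; first exact: mulr_ege1.
  exact/nrm_ge1/(allP ms).
have P1 := nrm_ge1 iP; have P0 : 0 < nrm P by apply: lt_le_trans P1.
set y := rq ^+ d.
have Py : nrm P = y ^+ 2 by rewrite nrm_mirred.
have d0 : (0 < d)%N by rewrite -ltnS prednK ?mirred_size // ltnW // mirred_size.
have yge : 17 / 10 <= y.
  rewrite /y -(prednK d0) exprS; have := rq_exp_ge1 d.-1; have := rq_ge.
  by move: (rq) (rq ^+ _) => u v; nra.
have cE : cop_density s = c + c / nrm P.
  rewrite /c cop_density_cons -[X in _ = X + _]mulr1 -mulrDr mulfVK //.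
  by rewrite gt_eqF // ltr_wpDr // invr_ge0 ltW.
have /andP[c0 c1] : 0 <= c <= 1 by exact: cop_density_bounds.
have rn := rq_exp_ge1.
elim/ltn_ind: n => n IHn.
have := IH n ms us; rewrite (sqf_count_cons n ms iP nPs) -/d -/W cE.
case: leqP => [dn|nd]; last first.
  rewrite addr0; set S := (_)%:~R; set X := Q ^+ n => H.
  have Xle : X * c / nrm P <= 1.
    rewrite -mulrA; apply: le_trans (_ : X / nrm P <= 1).
      apply: ler_wpM2l; first by rewrite exprn_ge0 // ltW // Q_gt0.
      by rewrite -[leRHS]mul1r; apply: ler_wpM2r => //; rewrite invr_ge0 ltW.
    rewrite ler_pdivrMr // mul1r Py /X -rq_sqr -!exprM mulnC.
    by apply: ler_weXn2l; rewrite ?leq_mul2r ?(ltnW nd) //; have := rn 1%N; rewrite expr1.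
  have X0 : 0 <= X * c / nrm P.
    apply: mulr_ge0; last by rewrite invr_ge0 ltW.
    by apply: mulr_ge0 => //; rewrite exprn_ge0 // ltW // Q_gt0.
  move: H (rn n); move: (rq ^+ n) => Z H Z1.
  have -> : S - X * c = (S - X * (c + c / nrm P)) + X * c / nrm P by ring.
  apply: le_trans (ler_normD _ _) _; rewrite (ger0_norm X0).
  apply: le_trans (lerD H Xle) _.
  have P2 : 2 <= nrm P by rewrite Py; nra.
  have WZ : 1 <= W * Z by apply: mulr_ege1.
  by rewrite -mulrA; move: (nrm P) P2 (W * Z) WZ => p p2 t t1; nra.
rewrite rmorphD /=; set S := (_)%:~R; set S' := (_)%:~R => H.
have H' := IHn (n - d)%N _; rewrite -/S' in H'.
have {}H' := H' (_ : n - d < n)%N; rewrite ltn_subrL d0 (leq_trans d0 dn) in H'.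
have {}H' := H' isT.
have QE : Q ^+ n = Q ^+ (n - d) * nrm P.
  by rewrite Py /y -exprM mulnC exprM rq_sqr -exprD subnK.
have rE : rq ^+ n = rq ^+ (n - d) * y by rewrite /y -exprD subnK.
have -> : S - Q ^+ n * c = (S + S' - Q ^+ n * (c + c / nrm P)) - (S' - Q ^+ (n - d) * c).
  by rewrite QE; field; rewrite gt_eqF.
apply: le_trans (ler_normB _ _) _; apply: le_trans (lerD H H') _.
rewrite rE; have Z1 := rn (n - d)%N; move: (rq ^+ (n - d)) Z1 => Z Z1.
rewrite Py; have WZ : 0 <= W * Z by rewrite mulr_ge0 //; lra.
have -> : W * (Z * y) + y ^+ 2 * W * Z = (W * Z) * (y + y ^+ 2) by ring.
have -> : y ^+ 2 * W * (Z * y) = (W * Z) * (y ^+ 3) by ring.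
by apply: ler_wpM2l => //; rewrite !exprS expr0 !mulr1; nra.
Qed.

Lemma prod_nrm_pdivs f n : f \in mon F n ->
  \prod_(P <- pdivs f) nrm P <= Q ^+ n.
Proof.
rewrite mem_mon => /andP[mf /eqP sf].
have -> : n = (size f).-1 by rewrite sf.
elim/monic_ind: f / mf {sf} => [|P f iP mf IH].
  by rewrite pdivs1 big_nil size_poly1 expr0.
have P1 := nrm_ge1 iP.
have szE : ((size (P * f)%R).-1 = (size P).-1 + (size f).-1)%N.
  by rewrite size_predM ?(mirred_monic iP).
rewrite szE exprD -natrX -absp_monic ?(mirred_monic iP) // -/(nrm P).
have [Pf|nPf] := boolP (P %| f).
  rewrite (perm_big _ (pdivsMd iP mf Pf)) -[leLHS]mul1r.
  apply: ler_pM => //; rewrite big_seq prodr_ge0 // => *; exact: ler0n.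
rewrite (perm_big _ (pdivsM iP mf nPf)) big_cons ler_pM2l //.
exact: lt_le_trans P1.
Qed.

(** The coefficient of [u^n] in G, with [u = q^(-s)]. *)
Definition acoef n : R :=
  \sum_(L <- mon F n) (moebius L)%:~R * \prod_(P <- pdivs L) (1 + nrm P)^-1.

(** Each of the [q^n] polynomials contributes at most [q^(-n)], since the product of the [1 + |P|]
    is at least [|L|] for square-free [L]. *)
Lemma acoef_le1 n : `|acoef n| <= 1.
Proof.
have Q0 := Q_gt0; have Qn0 : 0 < Q ^+ n by rewrite exprn_gt0.
apply: le_trans (ler_norm_sum _ _ _) _.
rewrite [leRHS](_ : _ = \sum_(L <- mon F n) (Q ^+ n)^-1); last first.
  by rewrite sumr_const_seq size_mon -[_ *+ (q ^ n)]mulr_natl natrX divff ?lt0r_neq0.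
rewrite big_seq [leRHS]big_seq; apply: ler_sum => L; rewrite mem_mon => /andP[mL /eqP sL].
rewrite moebiusE; case: (boolP (sqf L)) => [sqL|_]; last first.
  by rewrite mul0r normr0 invr_ge0 ltW.
rewrite normrM -intr_norm normrX normrN1 expr1n mul1r prodfV.
have -> : Q ^+ n = \prod_(P <- pdivs L) nrm P.
  have allm : all (@mirred F) (pdivs L).
    by apply/allP => P; rewrite mem_pdivs ?monic_neq0 // => /andP[].
  have -> : n = (size (\prod_(P <- pdivs L) P)).-1 by rewrite prod_pdivs // sL.
  elim: (pdivs L) allm => [_|P s IH /= /andP[iP ms]].
    by rewrite !big_nil size_poly1 expr0.
  rewrite !big_cons -IH // /nrm absp_monic ?(mirred_monic iP) // natrX -exprD.
  have mS : \prod_(P <- s) P \is monic.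
    by rewrite big_seq monic_prod // => T /(allP ms)/mirred_monic.
  by congr (_ ^+ _); rewrite size_predM ?(mirred_monic iP).
have pos : 0 < \prod_(P <- pdivs L) nrm P.
  rewrite big_seq prodr_gt0 // => P; rewrite mem_pdivs ?monic_neq0 // => /andP[iP _].
  exact: lt_le_trans (nrm_ge1 iP).
have le : \prod_(P <- pdivs L) nrm P <= \prod_(P <- pdivs L) (1 + nrm P).
  by apply: ler_prod => P _; rewrite ler0n lerDr ler01.
rewrite ger0_norm ?invr_ge0 ?(le_trans (ltW pos)) //.
by rewrite lef_pV2 ?posrE // (lt_le_trans pos).
Qed.

Lemma sum_cop_density m :
  \sum_(l <- mon F m) cop_density (pdivs l) =
  (1 - Q^-1) * \sum_(0 <= a < m.+1) acoef a * Q ^+ (m - a).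
Proof.
rewrite -mulr_sumr; congr (_ * _).
transitivity (\sum_(l <- mon F m) \sum_(L <- mdivs l)
    (moebius L)%:~R * \prod_(P <- pdivs L) (1 + nrm P)^-1).
  rewrite big_seq [RHS]big_seq; apply: eq_bigr => l.
  rewrite mem_mon => /andP[ml _]; rewrite sum_moebius // big_seq [RHS]big_seq.
  apply: eq_bigr => P; rewrite mem_pdivs ?monic_neq0 // => /andP[iP _].
  have := nrm_ge1 iP => P1.
  have P0 : nrm P != 0 by rewrite gt_eqF // (lt_le_trans ltr01).
  have P2 : 1 + nrm P != 0 by rewrite gt_eqF // (lt_le_trans ltr01) // lerDl ltW // (lt_le_trans ltr01).
  have P3 : 1 + (nrm P)^-1 != 0.
    by rewrite gt_eqF // ltr_wpDr // invr_ge0 (le_trans ler01).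
  by have P2' := P2; rewrite addrC in P2'; field; rewrite ?P0 ?P2 ?P2'.
rewrite sum_mdivs_mon; apply: eq_bigr => a _; rewrite mulr_suml.
by apply: eq_bigr => L _; rewrite sumr_const_seq size_mon -natrX mulr_natr.
Qed.

Lemma monic_square f : f \is monic -> (exists A, f = A ^+ 2) ->
  exists2 A, A \is monic & f = A ^+ 2.
Proof.
move=> mf [A fE]; have := mf; rewrite fE monicE lead_coef_exp => /eqP l2.
have l0 : lead_coef A != 0.
  by apply/eqP => l0; move: l2; rewrite l0 expr0n => /eqP; rewrite eq_sym oner_eq0.
exists ((lead_coef A)^-1 *: A); first by rewrite monicE lead_coefZ mulVf.
by rewrite exprZn exprVn l2 invr1 scale1r.
Qed.

Lemma monic_sqr_inj A B : A \is monic -> B \is monic -> A ^+ 2 = B ^+ 2 -> A = B.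
Proof.
move=> mA mB /eqP; rewrite eqf_sqr => /orP[/eqP //|/eqP AB].
have := mA; rewrite AB monicE lead_coefN (monicP mB) => /eqP/eqP.
rewrite -subr_eq0 -opprD oppr_eq0 => t0.
by have := two_neq0 odd_q; rewrite mulr2n t0.
Qed.

Lemma sum_mon_squares (V : nmodType) n (h : {poly F} -> V) :
  \sum_(f <- mon F n | `[< exists A, f = A ^+ 2 >]) h f =
  if odd n then 0 else \sum_(A <- mon F n./2) h (A ^+ 2).
Proof.
case: ifP => on.
  rewrite big1_seq // => f /andP[/asboolP fsq]; rewrite mem_mon => /andP[mf /eqP sf].
  have [A mA fE] := monic_square mf fsq; move: sf.
  rewrite fE expr2 size_monicM // => sf.
  have := size_poly_gt0 A; rewrite monic_neq0 //.
  by move: (size A) sf => a; lia.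
have nE : n = n./2.*2 by rewrite -[LHS]odd_double_half on.
rewrite -big_filter -(big_map (fun A => A ^+ 2) xpredT h); apply: perm_big.
apply: uniq_perm; first by rewrite filter_uniq ?uniq_mon.
  rewrite map_inj_in_uniq ?uniq_mon // => A B; rewrite !mem_mon.
  by move=> /andP[mA _] /andP[mB _]; apply: monic_sqr_inj.
have sq A : A \is monic -> (size A == n./2.+1) = (size (A ^+ 2) == n.+1).
  move=> mA; rewrite expr2 size_monicM //; have := size_poly_gt0 A.
  rewrite monic_neq0 // => A0; apply/eqP/eqP; move: nE A0.
    by move=> nE _ ->; lia.
  by move: (size A) => a; lia.
move=> f; rewrite mem_filter mem_mon; apply/idP/mapP.
  case/and3P => /asboolP fsq mf sf; have [A mA fE] := monic_square mf fsq.
  by exists A; rewrite // mem_mon mA sq // -fE.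
case=> A; rewrite mem_mon => /andP[mA sA] ->; rewrite monic_exp // -sq // sA !andbT.
by apply/asboolP; exists A.
Qed.

Definition Csum (g n : nat) : int := \sum_(D <- mon F g.+1.*2 | sqf D) csum D n.

(** The contribution of the squares [f = A ^+ 2] with [deg A = n/2], divided by [|D|] and by the
    density [1 - 1/q]. *)
Definition Cmain (n : nat) : R :=
  if odd n then 0 else \sum_(0 <= a < n./2.+1) acoef a * Q ^+ (n./2 - a).

(** The exponent is that of the non-squares, at most [q^n] in number; the error from the squares is
    only [q^(n+g+1)]. *)
Lemma Csum_bound (g n : nat) :
  `|(Csum g n)%:~R - Q ^+ g.+1.*2 * (1 - Q^-1) * Cmain n| <=
  2 * Q ^+ (g + n + n %/ 4 + 3).
Proof.
have Q0 := Q_gt0; have Q1 : 1 <= Q by have := Q_ge3; lra.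
rewrite /Csum /csum exchange_big /=.
rewrite (bigID (fun f => `[< exists A, f = A ^+ 2 >])) /= sum_mon_squares rmorphD /=.
rewrite addrAC mulr_natl mulr2n; apply: le_trans (ler_normD _ _) _; apply: lerD.
  rewrite /Cmain; case: ifP => on; first by rewrite mulr0 subr0 normr0 exprn_ge0 // ltW.
  rewrite -mulrA -sum_cop_density mulr_sumr rmorph_sum -sumrB.
  apply: le_trans (ler_norm_sum _ _ _) _.
  apply: le_trans (_ : \sum_(A <- mon F n./2) Q ^+ n./2 * rq ^+ g.+1.*2 <= _).
    rewrite big_seq [leRHS]big_seq; apply: ler_sum => A An.
    have := An; rewrite mem_mon => /andP[mA _].
    have allm : all (@mirred F) (pdivs A).
      by apply/allP => P; rewrite mem_pdivs ?monic_neq0 // => /andP[].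
    have -> : \sum_(D <- mon F g.+1.*2 | sqf D) chi D (A ^+ 2) =
        sqf_count (pdivs A) g.+1.*2.
      rewrite /sqf_count [RHS]big_mkcondr; apply: eq_bigr => D _.
      by rewrite chi_sqrr // coprimep_avoids //; case: avoids.
    apply: le_trans (sqf_count_bound _ allm (uniq_pdivs _)) _.
    by rewrite ler_wpM2r ?exprn_ge0 ?(ltW rq_gt0) // prod_nrm_pdivs.
  rewrite sumr_const_seq size_mon -[_ *+ (q ^ n./2)]mulr_natl natrX -[rq ^+ _]/(rq ^+ (g.+1.*2)).
  rewrite -mul2n exprM rq_sqr -!exprD ler_weXn2l //; lia.
rewrite rmorph_sum; apply: le_trans (ler_norm_sum _ _ _) _.
apply: le_trans (_ : \sum_(f <- mon F n) Q ^+ (g + n %/ 4 + 3) <= _); last first.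
  rewrite sumr_const_seq size_mon -[_ *+ (q ^ n)]mulr_natl natrX -exprD ler_weXn2l //; lia.
rewrite big_mkcond big_seq [leRHS]big_seq; apply: ler_sum => f fn.
case: asboolP => [_|/= nsq]; first by rewrite exprn_ge0 // ltW.
rewrite -intr_norm -natrX; have := sum_sqf_nonsquare odd_q g fn nsq.
by rewrite -(ler_int R) rmorph_nat.
Qed.

End CoprimeCounts.

(** * Asymptotics of the averaged coefficients *)

Section RealEstimates.

Lemma norm_limit_le (K : numFieldType) (V : pseudoMetricNormedZmodType K)
    (f : nat -> V) (l : V) (r : K) :
  r \is Num.real -> f n @[n --> \oo] --> l -> (\forall n \near \oo, `|f n| <= r) ->
  `|l| <= r.
Proof.
move=> rr fl fr; have lr : `|l| \is Num.real by apply: normr_real.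
rewrite real_leNgt //; apply/negP => rl.
have [n [/= H1 H2]] : exists n, (`|f n| <= r) /\ (r < `|f n|).
  have := filter_ex (filterI fr (cvgr_norm_gt _ fl _ rl)).
  by case=> n [? ?]; exists n.
by have := lt_le_trans H2 H1; rewrite ltxx.
Qed.

Lemma geometric_sum_le (K : numFieldType) (y : K) m n : 0 <= y -> y < 1 ->
  \sum_(m <= i < n) y ^+ i <= y ^+ m / (1 - y).
Proof.
move=> y0 y1; have d0 : 0 < 1 - y by rewrite subr_gt0.
case: (leqP m n) => [mn|nm]; last first.
  by rewrite big_geq ?(ltnW nm) // divr_ge0 ?exprn_ge0 // ltW.
rewrite ler_pdivlMr //.
suff -> : (\sum_(m <= i < n) y ^+ i) * (1 - y) = y ^+ m - y ^+ n.
  by rewrite gerBl exprn_ge0.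
elim: n mn => [|n IH]; first by rewrite leqn0 => /eqP ->; rewrite big_geq // mul0r subrr.
rewrite leq_eqVlt => /orP[/eqP <-|]; first by rewrite big_geq // mul0r subrr.
rewrite ltnS => mn; rewrite big_nat_recr //= mulrDl IH // exprS.
by rewrite mulrBr mulr1 addrA subrK mulrC.
Qed.

Lemma series_tail_le (K : numFieldType) (V : normedModType K) (u : nat -> V)
    (A y : K) (l : V) n :
  0 <= A -> 0 <= y -> y < 1 -> (forall k, `|u k| <= A * y ^+ k) ->
  series u k @[k --> \oo] --> l ->
  `|l - \sum_(0 <= k < n) u k| <= A * y ^+ n / (1 - y).
Proof.
move=> A0 y0 y1 Hu ul.
have r0 : 0 <= A * y ^+ n / (1 - y).
  by rewrite !mulr_ge0 ?exprn_ge0 // invr_ge0 subr_ge0 ltW.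
apply: (@norm_limit_le _ _ (fun N => series u N - \sum_(0 <= k < n) u k)).
- exact: ger0_real.
- by apply: cvgB => //; apply: cvg_cst.
exists n => // N /= nN; rewrite /series /= (big_cat_nat (leq0n n) nN) /=.
rewrite addrAC subrr add0r; apply: le_trans (ler_norm_sum _ _ _) _.
apply: le_trans (_ : \sum_(n <= k < N) A * y ^+ k <= _); first exact: ler_sum.
rewrite -mulr_sumr -[leRHS]mulrA; apply: ler_wpM2l => //.
exact: geometric_sum_le.
Qed.

Variable R : realType.

Lemma is_cvg_series_geo (u : nat -> R) (A y : R) :
  0 <= A -> 0 <= y -> y < 1 -> (forall k, `|u k| <= A * y ^+ k) ->
  cvgn (series u).
Proof.
move=> A0 y0 y1 Hu; apply: normed_cvg.
apply: (@series_le_cvg _ _ (geometric A y)) => [k|k|k|] /=.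
- exact: normr_ge0.
- by rewrite mulr_ge0 ?exprn_ge0.
- exact: Hu.
by apply: is_cvg_geometric_series; rewrite ger0_norm.
Qed.

Lemma exp_ge_linear (x : R) n : 1 < x -> n%:R * (x - 1) <= x ^+ n.
Proof.
move=> x1; elim: n => [|n IH]; first by rewrite mul0r.
have xn : 1 <= x ^+ n by rewrite exprn_ege1 // ltW.
by rewrite exprS -natr1; move: (x ^+ n) IH xn => t IH t1; nra.
Qed.

(** Half of the growth, [sqrt(x)^n], pays for one factor [n], and the other half for [n^m] by
    induction. *)
Lemma poly_le_exp m (x : R) : 1 < x ->
  exists2 K : R, 0 <= K & forall n : nat, n%:R ^+ m <= K * x ^+ n.
Proof.
elim: m x => [|m IH] x x1.
  by exists 1 => // n; rewrite expr0 mul1r exprn_ege1 // ltW.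
have x0 : 0 <= x by rewrite (le_trans ler01) // ltW.
have y1 : 1 < Num.sqrt x by rewrite -sqrtr1 ltr_sqrt // (lt_trans ltr01).
have [K K0 HK] := IH _ y1.
have d0 : 0 < Num.sqrt x - 1 by rewrite subr_gt0.
exists (K / (Num.sqrt x - 1)) => [|n]; first by rewrite divr_ge0 // ltW.
have xE : x ^+ n = Num.sqrt x ^+ n * Num.sqrt x ^+ n.
  by rewrite -exprMn -expr2 sqr_sqrtr.
rewrite xE exprS; have := HK n; have := exp_ge_linear n y1; rewrite -ler_pdivlMr //.
set a := Num.sqrt x ^+ n => le1 le2.
have -> : K / (Num.sqrt x - 1) * (a * a) = (a / (Num.sqrt x - 1)) * (K * a) by ring.
by apply: ler_pM => //; rewrite exprn_ge0.
Qed.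

Lemma geometric_sum_gt1 (y : R) n : 1 < y ->
  \sum_(0 <= i < n.+1) y ^+ i <= y / (y - 1) * y ^+ n.
Proof.
move=> y1; have d0 : 0 < y - 1 by rewrite subr_gt0.
have y0 : 0 < y by rewrite (lt_trans ltr01).
rewrite mulrAC -exprS ler_pdivlMr //.
suff -> : (\sum_(0 <= i < n.+1) y ^+ i) * (y - 1) = y ^+ n.+1 - 1.
  by rewrite gerBl.
elim: n => [|n IH]; first by rewrite big_nat1 expr0 mul1r expr1.
by rewrite big_nat_recr //= mulrDl IH [in RHS]exprS; ring.
Qed.

End RealEstimates.

(** * Partial sums and tails of the derivatives of G at 1 *)

Section Moments.
Variables (R : realType) (F : finFieldType).
Hypothesis odd_q : odd #|F|.
Local Notation q := #|F|.
Local Notation Q := (#|F|%:R : R).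
Local Notation acoef := (@acoef R F).

(* rho = q ^ (1/4) *)
Definition rho : R := Num.sqrt (rq R F).

Lemma rho_sqr : rho ^+ 2 = rq R F.
Proof. by rewrite sqr_sqrtr // ltW // rq_gt0. Qed.

Lemma rho4 : rho ^+ 4 = Q.
Proof. by rewrite -[4%N]/(2 * 2)%N exprM rho_sqr rq_sqr. Qed.

Lemma rho_ge : 13 / 10 <= rho.
Proof.
have := rho_sqr; have := @rq_ge R F odd_q; rewrite expr2 => r17 E.
have r0 : 0 <= rho by rewrite sqrtr_ge0.
by rewrite leNgt; apply/negP => rlt; nra.
Qed.

Lemma rho_gt1 : 1 < rho. Proof. by have := rho_ge; lra. Qed.
Lemma rho_gt0 : 0 < rho. Proof. by have := rho_ge; lra. Qed.
Lemma rho_neq0 : rho != 0. Proof. by rewrite gt_eqF // rho_gt0. Qed.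

Lemma rho_exp_le m n : (m <= n)%N -> rho ^+ m <= rho ^+ n.
Proof. by move=> mn; apply: ler_weXn2l => //; apply/ltW/rho_gt1. Qed.

Lemma rho_exp_ge1 n : 1 <= rho ^+ n.
Proof. by rewrite exprn_ege1 // ltW // rho_gt1. Qed.

Definition gterm m n : R := acoef n * n%:R ^+ m * Q ^- n.
(** The number [G^(m)(1) / (- ln q)^m], as [derive1n_Gfun] shows. *)
Definition gam m : R := limn (series (gterm m)).
Definition gpart m n : R := \sum_(0 <= a < n) gterm m a.

(** Of the decay [q^(-n) = rho^(-4n)], one factor [rho^n] is spent on the power [n^m]. *)
Lemma gterm_bound m : exists2 K : R, 0 <= K &
  forall n, `|gterm m n| <= K * (rho ^- 3) ^+ n.
Proof.
have [K K0 HK] := poly_le_exp m rho_gt1; exists K => // n.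
rewrite /gterm !normrM; have an := @acoef_le1 R F odd_q n.
have r0 : 0 < rho ^+ n by rewrite exprn_gt0 // rho_gt0.
have Qn : 0 < Q ^- n by rewrite invr_gt0 exprn_gt0 // Q_gt0.
rewrite (gtr0_norm Qn) [X in _ * X * _]ger0_norm ?exprn_ge0 //.
have -> : (rho ^- 3) ^+ n = rho ^+ n * Q ^- n.
  rewrite -rho4 -exprM (_ : (4 * n = n + 3 * n)%N); last by lia.
  by rewrite exprD [X in _ * X]invfM mulrA divff ?expf_neq0 ?rho_neq0 // mul1r exprVn -exprM.
rewrite mulrA; apply: ler_wpM2r; first exact: ltW.
rewrite -[leRHS]mul1r; apply: ler_pM => //; exact: exprn_ge0.
Qed.

Lemma rho3_lt1 : rho ^- 3 < 1.
Proof. by rewrite invf_lt1 ?exprn_gt0 ?rho_gt0 // exprn_egt1 // rho_gt1. Qed.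

Lemma rho3_ge0 : 0 <= rho ^- 3.
Proof. by rewrite invr_ge0 exprn_ge0 // ltW // rho_gt0. Qed.

Lemma is_cvg_gterm m : cvgn (series (gterm m)).
Proof.
have [K K0 HK] := gterm_bound m.
exact: is_cvg_series_geo K0 rho3_ge0 rho3_lt1 HK.
Qed.

Lemma gam_tail m : exists2 K : R, 0 <= K &
  forall n, `|gam m - gpart m n| <= K * rho ^- (3 * n).
Proof.
have [K K0 HK] := gterm_bound m; exists (K / (1 - rho ^- 3)) => [|n].
  by rewrite divr_ge0 // subr_ge0 ltW // rho3_lt1.
have := series_tail_le n K0 rho3_ge0 rho3_lt1 HK (@is_cvg_gterm m).
suff -> : K / (1 - rho ^- 3) * rho ^- (3 * n) = K * (rho ^- 3) ^+ n / (1 - rho ^- 3) by [].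
by rewrite mulrAC exprVn -exprM.
Qed.

End Moments.

Ltac nneg := repeat first
  [ assumption | by apply: ltW | exact: ler0n | exact: ler01 | exact: normr_ge0
  | by rewrite subr_ge0; apply: ltW
  | apply: exprn_ge0 | apply: mulr_ge0 | apply: addr_ge0 | rewrite invr_ge0 ].

(** * Truncated sums of the averaged coefficients *)

Section MomentAsymptotics.
Variables (R : realType) (F : finFieldType).
Hypothesis odd_q : odd #|F|.
Local Notation q := #|F|.
Local Notation Q := (#|F|%:R : R).
Local Notation rho := (rho R F).
Local Notation gam := (@gam R F).
Local Notation gpart := (@gpart R F).
Local Notation w := ((rq R F)^-1).

Let rho0 : 0 < rho. Proof. exact: rho_gt0. Qed.
Let rho1 : 1 < rho. Proof. exact: rho_gt1. Qed.

Definition CsumR (g n : nat) : R := (@Csum F g n)%:~R.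
(** The common factor [|D| / zeta(2)] of the main terms. *)
Definition Cdens (g : nat) : R := Q ^+ g.+1.*2 * (1 - Q^-1).

Lemma Cdens_bounds g : 0 <= Cdens g <= rho ^+ (8 * g + 8).
Proof.
have Q3 := @Q_ge3 R F odd_q; have Q0 := @Q_gt0 R F odd_q.
have h1 : Q^-1 <= 1 by rewrite invf_le1 //; lra.
have h0 : 0 <= Q^-1 by rewrite invr_ge0 ltW.
have Qn : 0 <= Q ^+ g.+1.*2 by rewrite exprn_ge0 // ltW.
rewrite /Cdens mulr_ge0 ?subr_ge0 //=.
have -> : rho ^+ (8 * g + 8) = Q ^+ g.+1.*2.
  by rewrite -(rho4 R odd_q) -exprM; congr (_ ^+ _); lia.
by rewrite -[leRHS]mulr1; apply: ler_wpM2l => //; rewrite gerBl.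
Qed.

Lemma CsumR_error g n :
  `|CsumR g n - Cdens g * Cmain R F n| <= 2 * rho ^+ (4 * g + 12) * rho ^+ (5 * n).
Proof.
apply: le_trans (Csum_bound R odd_q g n) _.
rewrite -mulrA -exprD; apply: ler_wpM2l; first exact: ler0n.
by rewrite -(rho4 R odd_q) -exprM; apply: rho_exp_le => //; lia.
Qed.

Lemma wE n : w ^+ n = rho ^- (2 * n).
Proof. by rewrite -(rho_sqr R odd_q) exprVn -exprM. Qed.

Lemma w_ge0 n : 0 <= w ^+ n.
Proof. by rewrite exprn_ge0 // invr_ge0 ltW // rq_gt0. Qed.

Lemma rho_pow_gt1 n : (0 < n)%N -> 1 < rho ^+ n.
Proof. by move=> n0; rewrite exprn_egt1 ?rho_gt1 // -lt0n. Qed.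

(** The weight [q^(-n/2) = rho^(-2n)] reduces the error [rho^(4g+5n)] to [rho^(4g+3n)], and
    [n <= g]. *)
Lemma weighted_error k : exists2 K : R, 0 <= K & forall g h, (h <= g)%N ->
  `|\sum_(0 <= n < h.+1) n%:R ^+ k * (CsumR g n - Cdens g * Cmain R F n) * w ^+ n|
  <= K * g.+1%:R ^+ k * rho ^+ (7 * g).
Proof.
pose y := rho ^+ 3; have y1 : 1 < y by exact: rho_pow_gt1.
exists (2 * rho ^+ 12 * (y / (y - 1))) => [|g h hg].
  by have y0 := lt_trans ltr01 y1; nneg.
apply: le_trans (ler_norm_sum _ _ _) _.
apply: le_trans (_ : \sum_(0 <= n < h.+1)
    (g.+1%:R ^+ k * (2 * rho ^+ (4 * g + 12))) * y ^+ n <= _).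
  rewrite big_nat_cond [leRHS]big_nat_cond; apply: ler_sum => n.
  move=> /andP[/andP[_ nh] _].
  move: (CsumR g n - Cdens g * Cmain R F n) (CsumR_error g n) => e He.
  rewrite !normrM (ger0_norm (w_ge0 _)).
  rewrite [`|_ ^+ k|]ger0_norm ?exprn_ge0 // -!mulrA; apply: ler_pM.
  - by rewrite exprn_ge0.
  - by rewrite mulr_ge0 // w_ge0.
  - by rewrite lerXn2r ?nnegrE ?ler0n // ler_nat; lia.
  have r0 : 0 <= w ^+ n by exact: w_ge0.
  apply: le_trans (ler_wpM2r r0 He) _.
  rewrite -!mulrA; apply: ler_wpM2l => //.
  apply: ler_wpM2l; first by nneg.
  rewrite wE (_ : (5 * n = 3 * n + 2 * n)%N); last by lia.
  by rewrite exprD mulfK ?expf_neq0 ?rho_neq0 // exprM.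
rewrite -mulr_sumr.
have A0 : 0 <= g.+1%:R ^+ k * (2 * rho ^+ (4 * g + 12)).
  by nneg.
apply: le_trans (ler_wpM2l A0 (geometric_sum_gt1 h y1)) _.
have le : y ^+ h <= rho ^+ (3 * g) by rewrite -exprM rho_exp_le // leq_mul2l hg orbT.
have -> : 2 * rho ^+ 12 * (y / (y - 1)) * g.+1%:R ^+ k * rho ^+ (7 * g) =
    g.+1%:R ^+ k * (2 * rho ^+ (4 * g + 12)) * (y / (y - 1) * rho ^+ (3 * g)).
  rewrite (_ : (7 * g = 4 * g + 3 * g)%N); last by lia.
  by rewrite !exprD; ring.
apply: ler_wpM2l => //; apply: ler_wpM2l => //.
by have y0 := lt_trans ltr01 y1; nneg.
Qed.

Lemma sum_even (V : nmodType) h (f : nat -> V) :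
  \sum_(0 <= n < h.+1) (if odd n then 0 else f n./2) =
  \sum_(0 <= l < (h %/ 2).+1) f l.
Proof.
elim: h => [|h IH]; first by rewrite !big_nat1.
rewrite big_nat_recr //= IH; case: (boolP (odd h)) => oh /=.
  have -> : (h.+1 %/ 2 = (h %/ 2).+1)%N by lia.
  by rewrite [RHS]big_nat_recr //=; congr (_ + f _); lia.
by rewrite addr0; have -> : (h.+1 %/ 2 = h %/ 2)%N by lia.
Qed.

Lemma Q_neq0 : Q != 0.
Proof. by rewrite gt_eqF // Q_gt0. Qed.

Lemma Cmain_gpart l : \sum_(0 <= a < l.+1) acoef R F a * Q ^+ (l - a) =
  Q ^+ l * gpart 0 l.+1.
Proof.
rewrite /gpart mulr_sumr big_nat_cond [RHS]big_nat_cond; apply: eq_bigr => a.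
move=> /andP[/andP[_ al] _]; rewrite /gterm expr0 mulr1 mulrCA; congr (_ * _).
by rewrite -{2}(subnK (_ : a <= l)%N) // exprD mulfK // expf_neq0 // Q_neq0.
Qed.

Lemma CmainE n : Cmain R F n = if odd n then 0 else Q ^+ n./2 * gpart 0 n./2.+1.
Proof. by rewrite /Cmain; case: ifP => // _; rewrite Cmain_gpart. Qed.

(** Only even degrees [n = 2 l] occur, and there the weight exactly cancels the growth [q^l]; this
    leaves partial sums of G at 1, weighted by [n^k = 2^k l^k]. *)
Lemma weighted_main k h :
  \sum_(0 <= n < h.+1) n%:R ^+ k * Cmain R F n * w ^+ n =
  2 ^+ k * \sum_(0 <= l < (h %/ 2).+1) l%:R ^+ k * gpart 0 l.+1.
Proof.
rewrite mulr_sumr -sum_even; apply: eq_bigr => n _; rewrite CmainE.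
case: ifP => [_|on]; first by rewrite mulr0 mul0r.
have nE : n = n./2.*2 by rewrite -[LHS]odd_double_half on.
have wn : w ^+ n = Q ^- n./2 by rewrite {1}nE -mul2n exprM exprVn rq_sqr // exprVn.
have nk : n%:R ^+ k = 2 ^+ k * n./2%:R ^+ k :> R.
  by rewrite {1}nE -mul2n natrM exprMn.
rewrite wn nk; move: (Q ^+ n./2) (expf_neq0 n./2 Q_neq0) => t t0.
by move: (2 ^+ k) (n./2%:R ^+ k) (gpart 0 _) => a b c; field.
Qed.

Local Notation j k m := (ratr (power_sum_coef k m) : R).

Lemma power_sum_jE k n :
  (power_sum k n)%:R = \sum_(1 <= m < k.+2) j k m * n%:R ^+ m :> R.
Proof.
rewrite -(ratr_nat R) power_sum_coefE rmorph_sum; apply: eq_bigr => m _.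
by rewrite rmorphM rmorphXn /= ratr_nat.
Qed.

Lemma power_sum_recr k n : power_sum k n.+1 = (power_sum k n + n.+1 ^ k)%N.
Proof. by rewrite /power_sum big_nat_recr. Qed.

Lemma gtermE m a : gterm R F m a = gterm R F 0 a * a%:R ^+ m.
Proof. by rewrite /gterm expr0 mulr1 mulrAC. Qed.

(** Exchanging the sums, the coefficient of index [a] receives [J_k(M) - J_k(a) + a^k], and
    expanding [J_k(a)] in powers of [a] produces the higher moments. *)
Lemma abel_summation k M :
  \sum_(0 <= l < M.+1) l%:R ^+ k * gpart 0 l.+1 =
  (power_sum k M)%:R * gpart 0 M.+1 + gpart k M.+1
  - \sum_(1 <= m < k.+2) j k m * gpart m M.+1.
Proof.
elim: M => [|M IH].
  rewrite big_nat1 /power_sum big_geq // mul0r add0r /gpart !big_nat1.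
  rewrite [X in _ - X]big1_seq ?subr0 => [|m /andP[_]]; first by rewrite [RHS]gtermE mulrC.
  rewrite mem_index_iota => /andP[m0 _].
  by rewrite big_nat1 gtermE expr0n -[m]prednK //= mulr0 mulr0.
have gS m : gpart m M.+2 = gpart m M.+1 + gterm R F m M.+1.
  by rewrite /gpart big_nat_recr.
rewrite big_nat_recr //= IH !gS power_sum_recr natrD natrX.
under [X in _ = _ - X]eq_bigr do rewrite gS mulrDr gtermE mulrCA.
rewrite big_split /= -mulr_sumr -power_sum_jE power_sum_recr natrD natrX.
by rewrite [gterm R F k _]gtermE; ring.
Qed.

Lemma power_sum_le k : exists2 K : R, 0 <= K &
  forall n, (power_sum k n)%:R <= K * rho ^+ n.
Proof.
have [K K0 HK] := @poly_le_exp R k.+1 rho (rho_gt1 R odd_q); exists K => // n.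
apply: le_trans (HK n); rewrite -natrX ler_nat /power_sum.
apply: leq_trans (_ : \sum_(1 <= l < n.+1) n ^ k <= _)%N.
  rewrite big_nat_cond [leqRHS]big_nat_cond; apply: leq_sum => l.
  by move=> /andP[/andP[_ ln] _]; case: (k) => // k'; rewrite leq_exp2r.
by rewrite sum_nat_const_nat subn1 /= expnS.
Qed.

(** The growth of [J_k(M)] is absorbed by one factor [rho^M], which lowers the tail exponent from 3
    to 2. *)
Lemma tail_combination k : exists2 K : R, 0 <= K & forall M,
  `|(gam 0 * (power_sum k M)%:R + gam k - \sum_(1 <= m < k.+2) j k m * gam m)
    - \sum_(0 <= l < M.+1) l%:R ^+ k * gpart 0 l.+1| <= K * rho ^- (2 * M.+1).
Proof.
have [Kp Kp0 HKp] := power_sum_le k.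
have /choice[T HT] : forall m, exists K : R, 0 <= K /\
    forall n, `|gam m - gpart m n| <= K * rho ^- (3 * n).
  by move=> m; have [K K0 HK] := gam_tail R odd_q m; exists K.
exists (Kp * T 0 + T k + \sum_(1 <= m < k.+2) `|j k m| * T m) => [|M].
  rewrite !addr_ge0 ?mulr_ge0 ?(HT _).1 //.
  by apply: sumr_ge0 => m _; rewrite mulr_ge0 // (HT _).1.
rewrite abel_summation.
rewrite (_ : _ - (_ + _ - _) = (power_sum k M)%:R * (gam 0 - gpart 0 M.+1) +
   (gam k - gpart k M.+1) -
   \sum_(1 <= m < k.+2) j k m * (gam m - gpart m M.+1)); last first.
  under [X in _ = _ - X]eq_bigr do rewrite mulrBr.
  by rewrite sumrB; ring.
have r0 n : 0 < rho ^- n by rewrite invr_gt0 exprn_gt0 // rho_gt0.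
have le3 : rho ^- (3 * M.+1) <= rho ^- (2 * M.+1).
  rewrite lef_pV2 ?posrE ?exprn_gt0 ?rho_gt0 // rho_exp_le //; lia.
have Hm m : `|gam m - gpart m M.+1| <= T m * rho ^- (2 * M.+1).
  apply: le_trans ((HT m).2 M.+1) _; apply: ler_wpM2l => //; exact: (HT m).1.
apply: le_trans (ler_normB _ _) _; rewrite mulrDl; apply: lerD.
  apply: le_trans (ler_normD _ _) _; rewrite mulrDl; apply: lerD; last exact: Hm.
  rewrite normrM ger0_norm // -mulrA.
  apply: le_trans (ler_pM (ler0n _ _) (normr_ge0 _) (HKp M) ((HT 0%N).2 M.+1)) _.
  rewrite -!mulrA; apply: ler_wpM2l => //; rewrite mulrCA; apply: ler_wpM2l.
    exact: (HT _).1.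
  apply: le_trans (_ : rho ^+ M.+1 * rho ^- (3 * M.+1) <= _).
    by apply: ler_wpM2r; [exact: ltW | apply: rho_exp_le].
  rewrite (_ : (3 * M.+1 = M.+1 + 2 * M.+1)%N); last by lia.
  by rewrite exprD [X in _ * X]invfM mulrA divff ?mul1r // expf_neq0 // rho_neq0.
apply: le_trans (ler_norm_sum _ _ _) _; rewrite mulr_suml; apply: ler_sum => m _.
by rewrite normrM -mulrA; apply: ler_wpM2l.
Qed.

(** Besides [weighted_error], the tail of G is multiplied by [|D|], about [rho^(8g)]; cut at [h/2]
    it saves at least [rho^g], and this is where [g <= h.+1] enters. *)
Lemma weighted_moment k : exists2 K : R, 0 <= K & forall g h, (h <= g)%N ->
  (g <= h.+1)%N ->
  `|\sum_(0 <= n < h.+1) n%:R ^+ k * CsumR g n * w ^+ n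
    - 2 ^+ k * Cdens g * (gam 0 * (power_sum k (h %/ 2))%:R + gam k
       - \sum_(1 <= m < k.+2) j k m * gam m)|
  <= K * g.+1%:R ^+ k * rho ^+ (7 * g).
Proof.
have [K1 K10 HK1] := weighted_error k; have [K2 K20 HK2] := tail_combination k.
exists (K1 + 2 ^+ k * rho ^+ 8 * K2) => [|g h hg gh].
  by nneg.
set A := (X in `|_ - _ * X|).
have -> : \sum_(0 <= n < h.+1) n%:R ^+ k * CsumR g n * w ^+ n =
    \sum_(0 <= n < h.+1) n%:R ^+ k * (CsumR g n - Cdens g * Cmain R F n) * w ^+ n +
    Cdens g * (2 ^+ k * \sum_(0 <= l < (h %/ 2).+1) l%:R ^+ k * gpart 0 l.+1).
  rewrite -weighted_main mulr_sumr -big_split /=; apply: eq_bigr => n _; ring.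
set E := \sum_(0 <= n < h.+1) _; set S := \sum_(0 <= l < _) _.
have -> : E + Cdens g * (2 ^+ k * S) - 2 ^+ k * Cdens g * A =
    E - 2 ^+ k * Cdens g * (A - S) by ring.
apply: le_trans (ler_normB _ _) _.
rewrite mulrDl mulrDl; apply: lerD; first exact: HK1.
move: (Cdens g) (Cdens_bounds g) => d /andP[c0 c1].
rewrite !normrM (ger0_norm c0) [`|2 ^+ k|]ger0_norm ?exprn_ge0 //.
have g1 : 1 <= g.+1%:R ^+ k :> R by rewrite exprn_ege1 // ler1n.
apply: le_trans (_ : 2 ^+ k * rho ^+ (8 * g + 8) * (K2 * rho ^- (2 * (h %/ 2).+1)) <= _).
  apply: ler_pM; try exact: HK2; nneg.
  by apply: ler_wpM2l; rewrite ?exprn_ge0.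
have le : rho ^+ (8 * g + 8) * rho ^- (2 * (h %/ 2).+1) <= rho ^+ 8 * rho ^+ (7 * g).
  rewrite ler_pdivrMr ?exprn_gt0 ?rho_gt0 // -!exprD; apply: rho_exp_le => //; lia.
have -> : 2 ^+ k * rho ^+ (8 * g + 8) * (K2 * rho ^- (2 * (h %/ 2).+1)) =
   2 ^+ k * K2 * (rho ^+ (8 * g + 8) * rho ^- (2 * (h %/ 2).+1)) by ring.
have B0 : 0 <= 2 ^+ k * K2 by nneg.
apply: le_trans (ler_wpM2l B0 le) _.
have -> : 2 ^+ k * rho ^+ 8 * K2 * g.+1%:R ^+ k * rho ^+ (7 * g) =
  (2 ^+ k * K2 * (rho ^+ 8 * rho ^+ (7 * g))) * g.+1%:R ^+ k by ring.
rewrite -[leLHS]mulr1; apply: ler_wpM2l => //.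
by nneg.
Qed.

Lemma sum_Qpow M : (1 - Q^-1) * \sum_(0 <= l < M.+1) Q ^+ l = Q ^+ M - Q^-1.
Proof.
elim: M => [|M IH]; first by rewrite big_nat1 expr0 mulr1.
rewrite big_nat_recr //= mulrDr IH mulrBl mul1r [in X in _ + (_ - X)]exprS mulKf ?Q_neq0 //.
ring.
Qed.

(** Without weights the even degrees form a geometric series in [q], whose sum is about
    [q^(h/2) / (1 - 1/q)] and cancels the density factor; this is why [1/zeta(2)] is absent from the
    terms built on these sums. The exponent 9 drops to 7 once [q^(-g/2)] is applied. *)
Lemma unweighted_moment : exists2 K : R, 0 <= K & forall g h, (h <= g)%N ->
  `|\sum_(0 <= n < h.+1) CsumR g n - gam 0 * Q ^+ g.+1.*2 * Q ^+ (h %/ 2)|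
  <= K * rho ^+ (9 * g).
Proof.
have r0 n : 0 <= rho ^+ n by rewrite exprn_ge0 // ltW // rho_gt0.
have [T T0 HT] := gam_tail R odd_q 0.
pose y := rho ^+ 5; have y1 : 1 < y by exact: rho_pow_gt1.
pose c := y / (y - 1); pose c' := rho / (rho - 1).
have c0 : 0 <= c by have y0 := lt_trans ltr01 y1; nneg.
have c'0 : 0 <= c'.
  by nneg.
exists (2 * rho ^+ 12 * c + rho ^+ 8 * (T * c' + `|gam 0|)) => [|g h hg].
  by nneg.
have Q0 := @Q_gt0 R F odd_q.
set M := (h %/ 2)%N; have Mg : (M <= g)%N by rewrite /M; lia.
have -> : \sum_(0 <= n < h.+1) CsumR g n - gam 0 * Q ^+ g.+1.*2 * Q ^+ M =
  \sum_(0 <= n < h.+1) (CsumR g n - Cdens g * Cmain R F n) +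
  Q ^+ g.+1.*2 * ((1 - Q^-1) * (\sum_(0 <= l < M.+1) Q ^+ l * (gpart 0 l.+1 - gam 0))
    - gam 0 * Q^-1).
  pose S := \sum_(0 <= l < M.+1) Q ^+ l * gpart 0 l.+1.
  have SE : \sum_(0 <= l < M.+1) Q ^+ l * (gpart 0 l.+1 - gam 0) =
      S - (\sum_(0 <= l < M.+1) Q ^+ l) * gam 0.
    by rewrite mulr_suml -sumrB; apply: eq_bigr => l _; rewrite mulrBr.
  have SC : \sum_(0 <= n < h.+1) (CsumR g n - Cdens g * Cmain R F n) =
      \sum_(0 <= n < h.+1) CsumR g n - Cdens g * S.
    rewrite sumrB -mulr_sumr /S -sum_even; congr (_ - _ * _).
    by apply: eq_bigr => n _; rewrite CmainE.
  rewrite SE SC; have := sum_Qpow M; set P := \sum_(0 <= l < M.+1) Q ^+ l => PE.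
  have -> : (1 - Q^-1) * (S - P * gam 0) =
      (1 - Q^-1) * S - ((1 - Q^-1) * P) * gam 0 by ring.
  by rewrite PE /Cdens; ring.
rewrite [leRHS]mulrDl; apply: le_trans (ler_normD _ _) _; apply: lerD.
  apply: le_trans (ler_norm_sum _ _ _) _.
  apply: le_trans (_ : \sum_(0 <= n < h.+1) (2 * rho ^+ (4 * g + 12)) * y ^+ n <= _).
    by apply: ler_sum => n _; rewrite -exprM; exact: CsumR_error.
  rewrite -mulr_sumr; have A0 : 0 <= 2 * rho ^+ (4 * g + 12) by nneg.
  apply: le_trans (ler_wpM2l A0 (geometric_sum_gt1 h y1)) _.
  have le : y ^+ h <= rho ^+ (5 * g) by rewrite -exprM rho_exp_le // leq_mul2l hg orbT.
  have -> : 2 * rho ^+ 12 * c * rho ^+ (9 * g) =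
      2 * rho ^+ (4 * g + 12) * (y / (y - 1) * rho ^+ (5 * g)).
    rewrite (_ : (9 * g = 4 * g + 5 * g)%N); last by lia.
    by rewrite !exprD /c; ring.
  by apply: ler_wpM2l => //; apply: ler_wpM2l.
have -> : Q ^+ g.+1.*2 = rho ^+ (8 * g) * rho ^+ 8.
  by rewrite -(rho4 R odd_q) -exprM -exprD; congr (_ ^+ _); lia.
rewrite normrM ger0_norm; last by rewrite mulr_ge0.
have -> : rho ^+ 8 * (T * c' + `|gam 0|) * rho ^+ (9 * g) =
    rho ^+ (8 * g) * rho ^+ 8 * ((T * c' + `|gam 0|) * rho ^+ g).
  by rewrite (_ : (9 * g = 8 * g + g)%N); [rewrite !exprD; ring | lia].
apply: ler_wpM2l; first by rewrite mulr_ge0.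
have h1 : Q^-1 <= 1 by rewrite invf_le1 //; have := @Q_ge3 R F odd_q; lra.
have h0 : 0 <= Q^-1 by rewrite invr_ge0 ltW.
apply: le_trans (ler_normB _ _) _; rewrite [leRHS]mulrDl; apply: lerD; last first.
  rewrite normrM; apply: ler_wpM2l => //; rewrite ger0_norm //.
  exact: le_trans h1 (rho_exp_ge1 R odd_q g).
rewrite normrM ger0_norm ?subr_ge0 // -[leRHS]mul1r.
apply: ler_pM; [by rewrite subr_ge0 | exact: normr_ge0 | by rewrite lerBlDr lerDl |].
apply: le_trans (ler_norm_sum _ _ _) _.
apply: le_trans (_ : \sum_(0 <= l < M.+1) T * rho ^+ l <= _).
  apply: ler_sum => l _; rewrite normrM ger0_norm ?exprn_ge0 ?(ltW Q0) // distrC.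
  apply: le_trans (ler_wpM2l _ (HT l.+1)) _; first by rewrite exprn_ge0 // ltW.
  rewrite mulrCA; apply: ler_wpM2l => //.
  rewrite ler_pdivrMr ?exprn_gt0 ?rho_gt0 // -(rho4 R odd_q) -exprM -exprD.
  by apply: rho_exp_le => //; lia.
rewrite -mulr_sumr -mulrA; apply: ler_wpM2l => //.
apply: le_trans (geometric_sum_gt1 M (rho_gt1 R odd_q)) _.
by apply: ler_wpM2l => //; apply: rho_exp_le.
Qed.

End MomentAsymptotics.

(** * Complex derivatives *)

(** Free of quotients, so that [h = 0] is harmless; it serves the real exponential, sine and cosine
    as well as complex functions. *)
Lemma is_derive_eps (K : numFieldType) (f : K^o -> K^o) (s l : K) :
  is_derive (s : K^o) 1 f l <->
  (forall e, 0 < e -> exists2 d, 0 < d & forall h, `|h| < d ->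
     `|f (s + h) - f s - h * l| <= e * `|h|).
Proof.
have key (h : K) : h != 0 ->
    `|f (s + h) - f s - h * l| = `|l - h^-1 * (f (s + h) - f s)| * `|h|.
  move=> h0; rewrite -normrM -normrN; congr `|_|.
  by rewrite mulrBl mulrAC mulVf // mul1r opprB [l * h]mulrC.
split=> [[ex lE] e e0|H].
  have H : h^-1 *: (f (h *: 1 + s) - f s) @[h --> (0 : K^o)^'] --> (l : K^o).
    by rewrite -lE; exact: ex.
  have /cvgrPdist_le/(_ _ e0)/nbhs_ballP[d /= d0 Hd] := H.
  exists d => // h hd; have [->|h0] := eqVneq h 0.
    by rewrite addr0 mul0r subr0 subrr normr0 mulr0.
  rewrite key //; apply: ler_wpM2r => //.
  have hb : ball (0 : K^o) d (h : K^o) by rewrite -ball_normE /= sub0r normrN.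
  have := Hd h hb h0; rewrite /=.
  by rewrite /GRing.scale /= mulr1 [h + s]addrC.
suff L : h^-1 *: (f (h *: 1 + s) - f s) @[h --> (0 : K^o)^'] --> (l : K^o).
  split; last exact: cvg_lim L.
  by apply/cvg_ex; exists l.
apply/cvgrPdist_le => e e0.
have [d d0 Hd] := H _ e0; apply/nbhs_ballP; exists d => //=.
move=> h; rewrite -ball_normE /= sub0r normrN => hd h0.
have := Hd h hd; rewrite key // /GRing.scale /= mulr1 [h + s]addrC.
by rewrite ler_pM2r // normr_gt0.
Qed.

Section ComplexDerivative.
Variable R : realType.
Local Notation C := R[i].
Implicit Types (z s h l : C) (x y e d : R).

(** The norm of [C] takes its values in [C]; its real part is the same number in the ordered field
    [R]. *)
Definition cnorm z : R := complex.Re `|z|.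

Lemma cnormE z : `|z| = (cnorm z)%:C.
Proof. by rewrite /cnorm normc_def. Qed.

Lemma cnormD z h : cnorm (z + h) <= cnorm z + cnorm h.
Proof. by rewrite -lecR rmorphD /= -!cnormE ler_normD. Qed.

Lemma cnormM z h : cnorm (z * h) = cnorm z * cnorm h.
Proof. by apply: complexI; rewrite rmorphM /= -!cnormE normrM. Qed.

Lemma cnormN z : cnorm (- z) = cnorm z.
Proof. by rewrite /cnorm normrN. Qed.

Lemma cnormB z h : cnorm (z - h) <= cnorm z + cnorm h.
Proof. by rewrite -[cnorm h]cnormN cnormD. Qed.

Lemma cnorm_ge0 z : 0 <= cnorm z.
Proof. by rewrite -lecR -cnormE rmorph0 normr_ge0. Qed.

Lemma cnorm_eq0 z : (cnorm z == 0) = (z == 0).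
Proof. by rewrite -[RHS]normr_eq0 cnormE -(inj_eq (@complexI R)). Qed.

Lemma cnorm_gt0 z : (0 < cnorm z) = (z != 0).
Proof. by rewrite lt_def cnorm_ge0 andbT cnorm_eq0. Qed.

Lemma cnorm0 : cnorm 0 = 0.
Proof. by apply/eqP; rewrite cnorm_eq0. Qed.

Lemma cnorm1 : cnorm 1 = 1.
Proof. by rewrite /cnorm normr1. Qed.

Lemma cnormX z n : cnorm (z ^+ n) = cnorm z ^+ n.
Proof.
elim: n => [|n IH]; first by rewrite !expr0 cnorm1.
by rewrite !exprS cnormM IH.
Qed.

Lemma cnormV z : cnorm z^-1 = (cnorm z)^-1.
Proof. by apply: complexI; rewrite -cnormE normfV cnormE fmorphV. Qed.

Lemma cnormC x : cnorm x%:C = `|x|.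
Proof. by rewrite /cnorm normc_def /= expr0n addr0 sqrtr_sqr. Qed.

Lemma Re_le_cnorm z : `|complex.Re z| <= cnorm z.
Proof.
by rewrite /cnorm normc_def /= -sqrtr_sqr ler_wsqrtr // lerDl sqr_ge0.
Qed.

Lemma Im_le_cnorm z : `|complex.Im z| <= cnorm z.
Proof.
by rewrite /cnorm normc_def /= -sqrtr_sqr ler_wsqrtr // lerDr sqr_ge0.
Qed.

Lemma cnorm_le_ReIm x y : cnorm (x +i* y) <= `|x| + `|y|.
Proof.
have -> : x +i* y = x%:C + 'i * y%:C by apply/eqP; rewrite eq_complex /=; simpc; rewrite ?eqxx.
apply: le_trans (cnormD _ _) _; rewrite cnormM !cnormC.
have -> : cnorm 'i = 1 by rewrite /cnorm normc_def /= expr0n expr1n add0r sqrtr1.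
by rewrite mul1r.
Qed.

Lemma posC_real (e : C) : 0 < e -> exists2 x : R, 0 < x & e = x%:C.
Proof.
case: e => a b; rewrite ltcE /= => /andP[/eqP -> a0].
by exists a.
Qed.

Lemma is_derive_epsP (f : C^o -> C^o) (s l : C) :
  is_derive (s : C^o) 1 f l <->
  (forall e, 0 < e -> exists2 d, 0 < d & forall h, cnorm h < d ->
     cnorm (f (s + h) - f s - h * l) <= e * cnorm h).
Proof.
split=> [/is_derive_eps H e e0|H].
  have e0' : 0 < e%:C by rewrite ltcR.
  have [d d0 Hd] := H _ e0'.
  have [d' d'0 dE] := posC_real d0; exists d' => // h hd.
  have := Hd h; rewrite dE !cnormE ltcR => /(_ hd).
  by rewrite -rmorphM lecR.
apply/is_derive_eps => e e0; have [e' e'0 ->] := posC_real e0.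
have [d d0 Hd] := H _ e'0; exists d%:C; first by rewrite ltcR.
by move=> h; rewrite !cnormE ltcR => /Hd; rewrite -rmorphM lecR.
Qed.

Lemma is_derive_comp (f g : C^o -> C^o) (s a b : C) :
  is_derive (g s : C^o) 1 f a -> is_derive (s : C^o) 1 g b ->
  is_derive (s : C^o) 1 (fun z => f (g z)) (a * b).
Proof.
move=> /is_derive_epsP Hf /is_derive_epsP Hg; apply/is_derive_epsP => e e0.
(* The summand 1 keeps the divisors positive when [a] or [b] is 0. *)
have b1 : 0 < cnorm b + 1 by rewrite ltr_wpDl // cnorm_ge0.
have a1 : 0 < cnorm a + 1 by rewrite ltr_wpDl // cnorm_ge0.
have eb : 0 < e / 2 / (cnorm b + 1) by rewrite !divr_gt0.
have [d1 d10 H1] := Hf _ eb.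
have m0 : 0 < Num.min 1 (e / 2 / (cnorm a + 1)).
  by rewrite lt_min ltr01 !divr_gt0.
have [d2 d20 H2] := Hg _ m0.
exists (Num.min d2 (d1 / (cnorm b + 1))) => [|h].
  by rewrite lt_min d20 divr_gt0.
rewrite lt_min => /andP[hd2 hd1]; set k := g (s + h) - g s.
have h0 := cnorm_ge0 h.
have K := H2 h hd2; rewrite -/k in K.
have K1 : cnorm (k - h * b) <= cnorm h.
  by apply: le_trans K _; rewrite ler_piMl // ge_min lexx.
have K2 : cnorm (k - h * b) <= e / 2 / (cnorm a + 1) * cnorm h.
  by apply: le_trans K _; rewrite ler_wpM2r // ge_min lexx orbT.
have kb : cnorm k <= (cnorm b + 1) * cnorm h.
  rewrite -[k](subrK (h * b)); apply: le_trans (cnormD _ _) _.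
  by rewrite cnormM mulrDl mul1r addrC [cnorm h * _]mulrC lerD2l.
have kd : cnorm k < d1.
  by apply: le_lt_trans kb _; rewrite mulrC -ltr_pdivlMr.
have gk : g (s + h) = g s + k by rewrite /k [RHS]addrC subrK.
rewrite gk; have := H1 k kd.
set r := f (g s + k) - f (g s) - k * a => Hr.
have -> : f (g s + k) - f (g s) - h * (a * b) = r + a * (k - h * b).
  by rewrite /r; ring.
apply: le_trans (cnormD _ _) _; rewrite cnormM.
have P1 : cnorm r <= e / 2 * cnorm h.
  apply: le_trans Hr _; apply: le_trans (ler_wpM2l _ kb) _.
    exact: ltW.
  by rewrite mulrA divfK // gt_eqF.
have P2 : cnorm a * cnorm (k - h * b) <= e / 2 * cnorm h.
  apply: le_trans (_ : (cnorm a + 1) * (e / 2 / (cnorm a + 1) * cnorm h) <= _).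
    by apply: ler_pM; rewrite ?cnorm_ge0 // lerDl.
  by rewrite mulrA mulrCA divff ?mulr1 // gt_eqF.
apply: le_trans (lerD P1 P2) _.
by rewrite -mulrDl -splitr.
Qed.

Lemma is_derive_inv z : z != 0 ->
  is_derive (z : C^o) 1 (fun y : C^o => y^-1 : C^o) (- (z ^- 2)).
Proof.
move=> z0; apply/is_derive_epsP => e e0.
have c0 : 0 < cnorm z by rewrite cnorm_gt0.
have c3 : 0 < cnorm z ^+ 3 by rewrite exprn_gt0.
exists (Num.min (cnorm z / 2) (e * cnorm z ^+ 3 / 2)) => [|h].
  by rewrite lt_min !divr_gt0 ?mulr_gt0.
rewrite lt_min => /andP[h1 h2].
have zh : cnorm z / 2 <= cnorm (z + h).
  have := cnormB (z + h) h; rewrite addrK => le1; lra.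
have zh0 : z + h != 0.
  by rewrite -cnorm_gt0; apply: lt_le_trans zh; rewrite divr_gt0.
have -> : (z + h)^-1 - z^-1 - h * - z ^- 2 = h * h / (z ^+ 2 * (z + h)).
  by field; rewrite z0 zh0.
have zp : 0 < cnorm (z + h) by rewrite cnorm_gt0.
have -> : cnorm (h * h / (z ^+ 2 * (z + h))) =
    cnorm h / (cnorm z * cnorm z * cnorm (z + h)) * cnorm h.
  by rewrite cnormM cnormV expr2 !cnormM mulrAC.
apply: ler_wpM2r; first exact: cnorm_ge0.
rewrite ler_pdivrMr; last by rewrite !mulr_gt0.
apply: le_trans (ltW h2) _; rewrite -mulrA (ler_pM2l e0).
have -> : cnorm z ^+ 3 / 2 = cnorm z * cnorm z * (cnorm z / 2).
  by rewrite !exprS expr0 mulr1 !mulrA.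
by apply: ler_wpM2l => //; rewrite mulr_ge0 ?cnorm_ge0.
Qed.

Lemma derive1_eq_near (f g : C^o -> C^o) (s : C^o) :
  (\forall z \near s, f z = g z) -> derive1 f s = derive1 g s.
Proof. by move=> fg; rewrite !derive1E; apply: near_eq_derive. Qed.

Lemma derive1n_eq_open (U : set C^o) (f g : C^o -> C^o) m : open U ->
  (forall z : C^o, U z -> f z = g z) ->
  forall z : C^o, U z -> derive1n m f z = derive1n m g z.
Proof.
move=> oU fg; elim: m => [|m IH] z Uz; first exact: fg.
rewrite !derive1nS; apply: derive1_eq_near; have := open_nbhs_nbhs (conj oU Uz).
by apply: filterS => y /IH.
Qed.

Lemma derive1n_sequence (U : set C^o) (fs : nat -> C^o -> C^o) m : open U ->
  (forall k (z : C^o), U z -> is_derive z 1 (fs k) (fs k.+1 z)) ->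
  forall z : C^o, U z -> derive1n m (fs 0%N) z = fs m z.
Proof.
move=> oU H; elim: m => [|m IH] z Uz; first by [].
rewrite derive1nS.
rewrite (@derive1_eq_near _ (fs m)); first by rewrite derive1E; case: (H m z Uz).
by have := open_nbhs_nbhs (conj oU Uz); apply: filterS => y /IH.
Qed.

(** The flag [b] serves two half-planes: [Re s < 1] for delta and [Re s > 0] for G. *)
Lemma open_Re (a : R) (b : bool) :
  open [set z : C^o | if b then complex.Re z < a else a < complex.Re z].
Proof.
rewrite openE => z /= Hz; apply/nbhs_ballP.
have d0 : 0 < `|a - complex.Re z|.
  by rewrite normr_gt0 subr_eq0; case: b Hz => Hz; rewrite ?(gt_eqF Hz) ?(lt_eqF Hz).
exists (`|a - complex.Re z|)%:C => /=; first by rewrite ltcR.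
move=> y; rewrite -ball_normE /= cnormE ltcR => hy.
have := Re_le_cnorm (z - y); rewrite raddfB /= => le1.
have := le_lt_trans le1 hy; move: (complex.Re z) (complex.Re y) Hz => u v; clear.
case: b => Hz; [rewrite (gtr0_norm (_ : 0 < a - u)) | rewrite (ltr0_norm (_ : a - u < 0))];
  by rewrite ?subr_gt0 ?subr_lt0 // ltr_norml => /andP[h1 h2]; lra.
Qed.

End ComplexDerivative.

(** * Complex powers of a positive real number *)

Section ComplexPower.
Variables (R : realType) (a : R).
Hypothesis a_gt0 : 0 < a.
Local Notation C := R[i].
Implicit Types (s t z h : C).

Lemma cpowD s t : cpow a (s + t) = cpow a s * cpow a t.
Proof.
case: s t => [x y] [u v]; rewrite /cpow /=.
rewrite powRD; last by rewrite (gt_eqF a_gt0) implybT.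
rewrite mulrDl cosD sinD rmorphM /=; apply/eqP; rewrite eq_complex; simpc => /=.
by apply/andP; split; apply/eqP; ring.
Qed.

Lemma cpow_real (x : R) : cpow a x%:C = (a `^ x)%:C.
Proof. by rewrite /cpow /= mul0r cos0 sin0 mulr1. Qed.

Lemma cpow0 : cpow a 0 = 1.
Proof. by rewrite -[0]/((0 : R)%:C) cpow_real powRr0. Qed.

Lemma cnorm_cpow s : cnorm (cpow a s) = a `^ complex.Re s.
Proof.
rewrite /cpow cnormM cnormC ger0_norm ?powR_ge0 // /cnorm normc_def /= cos2Dsin2.
by rewrite sqrtr1 mulr1.
Qed.

Lemma cpow_neq0 s : cpow a s != 0.
Proof. by rewrite -cnorm_gt0 cnorm_cpow powR_gt0. Qed.

Lemma cpowN s : cpow a (- s) = (cpow a s)^-1.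
Proof.
apply: (mulIf (cpow_neq0 s)); rewrite -cpowD addNr cpow0 mulVf //.
exact: cpow_neq0.
Qed.

Lemma cpowMn n s : cpow a (n%:R * s) = cpow a s ^+ n.
Proof.
elim: n => [|n IH]; first by rewrite mul0r cpow0.
by rewrite -natr1 mulrDl mul1r cpowD IH exprSr.
Qed.

Lemma cpow1 : cpow a 1 = a%:C.
Proof. by rewrite -[1]/((1 : R)%:C) cpow_real powRr1 // ltW. Qed.

Lemma cpow_expn n s : cpow (a ^+ n) s = cpow a (n%:R * s).
Proof.
rewrite /cpow lnXn // -[ln a *+ n]mulr_natl.
have -> : complex.Re (n%:R * s) = n%:R * complex.Re s.
  by case: s => x y; rewrite -(rmorph_nat (real_complex R)); simpc.
have -> : complex.Im (n%:R * s) = n%:R * complex.Im s.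
  by case: s => x y; rewrite -(rmorph_nat (real_complex R)); simpc.
by rewrite powRrM -powR_mulrn ?(ltW a_gt0) // mulrCA mulrA.
Qed.

Lemma real_eps (f : R -> R) (x l : R) : is_derive (x : R^o) 1 (f : R^o -> R^o) l ->
  forall e : R, 0 < e -> exists2 d : R, 0 < d & forall h : R, `|h| < d ->
     `|f (x + h) - f x - h * l| <= e * `|h|.
Proof. by move/is_derive_eps. Qed.

Lemma is_derive_cpow0 : is_derive (0 : C^o) 1 (cpow a : C^o -> C^o) (ln a)%:C.
Proof.
apply/is_derive_epsP => e e0.
set B := `|ln a|; have B0 : 0 <= B by exact: normr_ge0.
(* The bounds below add up to [c (|x| + 7 |y|)] with [|x|] and [|y|] at most [B |h|], whence the 8;
   [c <= 1] linearises the mixed products. *)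
have [c c0 [c1 ce]] : exists2 c : R, 0 < c & c <= 1 /\ c * (8 * (B + 1)) <= e.
  exists (Num.min 1 (e / (8 * (B + 1)))).
    by rewrite lt_min ltr01 divr_gt0 // mulr_gt0 // ltr_wpDl.
  split; first by rewrite ge_min lexx.
  by rewrite -ler_pdivlMr ?mulr_gt0 ?ltr_wpDl // ge_min lexx orbT.
have [d1 d10 H1] := real_eps (is_derive_expR 0) c0.
have [d2 d20 H2] := real_eps (is_derive_sin 0) c0.
have [d3 d30 H3] := real_eps (is_derive_cos 0) c0.
pose d := Num.min (Num.min d1 d2) (Num.min d3 c).
have d0 : 0 < d by rewrite !lt_min d10 d20 d30 c0.
exists (d / (B + 1)) => [|h hd]; first by rewrite divr_gt0 // ltr_wpDl.
have hB : B * cnorm h < d.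
  have : (B + 1) * cnorm h < d by rewrite mulrC -ltr_pdivlMr // ltr_wpDl.
  by apply: le_lt_trans; rewrite ler_wpM2r ?cnorm_ge0 // lerDl.
set x := complex.Re h * ln a; set y := complex.Im h * ln a.
have xB : `|x| <= B * cnorm h.
  by rewrite normrM mulrC; apply: ler_wpM2l => //; exact: Re_le_cnorm.
have yB : `|y| <= B * cnorm h.
  by rewrite normrM mulrC; apply: ler_wpM2l => //; exact: Im_le_cnorm.
have := le_lt_trans xB hB; have := le_lt_trans yB hB.
rewrite !lt_min => /andP[/andP[_ y2] /andP[y3 _]] /andP[/andP[x1 _] /andP[_ xc]].
have := H1 x x1; have := H2 y y2; have := H3 y y3.
rewrite !add0r expR0 sin0 cos0 oppr0 mulr0 !addr0 !subr0 !mulr1 => Hcos Hsin Hexp.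
have -> : cpow a h - cpow a 0 - h * (ln a)%:C =
    (expR x * cos y - 1 - x) +i* (expR x * sin y - y).
  rewrite cpow0 /cpow /powR gt_eqF // -/x -/y.
  case: h @x @y {hd hB xB yB y2 y3 x1 xc Hcos Hsin Hexp} => u v /=.
  by apply/eqP; rewrite eq_complex; simpc.
clearbody x y; apply: le_trans (cnorm_le_ReIm _ _) _.
have c8 : `|x| + 7 * `|y| <= 8 * (B + 1) * cnorm h.
  have h0 := cnorm_ge0 h; move: (cnorm h) h0 xB yB => t t0 xB yB; nra.
suff le1 : `|expR x * cos y - 1 - x| + `|expR x * sin y - y| <= c * (`|x| + 7 * `|y|).
  apply: le_trans le1 _; apply: le_trans (ler_wpM2l (ltW c0) c8) _.
  by rewrite mulrA; apply: ler_wpM2r => //; exact: cnorm_ge0.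
have cy : `|cos y| <= 1 by exact: cos_max.
have le1 : `|expR x * cos y - 1 - x| <= c * `|x| + 2 * (c * `|y|).
  have -> : expR x * cos y - 1 - x = (expR x - 1 - x) * cos y + (1 + x) * (cos y - 1) by ring.
  apply: le_trans (ler_normD _ _) _; rewrite !normrM; apply: lerD.
    by rewrite -[leRHS]mulr1; exact: (ler_pM (normr_ge0 _) (normr_ge0 _) Hexp cy).
  apply: (ler_pM (normr_ge0 _) (normr_ge0 _) _ Hcos); apply: le_trans (ler_normD _ _) _; rewrite normr1.
  have := lt_le_trans xc c1; lra.
have le2 : `|expR x * sin y - y| <= 5 * (c * `|y|).
  have -> : expR x * sin y - y = (expR x - 1) * sin y + (sin y - y) by ring.
  apply: le_trans (ler_normD _ _) _; rewrite normrM.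
  have E1 : `|expR x - 1| <= 2 * `|x|.
    have -> : expR x - 1 = (expR x - 1 - x) + x by ring.
    apply: le_trans (ler_normD _ _) _.
    have := ler_piMl (normr_ge0 x) c1; lra.
  have S1 : `|sin y| <= 2 * `|y|.
    have -> : sin y = (sin y - y) + y by ring.
    apply: le_trans (ler_normD _ _) _.
    have := ler_piMl (normr_ge0 y) c1; lra.
  have P : `|expR x - 1| * `|sin y| <= 4 * (c * `|y|).
    apply: le_trans (ler_pM (normr_ge0 _) (normr_ge0 _) E1 S1) _.
    have := normr_ge0 y; have := normr_ge0 x.
    move: `|x| `|y| (ltW xc) => u v uc u0 v0; nra.
  by apply: le_trans (lerD P Hsin) _; lra.
by apply: le_trans (lerD le1 le2) _; lra.
Qed.

Lemma is_derive_cpow s :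
  is_derive (s : C^o) 1 (cpow a : C^o -> C^o) ((ln a)%:C * cpow a s).
Proof.
apply/is_derive_epsP => e e0.
have c0 : 0 < cnorm (cpow a s) by rewrite cnorm_gt0 cpow_neq0.
have /is_derive_epsP H := is_derive_cpow0.
have [d d0 Hd] := H _ (divr_gt0 e0 c0); exists d => // h /Hd.
rewrite add0r cpow0 cpowD => K.
have -> : cpow a s * cpow a h - cpow a s - h * ((ln a)%:C * cpow a s) =
  cpow a s * (cpow a h - 1 - h * (ln a)%:C) by ring.
rewrite cnormM; apply: le_trans (ler_wpM2l (ltW c0) K) _.
by rewrite mulrA [X in X * _]mulrC divfK // gt_eqF.
Qed.

Lemma is_derive_opp (s : C) : is_derive (s : C^o) 1 (fun z : C^o => - z : C^o) (-1).
Proof.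
apply/is_derive_epsP => e e0; exists 1 => // h _.
rewrite (_ : _ - _ = 0) ?cnorm0 ?mulr_ge0 ?cnorm_ge0 ?ltW //; ring.
Qed.

Lemma is_derive_addr (c s : C) : is_derive (s : C^o) 1 (fun z : C^o => z + c : C^o) 1.
Proof.
apply/is_derive_epsP => e e0; exists 1 => // h _.
rewrite (_ : _ - _ = 0) ?cnorm0 ?mulr_ge0 ?cnorm_ge0 ?ltW //; ring.
Qed.

Definition upow s : C := cpow a (- s).

Lemma is_derive_upow s :
  is_derive (s : C^o) 1 (upow : C^o -> C^o) (- (ln a)%:C * upow s).
Proof.
have := is_derive_comp (is_derive_cpow (- s)) (is_derive_opp s).
by rewrite mulrN1 mulNr.
Qed.

Lemma is_derive_upow_exp n s :
  is_derive (s : C^o) 1 (fun z : C^o => upow z ^+ n : C^o)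
    (n%:R * (- (ln a)%:C) * upow s ^+ n).
Proof.
have -> : (fun z : C^o => upow z ^+ n : C^o) = (fun z => cpow a (- (n%:R * z))).
  by apply/funext => z; rewrite /upow -cpowMn mulrN.
have H : is_derive (s : C^o) 1 (fun z : C^o => - (n%:R * z) : C^o) (- n%:R).
  apply/is_derive_epsP => e e0; exists 1 => // h _.
  rewrite (_ : _ - _ = 0) ?cnorm0 ?mulr_ge0 ?cnorm_ge0 ?ltW //; ring.
have -> : n%:R * (- (ln a)%:C) * upow s ^+ n = (ln a)%:C * cpow a (- (n%:R * s)) * - n%:R.
  by rewrite /upow -cpowMn [n%:R * - s]mulrN; move: (cpow _ _) (ln a)%:C => x y; ring.
exact: (@is_derive_comp _ _ (fun z : C^o => - (n%:R * z) : C^o) s _ _ (is_derive_cpow _) H).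
Qed.

End ComplexPower.

Lemma is_derive_sumf (K : numFieldType) (I : Type) (r : seq I) (f : I -> K^o -> K^o)
    (df : I -> K) (s : K) :
  (forall i, is_derive (s : K^o) 1 (f i) (df i)) ->
  is_derive (s : K^o) 1 (fun z : K^o => \sum_(i <- r) f i z : K^o) (\sum_(i <- r) df i).
Proof.
move=> H; elim: r => [|i r IH].
  under [X in is_derive _ _ X]funext do rewrite big_nil.
  by rewrite big_nil; apply: is_derive_cst.
under [X in is_derive _ _ X]funext do rewrite big_cons.
by rewrite big_cons; apply: is_deriveD.
Qed.

Lemma is_deriveMf (K : numFieldType) (f g : K^o -> K^o) (df dg : K) (s : K) :
  is_derive (s : K^o) 1 f df -> is_derive (s : K^o) 1 g dg ->
  is_derive (s : K^o) 1 (fun z : K^o => f z * g z : K^o) (df * g s + f s * dg).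
Proof.
move=> Hf Hg; rewrite addrC [df * _]mulrC; exact: is_deriveM.
Qed.

Lemma is_derive_scale (K : numFieldType) (c : K) (f : K^o -> K^o) (df : K) (s : K) :
  is_derive (s : K^o) 1 f df ->
  is_derive (s : K^o) 1 (fun z : K^o => c * f z : K^o) (c * df).
Proof. by move=> Hf; exact: (is_deriveZ c Hf). Qed.

(** * Derivatives of the L-function and of delta *)

Section Towers.
Variable R : realType.
Local Notation C := R[i].
Implicit Types (f g h : nat -> C -> C) (c a z : C) (U : set C^o).

(* Scaling out c = - ln q at each derivation gives the normalisation used for the
   derivatives of G and delta in the theorem. *)
Definition tower U c f := forall m (z : C^o), U z ->
  is_derive z 1 (f m : C^o -> C^o) (c * f m.+1 z).

Lemma derive1n_tower U c f m z : open U -> c != 0 -> tower U c f -> U z ->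
  derive1n m (f 0%N : C^o -> C^o) z / c ^+ m = f m z.
Proof.
move=> oU c0 H Uz.
pose fs k (z : C^o) : C^o := c ^+ k * f k z.
have -> : (f 0%N : C^o -> C^o) = fs 0%N by apply/funext => y; rewrite /fs expr0 mul1r.
have Hfs k (y : C^o) : U y -> is_derive y 1 (fs k) (fs k.+1 y).
  by move=> Uy; rewrite /fs exprSr -mulrA; apply: is_derive_scale; apply: H.
by rewrite (derive1n_sequence m oU Hfs Uz) /fs mulrC mulKf // expf_neq0.
Qed.

Lemma tower_sum U c (I : Type) (r : seq I) (f : I -> nat -> C -> C) :
  (forall i, tower U c (f i)) -> tower U c (fun m z => \sum_(i <- r) f i m z).
Proof.
by move=> H m z Uz; rewrite mulr_sumr; apply: is_derive_sumf => i; apply: H.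
Qed.

Lemma tower_add U c f g : tower U c f -> tower U c g ->
  tower U c (fun m z => f m z + g m z).
Proof.
by move=> Hf Hg m z Uz; rewrite mulrDr; apply: is_deriveD; [apply: Hf | apply: Hg].
Qed.

Lemma tower_scale U c a f : tower U c f -> tower U c (fun m z => a * f m z).
Proof.
by move=> Hf m z Uz; rewrite mulrCA; apply: is_derive_scale; apply: Hf.
Qed.

Definition leibniz f g m z := \sum_(i < m.+1) 'C(m, i)%:R * (f i z * g (m - i)%N z).

(** Pascal's rule, with the factor [c] of each derivation pulled out. *)
Lemma tower_leibniz U c f g : tower U c f -> tower U c g -> tower U c (leibniz f g).
Proof.
move=> Hf Hg m z Uz.
have -> : c * leibniz f g m.+1 z = \sum_(i < m.+1)
    'C(m, i)%:R * (c * f i.+1 z * g (m - i)%N z + f i z * (c * g (m - i).+1 z)).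
  rewrite /leibniz big_ord_recl /= bin0 mul1r subn0.
  under eq_bigr => i _ do rewrite /bump /= add1n binS subSS natrD mulrDl.
  rewrite big_split /= big_ord_recr /= bin_small // mul0r addr0.
  under [RHS]eq_bigr => i _ do rewrite mulrDr -mulrA !(mulrCA _ c).
  rewrite big_split /= !mulrDr !mulr_sumr addrA addrC; congr (_ + _).
  rewrite [in RHS]big_ord_recl /= bin0 mul1r subn0; congr (_ + _).
  apply: eq_bigr => i _; rewrite /bump /= add1n -subSn //.
apply: is_derive_sumf => i; apply: is_derive_scale.
by apply: is_deriveMf; [apply: Hf | apply: Hg].
Qed.

Lemma is_derive_horner (p : {poly C}) z :
  is_derive (z : C^o) 1 (fun y : C^o => p.[y] : C^o) p^`().[z].
Proof.
elim/poly_ind: p => [|p a IH].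
  under [X in is_derive _ _ X]funext do rewrite horner0.
  by rewrite deriv0 horner0; apply: is_derive_cst.
under [X in is_derive _ _ X]funext do rewrite hornerMXaddC.
rewrite derivMXaddC hornerD hornerMX [p.[z] + _]addrC -[_ + p.[z]]addr0.
apply: is_deriveD; rewrite -[p.[z]]mulr1.
by apply: is_deriveMf.
Qed.

End Towers.

(** * The successive derivatives of delta *)

Section LTower.
Variables (R : realType) (F : finFieldType).
Hypothesis odd_q : odd #|F|.
Local Notation C := R[i].
Local Notation q := (#|F|%:R : R).
Local Notation Q3 := (Q_ge3 R odd_q).
Implicit Types (z : C).

Definition neg_lnq : C := - (ln q)%:C.
(** Here [q^(s-1)] has modulus below 1, so the denominator of delta has no zero. *)
Definition half_plane : set C^o := [set z : C^o | complex.Re z < 1].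

Lemma open_half_plane : open (half_plane : set C^o).
Proof. exact: (@open_Re R 1 true). Qed.

Lemma card_gt0R : 0 < q. Proof. exact: Q_gt0. Qed.

Lemma lnq_gt0 : 0 < ln q.
Proof. by apply: ln_gt0; apply: lt_le_trans Q3; rewrite ltr1n. Qed.

Lemma neg_lnq_neq0 : neg_lnq != 0.
Proof. by rewrite /neg_lnq oppr_eq0 -(rmorph0 (real_complex R)) (inj_eq (@complexI R)) gt_eqF ?lnq_gt0. Qed.

Lemma tower_upow (U : set C^o) k :
  tower U neg_lnq (fun m z => k%:R ^+ m * upow q z ^+ k).
Proof.
move=> m z _.
have -> : neg_lnq * (k%:R ^+ m.+1 * upow q z ^+ k) =
    k%:R ^+ m * (k%:R * - (ln q)%:C * upow q z ^+ k).
  by rewrite /neg_lnq exprS; move: (k%:R ^+ m) (upow _ _ ^+ k) (ln q)%:C => x y v; ring.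
apply: is_derive_scale; apply: is_derive_upow_exp; exact: card_gt0R.
Qed.

Definition tden z : C := (1 - cpow q (z - 1))^-1.

Lemma tden_neq0 z : half_plane z -> 1 - cpow q (z - 1) != 0.
Proof.
rewrite /half_plane /= => z1; rewrite subr_eq0; apply/eqP => /(congr1 (@cnorm R)).
rewrite cnorm1 cnorm_cpow raddfB /= => /esym; apply/eqP; rewrite lt_eqF //.
rewrite /powR gt_eqF ?card_gt0R // -[ltRHS]expR0 ltr_expR pmulr_llt0 ?lnq_gt0 //.
by rewrite subr_lt0.
Qed.

Lemma is_derive_tden z : half_plane z ->
  is_derive (z : C^o) 1 (tden : C^o -> C^o) (neg_lnq * (tden z - tden z ^+ 2)).
Proof.
move=> Uz; have nz := tden_neq0 Uz.
have D1 := @is_derive_comp _ _ (fun z : C^o => z + (-1) : C^o) z _ _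
  (is_derive_cpow card_gt0R (z - 1)) (is_derive_addr (-1) z).
have D2 := is_deriveD (is_derive_cst (1 : C^o) (z : C^o) 1) (is_derive_scale (-1) D1).
have D3 := @is_derive_comp _ _ (fun z : C^o => 1 + -1 * cpow q (z + -1) : C^o) z _ _ (is_derive_inv _) D2.
have -> : neg_lnq * (tden z - tden z ^+ 2) = - (1 + -1 * cpow q (z + -1)) ^- 2 *
   (0 + -1 * ((ln q)%:C * cpow q (z - 1) * 1)).
  rewrite /neg_lnq /tden mulN1r.
  move: (cpow _ _) (ln q)%:C nz => v l nz.
  by field.
have -> : (tden : C^o -> C^o) = (fun z : C^o => (1 + -1 * cpow q (z + -1))^-1 : C^o).
  by apply/funext => y; rewrite mulN1r.
by apply: D3; rewrite mulN1r.
Qed.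

(** As [tden] satisfies the logistic equation [tden' = - ln q (tden - tden^2)], its normalised
    derivatives are polynomials in [tden], obtained by iterating [p -> p' (X - X^2)]. *)
Definition tdenp m : {poly C} := iter m (fun p => p^`() * ('X - 'X^2)) 'X.

Lemma tower_tden : tower half_plane neg_lnq (fun m z => (tdenp m).[tden z]).
Proof.
move=> m z Uz.
have -> : neg_lnq * (tdenp m.+1).[tden z] =
    (tdenp m)^`().[tden z] * (neg_lnq * (tden z - tden z ^+ 2)).
  by rewrite /tdenp iterS hornerM hornerD hornerN hornerXn hornerX mulrCA.
exact: (is_derive_comp (is_derive_horner _ _) (is_derive_tden Uz)).
Qed.

(** Follows [delta = tden - u tden]; the factor [u] is written in the form of [tower_upow] with
    [k = 1]. *)
Definition deltas m z : C := (tdenp m).[tden z] +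
  -1 * leibniz (fun m z => 1%:R ^+ m * upow q z ^+ 1) (fun m z => (tdenp m).[tden z]) m z.

Lemma tower_deltas : tower half_plane neg_lnq deltas.
Proof.
apply: tower_add tower_tden _; apply: tower_scale; apply: tower_leibniz.
  exact: tower_upow.
exact: tower_tden.
Qed.

Lemma deltas0 : deltas 0 = @delta R F.
Proof.
apply/funext => z; rewrite /deltas /leibniz big_ord1 /= bin0 hornerX expr0 expr1 !mul1r.
by rewrite mulN1r /delta mulrBl mul1r.
Qed.

End LTower.

(** * The approximate functional equation and the derivatives of L *)

Lemma abel_partial_sums (K : comNzRingType) (c : nat -> K) (u : K) m :
  (1 - u) * \sum_(0 <= n < m) (\sum_(0 <= k < n.+1) c k) * u ^+ n =
  \sum_(0 <= n < m) c n * u ^+ n - (\sum_(0 <= k < m) c k) * u ^+ m.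
Proof.
elim: m => [|m IH]; first by rewrite !big_geq // mulr0 mul0r subr0.
rewrite big_nat_recr //= mulrDr IH !(big_nat_recr m) //= exprS.
set b := \sum_(0 <= k < m) c k; set s := \sum_(0 <= k < m) _; ring.
Qed.

(** Here [v] stands for [q^(s-1)]. In [L = (1 - u) (b_1 + b_2 u + ...)] the powers up to [u^g] are
    summed by parts directly. The others are reflected and become a series in [v]; summing that one
    by parts costs [1/(1 - v)], so the factor [(1 - u)/(1 - v)], which is delta, remains. *)
Lemma approximate_functional_equation (K : fieldType) (c : nat -> K) (Q u v : K) g :
  let b n := \sum_(0 <= k < n) c k in
  b g.+1.*2 = 0 -> Q * u * v = 1 -> v != 1 ->
  (forall n, (n < g.+1.*2)%N -> b n.+1 * Q ^+ g = Q ^+ n * b (g.+1.*2 - n).-1) ->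
  \sum_(0 <= n < g.+1.*2) c n * u ^+ n =
  \sum_(0 <= n < g.+1) c n * u ^+ n - b g.+1 * u ^+ g.+1 +
  (\sum_(0 <= n < g) c n * Q ^+ (g - n) * u ^+ (2 * g - n) - b g * u ^+ g) *
    ((1 - u) / (1 - v)).
Proof.
move=> b b0 Quv v1 FE.
have Q0 : Q != 0 by apply: contraTneq (oner_neq0 K) => Q0; rewrite -Quv Q0 !mul0r eqxx.
have vD : 1 - v != 0 by rewrite subr_eq0 eq_sym.
have E1 := abel_partial_sums c u g.+1.*2; rewrite -/(b _) b0 mul0r subr0 in E1.
rewrite -E1 (big_cat_nat (n := g.+1)) //=; last by rewrite -addnn leq_addr.
rewrite mulrDr abel_partial_sums -/(b _); congr (_ + _).
rewrite mulrCA; congr (_ * _).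
apply: (mulIf vD); rewrite mulfVK //.
have -> : \sum_(g.+1 <= n < g.+1.*2) (\sum_(0 <= k < n.+1) c k) * u ^+ n =
    Q ^+ g * u ^+ (2 * g) * \sum_(0 <= n < g) b n.+1 * v ^+ n.
  (* The reversal is [n = 2 g - j]; the top term [n = 2 g + 1] drops out because [b g.+1.*2 = 0]. *)
  rewrite -{1}[g.+1]add0n big_addn -addnn addnK big_nat_rev /= big_ltn //.
  have -> : (0 + g.+1 - 1 + g.+1).+1 = g.+1.*2 by lia.
  rewrite -/(b _) b0 mul0r add0r big_add1 /= mulr_sumr big_nat_cond [RHS]big_nat_cond.
  apply: eq_bigr => j /andP[/andP[_ jg] _].
  have -> : (0 + g.+1 - j.+2 + g.+1)%N = (2 * g - j)%N by lia.
  have jN : (j < g.+1.*2)%N by lia.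
  have := FE j jN; have -> : ((g.+1.*2 - j).-1 = (2 * g - j).+1)%N by lia.
  rewrite -/(b _) => E.
  have -> : u ^+ (2 * g) = u ^+ j * u ^+ (2 * g - j) by rewrite -exprD subnKC //; lia.
  have q1 : Q ^+ j * u ^+ j * v ^+ j = 1 by rewrite -!exprMn Quv expr1n.
  rewrite -[LHS]mul1r -q1.
  have ac (x1 x2 x3 x4 x5 x6 x7 : K) : x7 * x2 = x1 * x6 ->
      x1 * x3 * x5 * (x6 * x4) = x2 * (x3 * x4) * (x7 * x5).
    by move=> e; transitivity (x1 * x6 * (x3 * x5 * x4)); [ring | rewrite -e; ring].
  exact: ac E.
have E3 : (1 - v) * \sum_(0 <= n < g) b n.+1 * v ^+ n =
  \sum_(0 <= n < g) c n * v ^+ n - b g * v ^+ g := abel_partial_sums c v g.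
rewrite -[LHS]mulrA [in LHS](mulrC _ (1 - v)) E3 mulrBr; congr (_ - _).
  rewrite mulr_sumr. apply: eq_big_nat => j /andP[_ jg].
  have -> : Q ^+ g = Q ^+ j * Q ^+ (g - j) by rewrite -exprD subnKC // ltnW.
  have -> : u ^+ (2 * g) = u ^+ j * u ^+ (2 * g - j) by rewrite -exprD subnKC //; lia.
  have q1 : Q ^+ j * u ^+ j * v ^+ j = 1 by rewrite -!exprMn Quv expr1n.
  rewrite -[RHS]mul1r -q1; ring.
have q1 : Q ^+ g * u ^+ g * v ^+ g = 1 by rewrite -!exprMn Quv expr1n.
rewrite -[RHS]mul1r -q1 mul2n -addnn exprD; ring.
Qed.

Section LSeries.
Variables (R : realType) (F : finFieldType).
Hypothesis odd_q : odd #|F|.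
Local Notation C := R[i].
Local Notation q := (#|F|%:R : R).
Local Notation U := (@half_plane R).
Local Notation neg_lnq := (@neg_lnq R F).
Local Notation deltas := (@deltas R F).
Implicit Types (z : C).

Lemma L_chiE n (D : {poly F}) z : D \in mon F n ->
  @L_chi R F D z = \sum_(0 <= k < n) (csum D k)%:~R * upow q z ^+ k.
Proof.
rewrite mem_mon => /andP[_ /eqP sD]; rewrite /L_chi sD /=; apply: eq_big_nat => k _.
by rewrite sum_monics /csum -mulrN cpowMn //; exact: Q_gt0.
Qed.

Lemma bsumE (D : {poly F}) n :
  (bsum D n)%:~R = \sum_(0 <= k < n) (csum D k)%:~R :> C.
Proof. by rewrite /bsum rmorph_sum. Qed.

(** The normalised [m]-th derivative of the approximate functional equation for arbitrary
    coefficients [c]. It is linear in [c], so the sum over [D] can be moved onto the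
    coefficients. *)
Definition Lseq g (c : nat -> C) m z : C :=
  \sum_(0 <= n < g.+1) c n * (n%:R ^+ m * upow q z ^+ n)
  + - (\sum_(0 <= n < g.+1) c n) * (g.+1%:R ^+ m * upow q z ^+ g.+1)
  + \sum_(0 <= n < g) (c n * (q ^+ (g - n))%:C) *
      leibniz deltas (fun m z => (2 * g - n)%:R ^+ m * upow q z ^+ (2 * g - n)) m z
  + - (\sum_(0 <= n < g) c n) *
      leibniz deltas (fun m z => g%:R ^+ m * upow q z ^+ g) m z.

Lemma tower_Lseq g c : tower U neg_lnq (Lseq g c).
Proof.
apply: tower_add; [apply: tower_add; [apply: tower_add|]|].
- by apply: tower_sum => n; apply: tower_scale; apply: tower_upow.
- by apply: tower_scale; apply: tower_upow.
- apply: tower_sum => n; apply: tower_scale; apply: tower_leibniz.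
    exact: tower_deltas.
  exact: tower_upow.
- by apply: tower_scale; apply: tower_leibniz; [exact: tower_deltas | exact: tower_upow].
Qed.

Lemma Lseq0 g D z : D \in mon F g.+1.*2 -> sqf D -> U z ->
  @L_chi R F D z = Lseq g (fun n => (csum D n)%:~R) 0 z.
Proof.
move=> DN sD Uz; rewrite (L_chiE _ DN).
have q0 := Q_gt0 R odd_q.
rewrite (@approximate_functional_equation _ _ q%:C (upow q z) (cpow q (z - 1))).
- have -> : (1 - upow q z) / (1 - cpow q (z - 1)) = deltas 0 z by rewrite (deltas0 R F).
  rewrite /Lseq /leibniz.
  rewrite mulrBl !mulNr addrA; congr (_ + _ - _).
  + by congr (_ - _); rewrite ?expr0 ?mul1r //; apply: eq_bigr => n _; rewrite expr0 mul1r.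
  + rewrite mulr_suml; apply: eq_bigr => n _.
    by rewrite big_ord1 bin0 expr0 !mul1r rmorphXn /= -!mulrA; congr (_ * (_ * _)); rewrite mulrC.
  + by rewrite big_ord1 bin0 expr0 !mul1r -mulrA [deltas _ _ * _]mulrC.
- by rewrite -bsumE (bsum_all odd_q DN sD).
- by rewrite -(cpow1 q0) /upow -!(cpowD q0) (_ : _ + _ = 0) ?cpow0 //; ring.
- by have := tden_neq0 odd_q Uz; rewrite subr_eq0 eq_sym.
- move=> n nN; rewrite -!bsumE -!rmorphXn /=.
  have := functional_equation odd_q DN sD nN => /(congr1 (fun x => x%:~R : C)).
  by rewrite !rmorphM /= !natrX !rmorphXn /= !rmorph_nat.
Qed.

Lemma derive1n_L_chi g D m : D \in mon F g.+1.*2 -> sqf D ->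
  forall z : C^o, U z ->
  derive1n m (@L_chi R F D) z / neg_lnq ^+ m = Lseq g (fun n => (csum D n)%:~R) m z.
Proof.
move=> DN sD z Uz.
rewrite -(derive1n_tower m (@open_half_plane R) (neg_lnq_neq0 R odd_q) (@tower_Lseq g _) Uz).
congr (_ / _); apply: (derive1n_eq_open m (@open_half_plane R)) => // y Uy.
exact: Lseq0.
Qed.

End LSeries.

(** * The series G *)

Lemma poly_geometric_bound (R : realType) m (r : R) : 0 <= r -> r < 1 ->
  exists2 K : R, 0 <= K & exists2 y : R, 0 <= y < 1 &
    forall n : nat, n%:R ^+ m * r ^+ n <= K * y ^+ n.
Proof.
move=> r0 r1; have r2 : 0 < 1 + r by rewrite ltr_wpDr.
(* The ratio [2 / (1 + r)] exceeds 1, yet its product with [r] stays below 1. *)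
have x1 : 1 < 2 / (1 + r) by rewrite ltr_pdivlMr //; lra.
have [K K0 HK] := poly_le_exp m x1; exists K => //; exists (2 / (1 + r) * r).
  by rewrite mulr_ge0 ?divr_ge0 ?(ltW r2) //= mulrAC ltr_pdivrMr //; lra.
by move=> n; rewrite exprMn mulrA ler_wpM2r // exprn_ge0.
Qed.

Section ComplexSeries.
Variable R : realType.
Local Notation C := R[i].

Lemma cvg_complex (x y : nat -> R) (a b : R) :
  x n @[n --> \oo] --> a -> y n @[n --> \oo] --> b ->
  (x n +i* y n : C^o) @[n --> \oo] --> (a +i* b : C^o).
Proof.
move=> /cvgrPdist_le Hx /cvgrPdist_le Hy; apply/cvgrPdist_le => e e0.
have [e' e'0 ->] := posC_real e0; have e2 : 0 < e' / 2 by rewrite divr_gt0.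
have := Hx _ e2; have := Hy _ e2; apply: filterS2 => n Hb Ha.
rewrite cnormE lecR.
have -> : (a +i* b : C) - (x n +i* y n) = (a - x n) +i* (b - y n) by simpc.
by apply: le_trans (cnorm_le_ReIm _ _) _; rewrite [e']splitr lerD.
Qed.

Lemma cvg_real_complex (x : nat -> R) (a : R) :
  x n @[n --> \oo] --> a -> ((x n)%:C : C^o) @[n --> \oo] --> (a%:C : C^o).
Proof. by move=> Hx; apply: (cvg_complex Hx (cvg_cst 0)). Qed.

(** Completeness is only used over [R], for the real and imaginary parts separately. *)
Lemma is_cvg_complex_series (u : nat -> C^o) (A y : R) :
  0 <= A -> 0 <= y -> y < 1 -> (forall k, cnorm (u k) <= A * y ^+ k) ->
  cvgn (series u).
Proof.
move=> A0 y0 y1 Hu.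
have /cvg_ex[a /= Ha] : cvgn (series (fun n => complex.Re (u n))).
  apply: (is_cvg_series_geo A0 y0 y1) => k; exact: le_trans (Re_le_cnorm _) _.
have /cvg_ex[b /= Hb] : cvgn (series (fun n => complex.Im (u n))).
  apply: (is_cvg_series_geo A0 y0 y1) => k; exact: le_trans (Im_le_cnorm _) _.
apply/cvg_ex; exists (a +i* b).
suff -> : series u = (fun n => series (fun n => complex.Re (u n)) n +i*
    series (fun n => complex.Im (u n)) n) by exact: cvg_complex Ha Hb.
apply/funext => n; rewrite /series /= -!raddf_sum.
by case: (\sum_(0 <= k < n) u k).
Qed.

Lemma complex_series_le (u : nat -> C^o) (A y : R) (l : C^o) :
  0 <= A -> 0 <= y -> y < 1 -> (forall k, cnorm (u k) <= A * y ^+ k) ->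
  series u k @[k --> \oo] --> l -> cnorm l <= A / (1 - y).
Proof.
move=> A0 y0 y1 Hu ul; rewrite -lecR -cnormE.
have := @series_tail_le C C^o u A%:C y%:C l 0.
rewrite big_geq // subr0 expr0 mulr1 rmorphM fmorphV rmorphB rmorph1 /=; apply => //.
- by rewrite lecR.
- by rewrite lecR.
- by rewrite ltcR.
by move=> k; rewrite cnormE -rmorphXn -rmorphM lecR.
Qed.

End ComplexSeries.

(** * Termwise differentiation of power series *)

Section PowerSeries.
Variable R : realType.
Local Notation C := R[i].
Variable a : nat -> C.
Hypothesis a_le1 : forall n, cnorm (a n) <= 1.
Implicit Types (u h : C).

Definition pterm m u n : C^o := a n * n%:R ^+ m * u ^+ n.
Definition psum m u : C^o := limn (series (pterm m u)).

Lemma cnorm_nat n : cnorm (n%:R : C) = n%:R.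
Proof. by rewrite -(rmorph_nat (real_complex R)) cnormC ger0_norm. Qed.

Lemma is_cvg_pterm m u : cnorm u < 1 -> cvgn (series (pterm m u)).
Proof.
move=> u1; have [K K0 [y /andP[y0 y1] HK]] := poly_geometric_bound m (cnorm_ge0 u) u1.
apply: (is_cvg_complex_series K0 y0 y1) => n; apply: le_trans (HK n).
rewrite /pterm !cnormM !cnormX cnorm_nat -mulrA ler_piMl //.
by rewrite mulr_ge0 ?exprn_ge0 ?cnorm_ge0.
Qed.

(** Writing [n u^n / u] for [n u^(n-1)] avoids a predecessor at [n = 0]. The bound is quadratic in
    [h] and summable over [n] when [r < 1], which is what termwise differentiation needs. *)
Lemma expr_taylor u h (r : R) n : u != 0 -> cnorm u <= r -> cnorm (u + h) <= r ->
  cnorm ((u + h) ^+ n - u ^+ n - h * (n%:R * u ^+ n / u)) <=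
  cnorm h ^+ 2 / (r * cnorm u) * (n%:R ^+ 2 * r ^+ n).
Proof.
move=> u0 ur hr; have c0 : 0 < cnorm u by rewrite cnorm_gt0.
have r0 : 0 < r by exact: lt_le_trans ur.
set B := cnorm h ^+ 2 / (r * cnorm u).
have B0 : 0 <= B by rewrite divr_ge0 ?exprn_ge0 ?cnorm_ge0 // mulr_ge0 // ltW.
elim: n => [|n IH].
  by rewrite !expr0 subrr !mul0r mulr0 subr0 cnorm0 expr0n mul0r mulr0.
set E := (u + h) ^+ n - u ^+ n - _ in IH.
have -> : (u + h) ^+ n.+1 - u ^+ n.+1 - h * (n.+1%:R * u ^+ n.+1 / u) =
    (u + h) * E + h ^+ 2 * (n%:R * u ^+ n / u).
  rewrite /E !exprS -natr1; move: ((u + h) ^+ n) (u ^+ n) (n%:R : C) => x y z.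
  by field.
apply: le_trans (cnormD _ _) _.
have le1 : cnorm ((u + h) * E) <= r * (B * (n%:R ^+ 2 * r ^+ n)).
  by rewrite cnormM ler_pM ?cnorm_ge0.
have le2 : cnorm (h ^+ 2 * (n%:R * u ^+ n / u)) <= B * (n%:R * (r * r ^+ n)).
  rewrite cnormM cnormX cnormM cnormV cnormM cnormX cnorm_nat /B.
  have -> : cnorm h ^+ 2 / (r * cnorm u) * (n%:R * (r * r ^+ n)) =
     cnorm h ^+ 2 * (n%:R * r ^+ n / cnorm u) by field; rewrite !gt_eqF.
  apply: ler_wpM2l; first by rewrite exprn_ge0 ?cnorm_ge0.
  apply: ler_wpM2r; first by rewrite invr_ge0 cnorm_ge0.
  by apply: ler_wpM2l => //; rewrite lerXn2r ?nnegrE ?cnorm_ge0 // ltW.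
apply: le_trans (lerD le1 le2) _.
rewrite [r ^+ n.+1]exprS -[n.+1%:R]natr1.
have -> : r * (B * (n%:R ^+ 2 * r ^+ n)) + B * (n%:R * (r * r ^+ n)) =
   B * ((n%:R ^+ 2 + n%:R) * (r * r ^+ n)) by ring.
apply: (ler_wpM2l B0); apply: ler_wpM2r; first by rewrite mulr_ge0 ?exprn_ge0 ?ltW.
by have := ler0n R n; move: (n%:R : R) => x x0; nra.
Qed.

(** The remainders of [expr_taylor] form a series dominated by [n^(m+2) r^n], so the total remainder
    is at most a constant times [|h|^2]. *)
Lemma is_derive_psum m u : u != 0 -> cnorm u < 1 ->
  is_derive (u : C^o) 1 (psum m : C^o -> C^o) (psum m.+1 u / u).
Proof.
move=> u0 u1; have c0 : 0 < cnorm u by rewrite cnorm_gt0.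
(* Halfway between [|u|] and 1: one radius below 1 for both [u] and [u + h]. *)
pose r := (1 + cnorm u) / 2.
have r1 : r < 1 by rewrite /r; lra.
have ur : cnorm u < r by rewrite /r; lra.
have r0 : 0 < r by apply: lt_trans ur.
have [K K0 [y /andP[y0 y1] HK]] := poly_geometric_bound m.+2 (ltW r0) r1.
pose M := K / (r * cnorm u) / (1 - y).
have M0 : 0 <= M 
  by rewrite /M divr_ge0 ?subr_ge0 ?(ltW y1) // divr_ge0 // mulr_ge0 ?cnorm_ge0 // ltW.
apply/is_derive_epsP => e e0.
exists (Num.min (r - cnorm u) (e / (M + 1))) => [|h].
  by rewrite lt_min subr_gt0 ur divr_gt0 // ltr_wpDl.
rewrite lt_min => /andP[hr he]; have h0 := cnorm_ge0 h.
have uhr : cnorm (u + h) <= r by have := cnormD u h; lra.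
have uh1 := le_lt_trans uhr r1.
set l := psum m (u + h) - psum m u - h * (psum m.+1 u / u).
suff lM : cnorm l <= M * cnorm h ^+ 2.
  apply: le_trans lM _; rewrite expr2 mulrA ler_wpM2r //.
  have : cnorm h * (M + 1) <= e by rewrite -ler_pdivlMr ?ltW // ltr_wpDl.
  by rewrite mulrDr mulr1 mulrC; lra.
pose t n : C^o := a n * n%:R ^+ m * ((u + h) ^+ n - u ^+ n - h * (n%:R * u ^+ n / u)).
have -> : M * cnorm h ^+ 2 = cnorm h ^+ 2 / (r * cnorm u) * K / (1 - y).
  by rewrite /M; move: (1 - y)^-1 (r * cnorm u)^-1 => v w; ring.
apply: (@complex_series_le _ t) => //.
- by rewrite mulr_ge0 // divr_ge0 ?exprn_ge0 // mulr_ge0 // ltW.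
- move=> n; rewrite /t !cnormM cnormX cnorm_nat.
  apply: le_trans (_ : n%:R ^+ m * (cnorm h ^+ 2 / (r * cnorm u) * (n%:R ^+ 2 * r ^+ n)) <= _).
    apply: ler_pM; rewrite ?mulr_ge0 ?exprn_ge0 ?cnorm_ge0 //.
      by rewrite ler_piMl ?exprn_ge0.
    by apply: expr_taylor => //; exact: ltW.
  rewrite mulrCA -[leRHS]mulrA; apply: ler_wpM2l.
    by rewrite divr_ge0 ?exprn_ge0 // mulr_ge0 // ltW.
  by rewrite mulrA -exprD addn2.
have c1 := @is_cvg_pterm m _ uh1; have c2 := @is_cvg_pterm m _ u1.
have c3 := @is_cvg_pterm m.+1 _ u1.
have := cvgB (cvgB c1 c2) (cvgM (cvg_cst (h / u : C^o)) c3).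
have -> : limn (series (pterm m (u + h))) - limn (series (pterm m u)) -
  (h / u) * limn (series (pterm m.+1 u)) = l.
  by rewrite /l; congr (_ - _); rewrite mulrAC -mulrA.
move=> H; have E : series t = series (pterm m (u + h)) - series (pterm m u) -
    (fun=> h / u : C^o) \* series (pterm m.+1 u); last by rewrite E; exact (H _ _ _ _).
apply/funext => n; rewrite /series /= !fctE.
rewrite (_ : (_ \* _) n = h / u * \sum_(0 <= k < n) pterm m.+1 u k) //.
rewrite mulr_sumr -!sumrB; apply: eq_bigr => k _; rewrite /t /pterm [_ ^+ m.+1]exprSr.
move: (u ^+ k) ((u + h) ^+ k) (a k) ((k%:R : C) ^+ m) (k%:R : C) => x1 x2 x3 x4 x5.
by field.
Qed.

End PowerSeries.

(** * The derivatives of G at 1 *)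

Section GSeries.
Variables (R : realType) (F : finFieldType).
Hypothesis odd_q : odd #|F|.
Local Notation C := R[i].
Local Notation q := (#|F|%:R : R).
Local Notation neg_lnq := (@neg_lnq R F).
Local Notation acoefC := (fun n => (acoef R F n)%:C).

Lemma acoefC_le1 n : cnorm (acoefC n) <= 1.
Proof. by rewrite cnormC; exact: acoef_le1. Qed.

Definition Gseq m (z : C) : C := psum acoefC m (upow q z).

Lemma Gseq0 : @Gfun R F = Gseq 0.
Proof.
apply/funext => s; rewrite /Gfun /Gseq /psum; congr (limn (series _)).
apply/funext => n.
rewrite (sum_monics n (fun L : {poly F} => (moebius L)%:~R / (cpow (absp L)%:R s *
  (\prod_(P in prime_divisors L) (1 + absp (val P)))%:R) : C)).
rewrite /pterm /acoef expr0 mulr1 rmorph_sum mulr_suml /=.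
rewrite big_seq [RHS]big_seq; apply: eq_bigr => L; rewrite mem_mon => /andP[mL /eqP sL].
rewrite (prodn_prime_divisors L (fun P => 1 + absp P)%N) absp_monic // sL /=.
have q0 := Q_gt0 R odd_q.
rewrite natrX (cpow_expn q0) (cpowMn q0) /upow (cpowN q0) exprVn invfM mulrA mulrAC.
congr (_ / _); rewrite rmorphM rmorph_int; congr (_ * _).
rewrite natr_prod -prodfV rmorph_prod; apply: eq_bigr => P _.
by rewrite fmorphV rmorphD rmorph1 /nrm rmorph_nat natrD.
Qed.

Definition right_half_plane : set C^o := [set z : C^o | 0 < complex.Re z].

Lemma cnorm_upow_lt1 z : right_half_plane z -> cnorm (upow q z) < 1.
Proof.
rewrite /right_half_plane /= /upow cnorm_cpow => z0.
rewrite /powR gt_eqF ?Q_gt0 // -[ltRHS]expR0 ltr_expR pmulr_llt0 ?lnq_gt0 //.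
by rewrite raddfN oppr_lt0.
Qed.

Lemma tower_Gseq : tower right_half_plane neg_lnq Gseq.
Proof.
move=> m z Uz; have q0 := Q_gt0 R odd_q.
have u0 : upow q z != 0 by rewrite cpow_neq0.
have -> : neg_lnq * Gseq m.+1 z = psum acoefC m.+1 (upow q z) / upow q z *
   (- (ln q)%:C * upow q z) by rewrite mulrCA divfK.
have D := is_derive_psum acoefC_le1 m u0 (cnorm_upow_lt1 Uz).
exact: (is_derive_comp D (is_derive_upow q0 z)).
Qed.

Lemma Gseq1 m : Gseq m 1 = (gam R F m)%:C.
Proof.
rewrite /Gseq /psum; apply: (@cvg_lim C^o) => //.
have : ((series (@gterm R F m) n)%:C : C^o) @[n --> \oo] --> ((gam R F m)%:C : C^o).
  by apply: cvg_real_complex; exact: is_cvg_gterm.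
suff -> : (fun n => (series (@gterm R F m) n)%:C : C^o) = series (pterm acoefC m (upow q 1)) by [].
apply/funext => n; rewrite /series /= rmorph_sum /=; apply: eq_bigr => k _.
rewrite /gterm /pterm !rmorphM rmorphXn rmorph_nat fmorphV rmorphXn /=.
by rewrite /upow cpowN ?Q_gt0 // cpow1 ?Q_gt0 // exprVn.
Qed.

Lemma derive1n_Gfun m : derive1n m (@Gfun R F) 1 / neg_lnq ^+ m = (gam R F m)%:C.
Proof.
rewrite -Gseq1 Gseq0; apply: (derive1n_tower m _ (neg_lnq_neq0 R odd_q) tower_Gseq).
  exact: (@open_Re R 0 false).
by rewrite /right_half_plane /= ltr01.
Qed.

Lemma Gfun1 : @Gfun R F 1 = (gam R F 0)%:C.
Proof. by rewrite Gseq0 Gseq1. Qed.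

End GSeries.

(** * The moment *)

Lemma sum_trinomial_index (V : nmodType) m (f : nat -> nat -> nat -> V) :
  \sum_(a < m.+1) \sum_(b < m.+1) \sum_(c < m.+1 | (a + b + c == m)%N) f a b c =
  \sum_(b < m.+1) \sum_(c < (m - b).+1) f (m - b - c)%N b c.
Proof.
rewrite exchange_big /=; apply: eq_bigr => b _.
under eq_bigr => a _ do rewrite big_mkcond.
rewrite exchange_big /= (big_ord_widen m.+1 (fun c => f (m - b - c)%N b c)) ?ltnS ?leq_subr //.
rewrite [RHS]big_mkcond; apply: eq_bigr => c _.
have bm := ltn_ord b; have cm := ltn_ord c.
case: ifP => cb.
  have am : (m - b - c < m.+1)%N by lia.
  rewrite (bigD1 (Ordinal am)) //= big1 ?addr0 => [|a an].
    by case: ifP => // /eqP; lia.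
  case: ifP => // /eqP E; case/eqP: an; apply: val_inj => /=; lia.
by rewrite big1 // => a _; case: ifP => // /eqP; lia.
Qed.

Lemma trinomial_coef (K : numFieldType) m b c : (b <= m)%N -> (c <= m - b)%N ->
  m`!%:R / ((m - b - c)`! * b`! * c`!)%:R = 'C(m, b)%:R * 'C(m - b, c)%:R :> K.
Proof.
move=> bm cm; rewrite -(bin_fact bm) -(bin_fact cm) !natrM.
have nz k : (k`!%:R : K) != 0 by rewrite pnatr_eq0 -lt0n fact_gt0.
by field; rewrite !nz.
Qed.

Section Assembly.
Variables (R : realType) (F : finFieldType).
Hypothesis odd_q : odd #|F|.
Variable mu : nat.
Local Notation C := R[i].
Local Notation Q := (#|F|%:R : R).
Local Notation w := ((rq R F)^-1).
Local Notation CsumR := (@CsumR R F).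
Local Notation Cdens := (@Cdens R F).
Local Notation gam := (@gam R F).
Local Notation half := (1 / 2 : C).
Local Notation j k m := (ratr (power_sum_coef k m) : R).

Definition wsum c g h : R := \sum_(0 <= n < h.+1) n%:R ^+ c * CsumR g n * w ^+ n.
Definition wsum_main c g h : R := 2 ^+ c * Cdens g *
  (gam 0 * (power_sum c (h %/ 2))%:R + gam c - \sum_(1 <= m < c.+2) j c m * gam m).
Definition usum g h : R := \sum_(0 <= n < h.+1) CsumR g n.
Definition usum_main g h : R := gam 0 * Q ^+ g.+1.*2 * Q ^+ (h %/ 2).

(** The number [delta^(i)(1/2) / (- ln q)^i]. *)
Definition delta_deriv i : C := @deltas R F i half.

Definition dform g (Y : R) : C := Y%:C * w%:C ^+ g *
  \sum_(i < mu.+1) 'C(mu, i)%:R * (delta_deriv i * g%:R ^+ (mu - i)).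

(** Arises from expanding [(2 g - n)^(mu - b)] in Leibniz's formula, which separates [n] from
    [g]. *)
Definition trinomial_term g (X : nat -> R) b c : C :=
  'C(mu, b)%:R * 'C(mu - b, c)%:R * (-1) ^+ c * (2 * g)%:R ^+ (mu - b - c) *
  delta_deriv b * (X c)%:C.

(** One form for both sides: at the exact sums it is the moment, at their asymptotic values the main
    term of the theorem. *)
Definition linform g (X X' : nat -> R) (Y Y' : R) : C :=
  (X mu)%:C - g.+1%:R ^+ mu * Y%:C * w%:C ^+ g.+1
  + \sum_(b < mu.+1) \sum_(c < (mu - b).+1) trinomial_term g X' b c
  - dform g Y'.

Lemma half_half_plane : half_plane half.
Proof.
have -> : half = (1 / 2)%:C by rewrite rmorphM fmorphV rmorph1 rmorph_nat.
by rewrite /half_plane /=; lra.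
Qed.

Lemma upow_half : upow Q half = w%:C.
Proof.
have q0 := Q_gt0 R odd_q.
have -> : half = (2^-1)%:C by rewrite fmorphV rmorph_nat mul1r.
by rewrite /upow cpowN // cpow_real powR12_sqrt ?ltW // fmorphV.
Qed.

(** At the central point [u = q^(-1/2)] the dual sum acquires the same weight [q^(-n/2)] as the
    first one. *)
Lemma Q_w g n : (n <= g)%N -> (Q ^+ (g - n))%:C * w%:C ^+ (2 * g - n) = w%:C ^+ n.
Proof.
move=> ng; rewrite -!(rmorphXn (real_complex R)) -(rmorphM (real_complex R)); congr (_%:C).
have r0 := rq_gt0 R odd_q; rewrite -(rq_sqr R F) -exprM exprVn.
have -> : (2 * g - n = 2 * (g - n) + n)%N by lia.
by rewrite exprD invfM mulrA divff ?mul1r ?exprVn // expf_neq0 // gt_eqF.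
Qed.

Lemma leibniz_trinomial g n : (n <= g)%N ->
  (Q ^+ (g - n))%:C * leibniz (@deltas R F)
     (fun m z => (2 * g - n)%:R ^+ m * upow Q z ^+ (2 * g - n)) mu half =
  \sum_(b < mu.+1) \sum_(c < (mu - b).+1)
     trinomial_term g (fun c => n%:R ^+ c * w ^+ n) b c.
Proof.
move=> ng; rewrite /leibniz mulr_sumr; apply: eq_bigr => b _.
rewrite upow_half natrB; last by lia.
rewrite exprBn; have := Q_w ng.
set x := (Q ^+ _)%:C; set y := w%:C ^+ (2 * g - n) => xy.
transitivity ('C(mu, b)%:R * delta_deriv b * w%:C ^+ n * \sum_(c < (mu - b).+1)
    (-1) ^+ c * (2 * g)%:R ^+ (mu - b - c) * n%:R ^+ c *+ 'C(mu - b, c)).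
  by rewrite -xy /delta_deriv; move: (\sum_(c < _) _) (deltas F b half) ('C(mu, b)%:R : C) => s d e; ring.
rewrite mulr_sumr; apply: eq_bigr => c _.
rewrite /trinomial_term rmorphM !rmorphXn rmorph_nat /= -[X in _ * X = _]mulr_natr.
move: (delta_deriv b) ('C(mu, b)%:R : C) ('C(mu - b, c)%:R : C) (w%:C ^+ n) ((-1) ^+ c : C)
  ((2 * g)%:R ^+ (mu - b - c) : C) (n%:R ^+ c : C) => x1 x2 x3 x4 x5 x6 x7; ring.
Qed.

Lemma Lseq_linform g : (0 < g)%N ->
  Lseq F g (fun n => (CsumR g n)%:C) mu half =
  linform g (fun c => wsum c g g) (fun c => wsum c g g.-1) (usum g g) (usum g g.-1).
Proof.
move=> g0; rewrite /Lseq /linform upow_half; congr (_ + _ + _ + _).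
- rewrite /wsum rmorph_sum; apply: eq_bigr => n _.
  by rewrite !rmorphM !rmorphXn rmorph_nat /= mulrCA mulrA.
- rewrite /usum rmorph_sum mulNr; congr (- _).
  by rewrite mulrA [_ * _ ^+ mu]mulrC.
- transitivity (\sum_(0 <= n < g) (CsumR g n)%:C * \sum_(b < mu.+1) \sum_(c < (mu - b).+1)
     trinomial_term g (fun c => n%:R ^+ c * w ^+ n) b c).
    apply: eq_big_nat => n /andP[_ ng]; rewrite -mulrA leibniz_trinomial //; exact: ltnW.
  under eq_bigr => n _ do rewrite mulr_sumr.
  rewrite exchange_big /=; apply: eq_bigr => b _.
  under eq_bigr => n _ do rewrite mulr_sumr.
  rewrite exchange_big /=; apply: eq_bigr => c _.
  rewrite /trinomial_term /wsum rmorph_sum mulr_sumr prednK //.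
  apply: eq_bigr => n _; rewrite !rmorphM /=.
  by rewrite mulrCA; congr (_ * _); rewrite mulrCA mulrA.
- rewrite /dform /usum rmorph_sum prednK // mulNr -mulrA; congr (- (_ * _)).
  rewrite /leibniz mulr_sumr upow_half; apply: eq_bigr => i _.
  by rewrite [RHS]mulrC -!mulrA.
Qed.

Lemma LseqD g (c c' : nat -> C) m z :
  Lseq F g (fun n => c n + c' n) m z = Lseq F g c m z + Lseq F g c' m z.
Proof.
rewrite /Lseq.
under eq_bigr => n _ do rewrite mulrDl.
under [X in _ + X + _]eq_bigr => n _ do rewrite 2!mulrDl.
rewrite !big_split /= !opprD !mulrDl.
set x1 := \sum_(0 <= i < g.+1) c i * _; set x2 := \sum_(0 <= i < g.+1) c' i * _.
set y1 := _ * _; set y2 := _ * _; ring.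
Qed.

Lemma Lseq_const0 g m z : Lseq F g (fun=> 0 : C) m z = 0.
Proof.
rewrite /Lseq !big1 ?oppr0 ?mul0r ?addr0 // => n _; by rewrite !mul0r.
Qed.

Lemma Lseq_sum g (I : Type) (r : seq I) (P : pred I) (c : I -> nat -> C) m z :
  \sum_(i <- r | P i) Lseq F g (c i) m z =
  Lseq F g (fun n => \sum_(i <- r | P i) c i n) m z.
Proof.
elim: r => [|i r IH].
  rewrite big_nil; under [X in Lseq _ _ X]funext do rewrite big_nil.
  by rewrite Lseq_const0.
under [X in Lseq _ _ X]funext do rewrite big_cons.
rewrite big_cons; case: (P i) => //.
by rewrite LseqD IH.
Qed.

Lemma moment_linform g : (0 < g)%N ->
  \sum_(D in monic_square_frees F (2 * g + 2))
    derive1n mu (@L_chi R F (val D)) half / (@neg_lnq R F) ^+ mu =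
  linform g (fun c => wsum c g g) (fun c => wsum c g g.-1) (usum g g) (usum g g.-1).
Proof.
move=> g0; rewrite -Lseq_linform //.
rewrite (sum_sqfrees _ (fun D => derive1n mu (@L_chi R F D) half / (@neg_lnq R F) ^+ mu)).
have -> : (2 * g + 2 = g.+1.*2)%N by lia.
rewrite big_seq_cond.
under eq_bigr => D /andP[DN sD] do rewrite (derive1n_L_chi odd_q mu DN sD half_half_plane).
rewrite -big_seq_cond Lseq_sum; congr Lseq; apply/funext => n.
rewrite /(CsumR g n) /Csum rmorph_sum rmorph_sum /=.
by apply: eq_big => D; rewrite ?rmorph_int.
Qed.

Lemma wsum_mainC c g h : (wsum_main c g h)%:C = 2 ^+ c * (Cdens g)%:C *
  ((gam 0)%:C * (power_sum c (h %/ 2))%:R + (gam c)%:C -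
   \sum_(1 <= m < c.+2) ratr (power_sum_coef c m) * (gam m)%:C).
Proof.
rewrite /wsum_main; move: (Cdens g) => d.
rewrite 2!rmorphM rmorphXn rmorph_nat /= rmorphB rmorphD rmorphM rmorph_nat /=.
congr (_ * (_ - _)); rewrite rmorph_sum; apply: eq_bigr => m _.
by rewrite rmorphM /= fmorph_rat.
Qed.

(** The analytic quantities enter as variables subject to equations, so that the comparison with
    [linform] is pure algebra. *)
Lemma main_linform g (A Z x1 x2 l : C) (dG ddelta : nat -> C) :
  A = (Q ^+ g.+1.*2)%:C -> A / Z = (Cdens g)%:C ->
  (forall m, dG m = (gam m)%:C) -> l != 0 ->
  (forall b, ddelta b / (- l) ^+ b = delta_deriv b) ->
  x1 = (Q ^+ (g %/ 2))%:C * w%:C ^+ g.+1 ->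
  x2 = (Q ^+ (g.-1 %/ 2))%:C * w%:C ^+ g ->
  let G1 := (gam 0)%:C in
  let trinomial a b c : C := (-1) ^+ c * mu`!%:R / (a`! * b`! * c`!)%:R in
  2 ^+ mu * A / Z * (G1 * (power_sum mu (g %/ 2))%:R + dG mu)
  - 2 ^+ mu * A / Z * (\sum_(1 <= n < mu.+2) ratr (power_sum_coef mu n) * dG n)
  - g.+1%:R ^+ mu * G1 * A * x1
  + 2 ^+ mu * A / Z *
      (\sum_(a < mu.+1) \sum_(b < mu.+1) \sum_(c < mu.+1 | (a + b + c == mu)%N)
        trinomial a b c * (g%:R ^+ a * ddelta b / (- 2 * l) ^+ b) *
        (G1 * (power_sum c (g.-1 %/ 2))%:R + dG c))
  - 2 ^+ mu * A / Z *
      (\sum_(a < mu.+1) \sum_(b < mu.+1) \sum_(c < mu.+1 | (a + b + c == mu)%N)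
        trinomial a b c * (g%:R ^+ a * ddelta b / (- 2 * l) ^+ b) *
        (\sum_(1 <= n < c.+2) ratr (power_sum_coef c n) * dG n))
  - G1 * A * x2 *
      (\sum_(0 <= m < mu.+1)
        'C(mu, m)%:R * (g%:R ^+ (mu - m) * ddelta m / (- l) ^+ m))
  = linform g (fun c => wsum_main c g g) (fun c => wsum_main c g g.-1) (usum_main g g) (usum_main g g.-1).
Proof.
move=> AE AZ dGE l0 ddE x1E x2E G1 trinomial; rewrite /linform.
have AZ2 : 2 ^+ mu * A / Z = 2 ^+ mu * (Cdens g)%:C by rewrite -mulrA AZ.
rewrite AZ2 -mulrBr.
have -> : G1 * (power_sum mu (g %/ 2))%:R + dG mu
   - \sum_(1 <= n < mu.+2) ratr (power_sum_coef mu n) * dG n =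
   (gam 0)%:C * (power_sum mu (g %/ 2))%:R + (gam mu)%:C -
   \sum_(1 <= m < mu.+2) ratr (power_sum_coef mu m) * (gam m)%:C.
  by rewrite dGE; congr (_ - _); apply: eq_bigr => n _; rewrite dGE.
rewrite -wsum_mainC -[X in X - _ = _]addrA -mulrBr.
congr (_ - _ + _ - _).
- rewrite /usum_main AE x1E !rmorphM /= -/G1; move: (_ ^+ mu) (w%:C ^+ _) => y1 y2; ring.
- pose T a b c := trinomial a b c * (g%:R ^+ a * ddelta b / (- 2 * l) ^+ b).
  have E f := sum_trinomial_index mu (fun a b c => T a b c * f c).
  rewrite (E (fun c => G1 * (power_sum c (g.-1 %/ 2))%:R + dG c)).
  rewrite (E (fun c => \sum_(1 <= n < c.+2) ratr (power_sum_coef c n) * dG n)).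
  rewrite /T {T E} -sumrB mulr_sumr.
  apply: eq_bigr => b _; rewrite -sumrB mulr_sumr; apply: eq_bigr => c _.
  have bm : (b <= mu)%N by rewrite -ltnS.
  have cm : (c <= mu - b)%N by rewrite -ltnS.
  rewrite -mulrBr /trinomial_term wsum_mainC dGE.
  have -> : \sum_(1 <= n < c.+2) ratr (power_sum_coef c n) * dG n =
    \sum_(1 <= n < c.+2) ratr (power_sum_coef c n) * (gam n)%:C.
    by apply: eq_bigr => n _; rewrite dGE.
  rewrite -/G1; set X := _ - _; rewrite /trinomial.
  rewrite -(trinomial_coef C bm cm) -ddE.
  have -> : - 2 * l = 2 * - l by ring.
  have -> : (2 * g)%:R ^+ (mu - b - c) = 2 ^+ (mu - b - c) * g%:R ^+ (mu - b - c) :> C.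
    by rewrite natrM exprMn.
  (* With [a = mu - b - c], the factor [2^a] belongs to [(2g)^a], [2^c] to [wsum_main], and [2^b]
     cancels the 2 in [(- 2 ln q)^b]. *)
  have -> : 2 ^+ mu = 2 ^+ (mu - b - c) * 2 ^+ b * 2 ^+ c :> C.
    by rewrite -!exprD; congr (_ ^+ _); lia.
  have t0 : 2 ^+ b != 0 :> C by rewrite expf_neq0 // pnatr_eq0.
  have l1 : (- l) ^+ b != 0 by rewrite expf_neq0 // oppr_eq0.
  rewrite exprMn.
  have f0 : ((mu - b - c)`! * b`! * c`!)%:R != 0 :> C.
    by rewrite pnatr_eq0 -lt0n !muln_gt0 !fact_gt0.
  move: ((2 : C) ^+ b) ((- l) ^+ b) (((mu - b - c)`! * b`! * c`!)%:R : C) t0 l1 f0.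
  move=> z1 z2 z3 n1 n2 n3.
  by field; rewrite n1 n2 n3.
rewrite /dform /usum_main AE x2E big_mkord.
move: (Q ^+ g.+1.*2) (Q ^+ (g.-1 %/ 2)) => y1 y2; rewrite 2!rmorphM /= -/G1.
have -> : G1 * y1%:C * (y2%:C * w%:C ^+ g) = G1 * y1%:C * y2%:C * w%:C ^+ g.
  by rewrite !mulrA.
by congr (_ * _); apply: eq_bigr => i _; rewrite -ddE; congr (_ * _); rewrite [RHS]mulrC mulrA.
Qed.

Local Notation rho := (@rho R F).

Definition error_scale g : R := g.+1%:R ^+ mu * rho ^+ (7 * g).

Definition dominated (f : nat -> C) := exists2 K : R, 0 <= K &
  forall g, (0 < g)%N -> cnorm (f g) <= K * error_scale g.

Lemma error_scale_ge0 g : 0 <= error_scale g.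
Proof. by rewrite mulr_ge0 ?exprn_ge0 // ltW // rho_gt0. Qed.

Lemma dominatedD f1 f2 : dominated f1 -> dominated f2 -> dominated (fun g => f1 g + f2 g).
Proof.
move=> [K K0 HK] [L L0 HL]; exists (K + L) => [|g g0]; first exact: addr_ge0.
by apply: le_trans (cnormD _ _) _; rewrite mulrDl lerD // ?HK ?HL.
Qed.

Lemma dominatedZ (c : C) f : dominated f -> dominated (fun g => c * f g).
Proof.
move=> [K K0 HK]; exists (cnorm c * K) => [|g g0]; first by rewrite mulr_ge0 // cnorm_ge0.
by rewrite cnormM -mulrA; apply: ler_wpM2l (HK g g0); exact: cnorm_ge0.
Qed.

Lemma dominated_sum n (f : 'I_n -> nat -> C) : (forall i, dominated (f i)) ->
  dominated (fun g => \sum_(i < n) f i g).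
Proof.
move=> H; suff : forall r : seq 'I_n, dominated (fun g => \sum_(i <- r) f i g) by apply.
elim=> [|i r IH].
  by exists 0 => // g _; rewrite big_nil cnorm0 mul0r.
by under [X in dominated X]funext do rewrite big_cons; apply: dominatedD.
Qed.

Lemma dominated_weighted c b h : (b + c <= mu)%N ->
  (forall g, (0 < g)%N -> (h g <= g)%N && (g <= (h g).+1)%N) ->
  dominated (fun g => g.+1%:R ^+ (mu - b - c) * ((wsum c g (h g))%:C - (wsum_main c g (h g))%:C)).
Proof.
move=> bc Hh; have [K K0 HK] := weighted_moment R odd_q c; exists K => // g g0.
have /andP[h1 h2] := Hh g g0; have := HK g (h g) h1 h2.
rewrite -/(wsum _ _ _) -/(wsum_main _ _ _) => Kg.
rewrite cnormM cnormX cnorm_nat -(rmorphB (real_complex R)) cnormC.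
have n1 : 1 <= (g.+1%:R : R) by rewrite ler1n.
apply: le_trans (ler_wpM2l _ Kg) _; first by rewrite exprn_ge0.
have ac (x y z : R) : x * (K * y * z) = K * (x * y * z) by ring.
rewrite ac /error_scale; apply: ler_wpM2l => //; apply: ler_wpM2r.
  by rewrite exprn_ge0 // ltW // rho_gt0.
by rewrite -exprD; apply: ler_weXn2l => //; lia.
Qed.

(** The power of [w] saves [rho^(2g)], which brings [rho^(9g)] down to [rho^(7g)]. *)
Lemma dominated_unweighted b h s : (b <= mu)%N ->
  (forall g, (0 < g)%N -> (h g <= g <= s g)%N) ->
  dominated (fun g => ((usum g (h g))%:C - (usum_main g (h g))%:C) *
     (g.+1%:R ^+ (mu - b) * w%:C ^+ s g)).
Proof.
move=> bmu Hh; have [K K0 HK] := unweighted_moment R odd_q; exists K => // g g0.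
have /andP[h1 h2] := Hh g g0; have := HK g (h g) h1.
rewrite -/(usum _ _) -/(usum_main _ _) => Kg.
have r0 := rho_gt0 R odd_q.
have wr : w ^+ s g <= rho ^- (2 * g).
  rewrite (wE R odd_q) -!exprVn; apply: ler_wiXn2l; last by lia.
    by rewrite invr_ge0 ltW.
  by rewrite invf_le1 // ltW // (rho_gt1 R odd_q).
have w0 : 0 <= w ^+ s g by exact: (w_ge0 R odd_q).
rewrite !cnormM -(rmorphB (real_complex R)) -(rmorphXn (real_complex R)) !cnormC.
rewrite cnormX cnorm_nat [`|w ^+ _|]ger0_norm //.
have n1 : 1 <= (g.+1%:R : R) by rewrite ler1n.
apply: le_trans (_ : K * rho ^+ (9 * g) * (g.+1%:R ^+ mu * rho ^- (2 * g)) <= _).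
  apply: ler_pM => //; first by rewrite mulr_ge0 // exprn_ge0.
  apply: (ler_pM _ w0 _ wr); first by rewrite exprn_ge0.
  by apply: ler_weXn2l => //; lia.
rewrite /error_scale -mulrA; apply: ler_wpM2l => //.
have -> : (9 * g = 2 * g + 7 * g)%N by lia.
have rn : rho ^+ (2 * g) != 0 by rewrite expf_neq0 // gt_eqF.
rewrite exprD; move: (rho ^+ (2 * g)) (rho ^+ (7 * g)) (g.+1%:R ^+ mu) rn => x y z rn.
by rewrite (_ : x * y * (z / x) = z * y) //; field.
Qed.

Lemma linformB_dominated : dominated (fun g =>
  linform g (fun c => wsum c g g) (fun c => wsum c g g.-1) (usum g g) (usum g g.-1) -
  linform g (fun c => wsum_main c g g) (fun c => wsum_main c g g.-1) (usum_main g g) (usum_main g g.-1)).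
Proof.
have h0 g : (0 < g)%N -> (g <= g)%N && (g <= g.+1)%N by rewrite leqnn leqnSn.
have h1 g : (0 < g)%N -> (g.-1 <= g)%N && (g <= g.-1.+1)%N by lia.
have h2 g : (0 < g)%N -> (g <= g <= g.+1)%N by rewrite leqnn leqnSn.
have h3 g : (0 < g)%N -> (g.-1 <= g <= g)%N by lia.
have D1 := @dominated_weighted mu 0 id (leqnn _) h0.
have D2 := dominatedZ (-1) (@dominated_unweighted 0 id succn (leq0n _) h2).
have D3 (b : 'I_mu.+1) (c : 'I_(mu - b).+1) : dominated (fun g =>
    'C(mu, b)%:R * 'C(mu - b, c)%:R * (-1) ^+ c * delta_deriv b *
    ((2 * g)%:R ^+ (mu - b - c) * ((wsum c g g.-1)%:C - (wsum_main c g g.-1)%:C))).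
  have bc : (b + c <= mu)%N by have := ltn_ord b; have := ltn_ord c; lia.
  apply: dominatedZ.
  have [K K0 HK] := dominated_weighted bc h1.
  exists (2 ^+ (mu - b - c) * K) => [|g g0]; first by rewrite mulr_ge0 // exprn_ge0.
  have := HK g g0; rewrite !cnormM !cnormX !cnorm_nat natrM exprMn -!mulrA.
  have G1 : (g%:R : R) ^+ (mu - b - c) <= g.+1%:R ^+ (mu - b - c).
    by rewrite lerXn2r ?nnegrE // ler_nat.
  move=> H; apply: ler_wpM2l; first by rewrite exprn_ge0.
  by apply: le_trans H; apply: ler_wpM2r G1; exact: cnorm_ge0.
have D4 (i : 'I_mu.+1) : dominated (fun g => ('C(mu, i)%:R * delta_deriv i) *
    (((usum g g.-1)%:C - (usum_main g g.-1)%:C) * (g%:R ^+ (mu - i) * w%:C ^+ g))).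
  apply: dominatedZ.
  have [K K0 HK] := @dominated_unweighted i predn id (leq_ord i) h3.
  exists K => // g g0; apply: le_trans (HK g g0).
  rewrite cnormM [leRHS]cnormM; apply: ler_wpM2l; first exact: cnorm_ge0.
  rewrite cnormM [leRHS]cnormM; apply: ler_wpM2r; first exact: cnorm_ge0.
  by rewrite !cnormX !cnorm_nat lerXn2r ?nnegrE // ler_nat.
have D := dominatedD (dominatedD D1 D2) (dominatedD
  (dominated_sum (fun b => dominated_sum (D3 b))) (dominatedZ (-1) (dominated_sum D4))).
move: D; congr dominated; apply/funext => g.
rewrite /linform /dform.
have -> : \sum_(i < mu.+1) 'C(mu, i)%:R * delta_deriv i * (((usum g g.-1)%:C - (usum_main g g.-1)%:C) *
    (g%:R ^+ (mu - i) * w%:C ^+ g)) =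
  ((usum g g.-1)%:C - (usum_main g g.-1)%:C) * (w%:C ^+ g *
  \sum_(i < mu.+1) 'C(mu, i)%:R * (delta_deriv i * g%:R ^+ (mu - i))).
  rewrite mulrA mulr_sumr; apply: eq_bigr => i _.
  move: ((usum _ _)%:C - _) ('C(_, _)%:R : C) (delta_deriv i) ((g%:R : C) ^+ _) (w%:C ^+ _).
  by move=> x1 x2 x3 x4 x5; ring.
have -> : \sum_(b < mu.+1) \sum_(c < (mu - b).+1)
    'C(mu, b)%:R * 'C(mu - b, c)%:R * (-1) ^+ c * delta_deriv b *
    ((2 * g)%:R ^+ (mu - b - c) * ((wsum c g g.-1)%:C - (wsum_main c g g.-1)%:C)) =
  \sum_(b < mu.+1) \sum_(c < (mu - b).+1) trinomial_term g (fun c => wsum c g g.-1) b c -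
  \sum_(b < mu.+1) \sum_(c < (mu - b).+1) trinomial_term g (fun c => wsum_main c g g.-1) b c.
  rewrite -sumrB; apply: eq_bigr => b _; rewrite -sumrB; apply: eq_bigr => c _.
  rewrite /trinomial_term.
  move: ('C(mu, b)%:R : C) ('C(mu - b, c)%:R : C) ((-1 : C) ^+ c) (delta_deriv b)
    (((2 * g)%N%:R : C) ^+ _) ((wsum _ _ _)%:C) ((wsum_main _ _ _)%:C).
  by move=> x1 x2 x3 x4 x5 x6 x7; ring.
rewrite !subn0 subnn expr0 mul1r.
move: (w%:C ^+ g.+1) (w%:C ^+ g) (\sum_(i < mu.+1) 'C(mu, i)%:R * _)
  (\sum_(b < mu.+1) \sum_(c < (mu - b).+1) trinomial_term g (fun c => wsum c g g.-1) b c)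
  (\sum_(b < mu.+1) \sum_(c < (mu - b).+1) trinomial_term g (fun c => wsum_main c g g.-1) b c)
  ((g.+1%:R : C) ^+ mu).
move=> x1 x2 x3 x4 x5 x6; ring.
Qed.

End Assembly.

(** * Special values, and the error in terms of [|D|] *)

Section ErrorTerm.
Variables (R : realType) (F : finFieldType).
Hypothesis odd_q : odd #|F|.
Local Notation Q := (#|F|%:R : R).

Lemma zetaA2 : (@zetaA R F 2)^-1 = (1 - Q^-1)%:C.
Proof.
have q0 := Q_gt0 R odd_q.
have -> : zetaA F 2 = (1 - cpow Q (- 1))^-1 by rewrite /zetaA; congr (1 - cpow _ _)^-1; ring.
by rewrite invrK cpowN // cpow1 // rmorphB rmorph1 fmorphV.
Qed.

Lemma cpow_half (k n : nat) :
  cpow Q (k%:R - n%:R / 2) = (Q ^+ k)%:C * ((rq R F)^-1)%:C ^+ n.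
Proof.
have q0 := Q_gt0 R odd_q.
rewrite cpowD // -[k%:R]mulr1 cpowMn // cpow1 // rmorphXn; congr (_ * _).
by rewrite -(upow_half R odd_q) /upow -cpowMn // mulrN mul1r.
Qed.

(** In terms of [rho], [|D|^(7/8)] is [rho^(7(g+1))]. *)
Lemma error_scale_le mu g :
  error_scale R F mu g <= (Q ^+ (2 * g + 2)) `^ (7 / 8) *
    (ln (Q ^+ (2 * g + 2)) / ln Q) ^+ mu.
Proof.
have q0 := Q_gt0 R odd_q; have r0 := rho_gt0 R odd_q.
have l0 := lnq_gt0 R odd_q.
have -> : (Q ^+ (2 * g + 2)) `^ (7 / 8) = rho R F ^+ (7 * g.+1).
  rewrite -(rho4 R odd_q) -exprM -(powR_mulrn (4 * _)) ?ltW // -powRrM.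
  rewrite -(powR_mulrn (7 * _)) ?ltW //.
  by congr (_ `^ _); rewrite -[g.+1]addn1 !(natrM, natrD); field.
have -> : ln (Q ^+ (2 * g + 2)) / ln Q = (2 * g + 2)%:R.
  by rewrite lnXn // -[_ *+ _]mulr_natr mulrAC divff ?mul1r // gt_eqF.
rewrite /error_scale mulrC; apply: ler_pM; rewrite ?exprn_ge0 ?(ltW r0) //.
  by apply: rho_exp_le => //; lia.
by rewrite lerXn2r ?nnegrE // ler_nat; lia.
Qed.

End ErrorTerm.

Theorem theorem3p2 (R : realType) (F : finFieldType) (mu : nat)
    (odd_q : odd #|F|) (mu_gt0 : (0 < mu)%N) :
  let q : R := #|F|%:R in
  let lnq : R[i] := (ln q)%:C in
  let half : R[i] := 1 / 2 in
  let absD (g : nat) : R[i] := #|F|%:R ^+ (2 * g + 2) in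
  let G1 : R[i] := Gfun F 1 in
  let dG (m : nat) : R[i] := derive1n m (@Gfun R F) 1 / (- lnq) ^+ m in
  let ddelta (b : nat) : R[i] := derive1n b (@delta R F) half in
  let J (k n : nat) : R[i] := (power_sum k n)%:R in
  let j (k m : nat) : R[i] := ratr (power_sum_coef k m) in
  let trinomial (a b c : nat) : R[i] :=
    (-1) ^+ c * mu`!%:R / (a`! * b`! * c`!)%:R in
  let moment (g : nat) : R[i] :=
    \sum_(D in monic_square_frees F (2 * g + 2))
      derive1n mu (@L_chi R F (val D)) half / (- lnq) ^+ mu in
  let main (g : nat) : R[i] :=
    2 ^+ mu * absD g / zetaA F 2 * (G1 * J mu (g %/ 2)%N + dG mu)
    - 2 ^+ mu * absD g / zetaA F 2 *
        (\sum_(1 <= n < mu.+2) j mu n * dG n)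
    - g.+1%:R ^+ mu * G1 * absD g *
        cpow q ((g %/ 2)%:R - g.+1%:R / 2)
    + 2 ^+ mu * absD g / zetaA F 2 *
        (\sum_(a < mu.+1) \sum_(b < mu.+1) \sum_(c < mu.+1 | (a + b + c == mu)%N)
          trinomial a b c * (g%:R ^+ a * ddelta b / (- 2 * lnq) ^+ b) *
          (G1 * J c ((g - 1) %/ 2)%N + dG c))
    - 2 ^+ mu * absD g / zetaA F 2 *
        (\sum_(a < mu.+1) \sum_(b < mu.+1) \sum_(c < mu.+1 | (a + b + c == mu)%N)
          trinomial a b c * (g%:R ^+ a * ddelta b / (- 2 * lnq) ^+ b) *
          (\sum_(1 <= n < c.+2) j c n * dG n))
    - G1 * absD g * cpow q (((g - 1) %/ 2)%:R - g%:R / 2) *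
        (\sum_(0 <= m < mu.+1)
          'C(mu, m)%:R * (g%:R ^+ (mu - m) * ddelta m / (- lnq) ^+ m)) in
  let error (g : nat) : R[i] :=
    ((q ^+ (2 * g + 2)) `^ (7 / 8) *
     (ln (q ^+ (2 * g + 2)) / ln q) ^+ mu)%:C in
  (fun g : nat => moment g - main g : R[i]^o) =O_\oo
  (fun g : nat => error g : R[i]^o).
Proof.
move=> q lnq half absD G1 dG ddelta J j trinomial moment main error.
have lnq0 : lnq != 0 by rewrite -oppr_eq0; exact: (neg_lnq_neq0 R odd_q).
have dGE m : dG m = (gam R F m)%:C by exact: derive1n_Gfun.
have G1E : G1 = (gam R F 0)%:C by exact: Gfun1.
have ddE b : ddelta b / (- lnq) ^+ b = delta_deriv R F b.
  rewrite /ddelta /delta_deriv -deltas0.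
  exact: (derive1n_tower b (@open_half_plane R) (neg_lnq_neq0 R odd_q)
    (@tower_deltas R F odd_q) (half_half_plane R)).
have E g : (0 < g)%N -> moment g - main g =
  linform F mu g (fun c => wsum R F c g g) (fun c => wsum R F c g g.-1)
    (usum R F g g) (usum R F g g.-1) -
  linform F mu g (fun c => wsum_main R F c g g) (fun c => wsum_main R F c g g.-1)
    (usum_main R F g g) (usum_main R F g g.-1).
  move=> g0; rewrite -moment_linform //; congr (_ - _).
  have gE : (2 * g + 2 = g.+1.*2)%N by lia.
  rewrite /main G1E subn1.
  apply: (main_linform odd_q mu _ _ dGE lnq0 ddE).
  - by rewrite /absD gE rmorphXn rmorph_nat.
  - by rewrite /absD gE zetaA2 // /Cdens rmorphM rmorphXn rmorph_nat.
  - exact: cpow_half.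
  - exact: cpow_half.
have [K K0 HK] := linformB_dominated R odd_q mu.
apply/eqO_exP; exists (K + 1)%:C; first by rewrite ltcR ltr_wpDl.
(* For [g = 0] the sums over [n < g], written with the upper end [g.-1], would not be empty. *)
exists 1%N => // g /= g0; rewrite E // !cnormE -rmorphM lecR.
apply: le_trans (HK g g0) _.
have e0 := error_scale_ge0 R odd_q mu g; have le1 := error_scale_le R odd_q mu g.
rewrite /error cnormC ger0_norm ?(le_trans e0 le1) //.
apply: le_trans (ler_wpM2l K0 le1) _.
by apply: ler_wpM2r; [exact: le_trans le1 | rewrite lerDl].
Qed.
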